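(* Let $\varepsilon>0$, $\alpha\in(0,1)$, $\beta=4n/\varepsilon$. There is a choice of interval length $$T=\exp\big(\Theta(\beta nV)\big)\,\Theta\!\Big(\frac{(\beta V+\alpha)n^2}{\beta\varepsilon}\Big)$$ (with universal implicit constants) such that, under Congestion Control Algorithm 2 with these parameters (described in the context), the queue lengths satisfy $$Q_i(t)\le\frac{T(\beta V+2\alpha)}{\alpha}\qquad\text{for all }t\ge0\text{ and all }i.$$ Further, with $\tilde\lambda_i(J)=\frac1J\sum_{j=0}^{J-1}\lambda_i(j)$, $$\liminf_{J\to\infty}\Big(\sum_iU_i(\tilde\lambda_i(J))\Big)\ \ge\ \Big(\sum_iU_i(\lambda_i^* )\Big)-\varepsilon\qquad\text{with probability }1,$$ where $\boldsymbol\lambda^*$ is the solution of the utility maximization problem: maximize $\sum_{i=1}^nU_i(\lambda_i)$ over $\boldsymbol\lambda\in\boldsymbol\Lambda$.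
   Context: **Network.** $G=(V_G,E)$ is a finite graph with vertex set $V_G=\{1,\dots,n\}$; $\mathcal N(i)=\{j:(i,j)\in E\}$; $\mathcal I(G)=\{\boldsymbol\rho\in\{0,1\}^n:\rho_i+\rho_j\le 1\ \forall (i,j)\in E\}$. $\boldsymbol\sigma(t)\in\mathcal I(G)$ is the schedule ($\sigma_i(t)=1$ iff node $i$ is transmitting at time $t\in\mathbb R_+$). Queues $\mathbf Q(t)\in\mathbb R_+^n$ start with $\mathbf Q(0)=\mathbf 0$ and satisfy, for $0\le s<t$, $Q_i(t)=Q_i(s)-\int_s^t\sigma_i(u)\mathbf 1_{\{Q_i(u)>0\}}du+A_i(s,t)$, where $A_i(s,t)$ is the work arriving to queue $i$ during $(s,t]$. **Capacity.** $\mathcal C$ is the convex hull of $\mathcal I(G)$; $\boldsymbol\Lambda=\{\boldsymbol\lambda\in\mathbb R_+^n:\boldsymbol\lambda\le\gamma\text{ componentwise for some }\gamma\in\mathcal C\}$. **Utilities.** Each $U_i:[0,1]\to\mathbb R$ is strictly concave, increasing (and differentiable), and $V=\max_iU_i'(0)<\infty$. **CSMA dynamics.** Node $i$ has a parameter $r_i(t)$. A waiting node $i$ ($\sigma_i=0$) has a clock ringing at rate $\exp(r_i(t))$; when it rings, $\sigma_i$ becomes $1$ if $\sigma_k=0$ for all $k\in\mathcal N(i)$, and otherwise a new waiting period starts. A transmission lasts an exponential time of mean $1$, after which $\sigma_i$ becomes $0$. All clocks are independent. **Congestion Control Algorithm 2.** On $[jT,(j+1)T)$, $j\in\mathbb Z_+$,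 the parameters are constant, $r_i(t)=r_i(j)$, and data is generated at node $i$ deterministically at rate $\lambda_i(j)$, i.e. $A_i(s,t)=\int_s^t\lambda_i(u)du$ with $\lambda_i(u)=\lambda_i(j)$ for $u\in[jT,(j+1)T)$. Initially $\mathbf r(0)=\mathbf 0$, $\boldsymbol\lambda(0)=\mathbf 1$, and for all $i$ $$r_i(j+1)=\big[r_i(j)-\alpha\widehat s_i(j)\big]_++\alpha\lambda_i(j),\qquad \lambda_i(j+1)=\arg\max_{y\in[0,1]}\big(\beta U_i(y)-r_i(j+1)y\big),$$ where $\widehat s_i(j)=\frac1T\int_{jT}^{(j+1)T}\sigma_i(t)dt$ and $[x]_+=\max(x,0)$.
   Formalization: The queue equation has no solution when an empty queue is served while data arrives at a rate in (0,1]; so the departure rate is only required to lie between 0 and σ_i(u), and to equal σ_i(u) when Q_i(u)>0, which includes every solution of the equation as written. *)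

(* Defs.v *)
From HB Require Import structures.
From mathcomp Require Import all_boot all_order all_algebra.
From mathcomp Require Import all_classical all_reals all_analysis.

Set Implicit Arguments.
Unset Strict Implicit.
Unset Printing Implicit Defensive.

Import Order.TTheory GRing.Theory Num.Theory.
Import numFieldNormedType.Exports.

Local Open Scope classical_set_scope.
Local Open Scope ring_scope.

Definition schedules (n : nat) (E : rel 'I_n) : {set {ffun 'I_n -> bool}} :=
  [set rho : {ffun 'I_n -> bool} |
    [forall i, forall j, E i j ==> (rho i + rho j <= 1)%N]].

Definition schedule_hull (R : realType) (n : nat) (E : rel 'I_n) :
    set ('I_n -> R) :=
  [set g | exists w : {ffun 'I_n -> bool} -> R,
    [/\ forall rho, 0 <= w rho,
        \sum_(rho in schedules E) w rho = 1 &
        forall i, g i = \sum_(rho in schedules E) w rho * (rho i)%:R]].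

Definition capacity (R : realType) (n : nat) (E : rel 'I_n) :
    set ('I_n -> R) :=
  [set l | (forall i, 0 <= l i) /\
    exists2 g, schedule_hull E g & forall i, l i <= g i].

(* Only the restriction to [0, 1] of a utility U : R -> R is ever used; in
   particular derivatives are taken within [0, 1], hence are one-sided at the
   endpoints. *)
Definition slope (R : realType) (U : R -> R) (x y : R) : R :=
  (U y - U x) / (y - x).

Definition differentiable01 (R : realType) (U : R -> R) : Prop :=
  forall x, x \in `[0, 1] ->
    cvg (slope U x y @[y --> within `[0, 1] x^']).

Definition deriv01 (R : realType) (U : R -> R) (x : R) : R :=
  lim (slope U x y @[y --> within `[0, 1] x^']).

Definition strictly_concave01 (R : realType) (U : R -> R) : Prop :=
  forall x y t, x \in `[0, 1] -> y \in `[0, 1] -> x != y -> 0 < t < 1 ->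
    t * U x + (1 - t) * U y < U (t * x + (1 - t) * y).

Record utility (R : realType) (U : R -> R) : Prop := Utility {
  utility_concave : strictly_concave01 U ;
  utility_increasing :
    forall x y, x \in `[0, 1] -> y \in `[0, 1] -> x < y -> U x < U y ;
  utility_differentiable : differentiable01 U }.

(* Starting the maximum from 0 is harmless: these derivatives are nonnegative
   for increasing utilities. *)
Definition max_slope (R : realType) (n : nat) (U : 'I_n -> R -> R) : R :=
  \big[Num.max/0]_(i < n) deriv01 (U i) 0.

Definition utility_optimum (R : realType) (n : nat) (E : rel 'I_n)
    (U : 'I_n -> R -> R) (lstar : 'I_n -> R) : Prop :=
  capacity E lstar /\
  forall l, capacity E l -> \sum_(i < n) U i (l i) <= \sum_(i < n) U i (lstar i).

Definition time_integral (R : realType) (s t : R) (f : R -> R) : R :=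
  \int[@lebesgue_measure R]_(u in `[s, t]) f u.

(* The function of time equal to [x j] on [jT, (j+1)T). *)
Definition held (R : realType) (T : R) (x : nat -> R) (u : R) : R :=
  x (Num.truncn (u / T)).

(* Sample path of the CSMA dynamics.  Each node goes through successive
   periods [tau i k, tau i k.+1), during which it is either waiting or
   transmitting; each period is timed by its own clock, driven by the unit
   exponential variable [xi i k].  A clock of time-varying rate rings when its
   accumulated rate reaches [xi i k].  Schedules are right-continuous and a
   ringing node looks at its neighbours' state at the ringing time: simultaneous
   events form a null set, and this convention keeps schedules feasible even
   then.  The condition [csma_cover] excludes explosion. *)
Record csma_path (R : realType) (n : nat) (E : rel 'I_n) (r : 'I_n -> R -> R)
    (xi : 'I_n -> nat -> R) (sigma : R -> {ffun 'I_n -> bool})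
    (tau : 'I_n -> nat -> R) : Prop := CsmaPath {
  csma_feasible : forall t, 0 <= t -> sigma t \in schedules E ;
  csma_start : forall i, tau i 0%N = 0 ;
  csma_increasing : forall i k, tau i k < tau i k.+1 ;
  csma_cover : forall i t, 0 <= t -> exists k, tau i k <= t < tau i k.+1 ;
  csma_const : forall i k t, tau i k <= t < tau i k.+1 ->
    sigma t i = sigma (tau i k) i ;
  csma_transmit : forall i k, sigma (tau i k) i ->
    tau i k.+1 - tau i k = xi i k /\ sigma (tau i k.+1) i = false ;
  csma_wait : forall i k, ~~ sigma (tau i k) i ->
    time_integral (tau i k) (tau i k.+1) (fun t => expR (r i t)) = xi i k /\
    sigma (tau i k.+1) i =
      [forall m, E i m ==> ~~ sigma (tau i k.+1) m] }.

(* Queue with arrival rate [lam t], served while [sigma t].  The literal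
   departure rate  sigma t * 1_{Q t > 0}  admits no solution with fluid
   arrivals once an empty queue is served while 0 < lam <= 1: work then leaves
   as it arrives, at rate lam.  So the departure rate
   [dep] is only required to lie in [0, sigma t], and to equal [sigma t] when
   the queue is nonempty.  Solutions of the literal equation are the particular
   case dep = sigma * 1_{Q > 0}. *)
Definition queue_path (R : realType) (lam : R -> R) (sigma : R -> bool)
    (Q : R -> R) : Prop :=
  [/\ Q 0 = 0,
      forall t, 0 <= t -> 0 <= Q t &
      exists dep : R -> R,
        [/\ measurable_fun setT dep,
            forall t, 0 <= t -> 0 <= dep t <= (sigma t)%:R,
            forall t, 0 <= t -> 0 < Q t -> dep t = (sigma t)%:R &
            forall s t, 0 <= s -> s < t ->
              Q t = Q s - time_integral s t dep + time_integral s t lam]].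

(* The initial schedule may be random; [clocks_indep] makes the whole family of
   clock variables mutually independent and independent of it. *)
Record clocks (R : realType) (n : nat) (d : measure_display)
    (Omega : measurableType d) (P : probability Omega R)
    (xi : 'I_n -> nat -> {RV P >-> R})
    (sigma0 : Omega -> {ffun 'I_n -> bool}) : Prop := Clocks {
  clocks_exp : forall i k (B : set R), measurable B ->
    distribution P (xi i k) B = exponential_prob 1 B ;
  clocks_indep : forall (rho : {ffun 'I_n -> bool}) (s : seq ('I_n * nat))
      (B : 'I_n * nat -> set R), uniq s -> (forall p, measurable (B p)) ->
    P ([set w | sigma0 w = rho] `&`
       \bigcap_(p in [set` s]) (xi p.1 p.2 @^-1` B p)) =
    (P [set w | sigma0 w = rho] *
     \prod_(p <- s) P (xi p.1 p.2 @^-1` B p))%E }.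

Definition argmax01 (R : realType) (f : R -> R) (y : R) : Prop :=
  y \in `[0, 1] /\ forall z, z \in `[0, 1] -> f z <= f y.

Definition service (R : realType) (n : nat) (T : R)
    (sigma : R -> {ffun 'I_n -> bool}) (i : 'I_n) (j : nat) : R :=
  T^-1 * time_integral (j%:R * T) (j.+1%:R * T) (fun t => (sigma t i)%:R).

Record parameter_path (R : realType) (n : nat) (U : 'I_n -> R -> R)
    (alpha beta T : R) (sigma : R -> {ffun 'I_n -> bool})
    (r lam : 'I_n -> nat -> R) : Prop := ParameterPath {
  r_init : forall i, r i 0%N = 0 ;
  lam_init : forall i, lam i 0%N = 1 ;
  r_update : forall i j,
    r i j.+1 = Num.max (r i j - alpha * service T sigma i j) 0
               + alpha * lam i j ;
  lam_update : forall i j,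
    argmax01 (fun y => beta * U i y - r i j.+1 * y) (lam i j.+1) }.

(* The dynamics are required on every sample path: this amounts to discarding
   from Omega the null event on which they fail. *)
Record congestion_control (R : realType) (n : nat) (E : rel 'I_n)
    (U : 'I_n -> R -> R) (alpha beta T : R) (d : measure_display)
    (Omega : measurableType d) (P : probability Omega R)
    (xi : 'I_n -> nat -> {RV P >-> R})
    (sigma : Omega -> R -> {ffun 'I_n -> bool})
    (r lam : Omega -> 'I_n -> nat -> R)
    (Q : Omega -> 'I_n -> R -> R) : Prop := CongestionControl {
  cc_measurable : forall t rho, 0 <= t -> measurable [set w | sigma w t = rho] ;
  cc_clocks : clocks xi (fun w => sigma w 0) ;
  cc_csma : forall w, exists tau,
    csma_path E (fun i => held T (r w i)) (fun i k => xi i k w) (sigma w) tau ;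
  cc_parameters : forall w,
    parameter_path U alpha beta T (sigma w) (r w) (lam w) ;
  cc_queue : forall w i,
    queue_path (held T (lam w i)) (fun t => sigma w t i) (Q w i) }.

Definition average (R : realType) (x : nat -> R) (J : nat) : R :=
  J%:R^-1 * \sum_(0 <= j < J) x j.

(* Main.v *)
(* If [n V <= eps] the utilities oscillate by at most [eps] and there is nothing
   to prove beyond the deterministic bound on the queues, which follows from
   [alpha Q_i <= T r_i] at slot ends and [r_i <= beta V + alpha].

   Otherwise, the Lyapunov function [sum_i r_i^2] reduces the utility bound to
   [sum_i r_i (s_i - l_i) >= - (2 + 3/4) n] on average over the slots, for every
   [l] in the capacity region, [s_i] being the empirical service rates.  For
   frozen [r] the schedule is a Markov chain with generator [L], reversible for
   the weights [expR (sum_i r_i sigma_i)] (up to normalization).  Let [u] be a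
   long Cesaro average of the iterates of [g = sum_i r_i sigma_i] under the
   uniformized chain; then [L f = g - u] for an explicit [f].  Since [L u] is
   small, so is the Dirichlet form of [u]; every schedule is joined to the empty
   one by at most [n] single-node moves, so [u] varies by at most [n / 2] around
   [u empty], and the Gibbs variational principle gives
   [u >= sum_i r_i l_i - 2 n].

   It remains to integrate [g - u] along the path.  By Dynkin's formula this is
   a telescoping sum, up to one jump of [f] per slot (absorbed by the factor
   [expR (9 beta n V)] in [T]), minus a sum of compensated clock rings.  Given
   the history, the residual exponential clocks are still exponential, so the
   compensated rings are orthogonal increments and obey a strong law of large
   numbers.  Orthogonality is proved by resampling a single clock. *)

Require Import Defs.
From HB Require Import structures.
From mathcomp Require Import all_boot all_order all_algebra.
From mathcomp Require Import all_classical all_reals all_analysis.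
From mathcomp Require Import measurable_realfun.
From mathcomp Require Import lra ring zify.

Set Implicit Arguments.
Unset Strict Implicit.
Unset Printing Implicit Defensive.

Import Order.TTheory GRing.Theory Num.Theory.
Import numFieldNormedType.Exports.

Local Open Scope classical_set_scope.
Local Open Scope ring_scope.

(** * The event-driven simulation of the network *)

(** No mixing time or spectral gap is estimated. The exact solution of the Poisson equation would
    call for one; with the Cesaro average [u] in place of the mean, [f] is bounded by counting
    terms, and a long average is nearly invariant for free. The price is an [N] proportional to
    [2 ^ n * expR (n * Rmax)], which the exponential factor in [T] pays for.

    The probabilistic obstacle is that no filtration is given to condition on, and neither the
    ringing times nor the parameters are assumed measurable in the sample point. So the path is
    recomputed by a deterministic program that reads the clocks. It is measurable in them and
    defined for all real clock values, so that a single clock can be replaced with the others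
    frozen; the history is the list of the first states of the program. It agrees with the given
    path when no tie occurs.

    The initial schedule is random but takes finitely many values: almost sure statements are proved
    for each fixed value and then intersected.

    The strong law is normalized by events, the goal by slots; the compensated number of rings
    itself shows that events are at most proportional to slots. *)

(* State of the network at an event, either the ringing of a clock or the end of
   a slot: [rem] is the time left in slot [slot]; node [i] is running its clock
   number [idx i], whose accumulated rate is [age i]; [par i] is the parameter
   [r_i] of the slot and [served i] the time node [i] has transmitted in it. *)
Record state (R : realType) (n : nat) := State {
  time : R ;
  rem : R ;
  slot : nat ;
  sched : {ffun 'I_n -> bool} ;
  idx : 'I_n -> nat ;
  age : 'I_n -> R ;
  par : 'I_n -> R ;
  served : 'I_n -> R }.

Definition flip (n : nat) (E : rel 'I_n) (s : {ffun 'I_n -> bool}) (i : 'I_n) :=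
  ~~ s i && [forall m, E i m ==> ~~ s m].

Definition rate (R : realType) (n : nat) (H : state R n) (i : 'I_n) : R :=
  if sched H i then 1 else expR (par H i).

(** Truncating at 0 keeps time from running backwards for arbitrary real clock values, negative ones
    included. *)
Definition gap (R : realType) (n : nat) (z : 'I_n * nat -> R) (H : state R n)
    (i : 'I_n) : R :=
  Num.max 0 ((z (i, idx H i) - age H i) / rate H i).

(* The time to the next event if node [i] is ignored: [gap] and [other_gap] of
   the same node are driven by independent clocks. *)
Definition other_gap (R : realType) (n : nat) (z : 'I_n * nat -> R)
    (H : state R n) (i : 'I_n) : R :=
  \big[Num.min/rem H]_(k < n | k != i) gap z H k.

(* At most one node rings; in case of a tie none does.  Ties have probability 0
   (lemma [no_ties]). *)
Definition rings (R : realType) (n : nat) (z : 'I_n * nat -> R)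
    (H : state R n) (i : 'I_n) : bool :=
  gap z H i < other_gap z H i.

Definition step_len (R : realType) (n : nat) (z : 'I_n * nat -> R)
    (H : state R n) : R :=
  \big[Num.min/rem H]_(k < n) gap z H k.

(** A step without ringing node is read as the end of the slot. A tie for the first event is misread
    in this way too, which is harmless: all bounds on the state survive, and ties are null. *)
Definition next (R : realType) (n : nat) (E : rel 'I_n) (T : R)
    (upd : 'I_n -> R -> R -> R) (z : 'I_n * nat -> R) (H : state R n) :=
  let D := step_len z H in
  let e := [exists i, rings z H i] in
  State (time H + D) (if e then rem H - D else T)
    (if e then slot H else (slot H).+1)
    [ffun i => if rings z H i then flip E (sched H) i else sched H i]
    (fun i => (idx H i + rings z H i)%N)
    (fun i => if rings z H i then 0 else age H i + rate H i * D)
    (fun i => if e then par H i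
              else upd i (par H i) (served H i + (sched H i)%:R * D))
    (fun i => if e then served H i + (sched H i)%:R * D else 0).

Definition init (R : realType) (n : nat) (T : R) (rho : {ffun 'I_n -> bool}) :=
  State 0 T 0 rho (fun=> 0%N) (fun=> 0) (fun=> 0) (fun=> 0).

Definition run (R : realType) (n : nat) (E : rel 'I_n) (T : R)
    (upd : 'I_n -> R -> R -> R) (rho : {ffun 'I_n -> bool})
    (z : 'I_n * nat -> R) (m : nat) : state R n :=
  iter m (next E T upd z) (init T rho).

Definition set_clock (R : realType) (n : nat) (p : 'I_n * nat) (x : R)
    (z : 'I_n * nat -> R) : 'I_n * nat -> R :=
  fun q => if q == p then x else z q.

Section Simulator.
Variables (R : realType) (n : nat) (E : rel 'I_n) (T : R).
Variables (upd : 'I_n -> R -> R -> R).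
Hypothesis T0 : 0 <= T.
Implicit Types (z : 'I_n * nat -> R) (H : state R n).

Lemma rate_gt0 H i : 0 < rate H i.
Proof. by rewrite /rate; case: ifP => // _; exact: expR_gt0. Qed.

Lemma gap_ge0 z H i : 0 <= gap z H i.
Proof. by rewrite /gap le_max lexx. Qed.

Lemma step_len_ge0 z H : 0 <= rem H -> 0 <= step_len z H.
Proof.
move=> H0; rewrite /step_len; elim/big_ind: _ => [//|x y x0 y0|i _]; last exact: gap_ge0.
by rewrite le_min x0.
Qed.

Lemma step_len_le_rem z H : step_len z H <= rem H.
Proof. exact: bigmin_le_id. Qed.

Lemma step_lenE z H i : step_len z H = Num.min (gap z H i) (other_gap z H i).
Proof. by rewrite /step_len (bigminD1 i). Qed.

Lemma rem_next z H : 0 <= rem H <= T -> 0 <= rem (next E T upd z H) <= T.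
Proof.
move=> /andP[H0 HT] /=; case: ifP => _; last by rewrite T0 lexx.
rewrite subr_ge0 step_len_le_rem/= lerBlDr (le_trans HT)// lerDl.
exact: step_len_ge0.
Qed.

Lemma rem_run rho z m : 0 <= rem (run E T upd rho z m) <= T.
Proof. by elim: m => [|m IH] /=; [rewrite T0 lexx|exact: rem_next]. Qed.

Lemma rings_lt z H i j : rings z H i -> j != i -> gap z H i < gap z H j.
Proof.
rewrite /rings /other_gap => h ji; apply: lt_le_trans h _.
exact: bigmin_le_cond.
Qed.

Lemma rings_inj z H i j : rings z H i -> rings z H j -> i = j.
Proof.
move=> hi hj; apply/eqP/negPn/negP => ij.
have ji : j != i by rewrite eq_sym.
by have := lt_trans (rings_lt hj ij) (rings_lt hi ji); rewrite ltxx.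
Qed.

Lemma other_gapD1 z H i k : k != i ->
  other_gap z H i =
    Num.min (gap z H k) (\big[Num.min/rem H]_(l < n | (l != i) && (l != k)) gap z H l).
Proof. by move=> ki; rewrite /other_gap (bigminD1 k). Qed.

Lemma next_ext z z' H : gap z H = gap z' H -> next E T upd z H = next E T upd z' H.
Proof. by move=> e; rewrite /next /rings /step_len /other_gap e. Qed.

(** A clock that comes strictly after some other event neither rings nor sets the length of the
    step, so its exact value is invisible. *)
Lemma next_ext_late z z' H i :
  (forall k, k != i -> gap z H k = gap z' H k) ->
  other_gap z H i < gap z H i -> other_gap z' H i < gap z' H i ->
  next E T upd z H = next E T upd z' H.
Proof.
move=> e lt lt'.
have eo : other_gap z H i = other_gap z' H i.
  by apply: eq_bigr => k /e.
have aux y y' k : (forall k, k != i -> gap y H k = gap y' H k) ->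
    other_gap y' H i < gap y' H i -> k != i ->
    rings y H k -> rings y' H k.
  move=> ey ly ki; have ik : i != k by rewrite eq_sym.
  rewrite /rings (other_gapD1 _ _ ik) (other_gapD1 y' _ ik) -ey// !lt_min.
  have -> : \big[Num.min/rem H]_(l < n | (l != k) && (l != i)) gap y' H l =
            \big[Num.min/rem H]_(l < n | (l != k) && (l != i)) gap y H l.
    by apply: eq_bigr => l /andP[_ /ey].
  move=> /andP[_ h]; rewrite h andbT.
  apply: le_lt_trans ly; rewrite (other_gapD1 _ _ ki) -ey// le_min lexx/=.
  have -> : \big[Num.min/rem H]_(l < n | (l != i) && (l != k)) gap y' H l =
            \big[Num.min/rem H]_(l < n | (l != k) && (l != i)) gap y H l.
    by apply: eq_big => [l|l /andP[/ey]]; first by rewrite andbC.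
  exact: ltW.
have er : rings z H = rings z' H.
  apply/funext => k; have [->|ki] := eqVneq k i.
    by rewrite /rings !ltNge !ltW.
  apply/idP/idP; apply: aux => //.
  by move=> l li; rewrite e.
have es : step_len z H = step_len z' H.
  by rewrite !(step_lenE _ _ i) eo !min_r// ltW// -eo.
by rewrite /next er es.
Qed.

Lemma gap_set_clock z H p x k : (k, idx H k) != p ->
  gap (set_clock p x z) H k = gap z H k.
Proof. by rewrite /gap /set_clock => /negbTE ->. Qed.

Lemma gap_set_clock_eq z H i x :
  gap (set_clock (i, idx H i) x z) H i = Num.max 0 ((x - age H i) / rate H i).
Proof. by rewrite /gap /set_clock eqxx. Qed.

Lemma other_gap_set_clock z H i c x :
  other_gap (set_clock (i, c) x z) H i = other_gap z H i.
Proof.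
apply: eq_bigr => k ki; apply: gap_set_clock.
by apply: contra ki => /eqP[->].
Qed.

Lemma idx_next z H i : idx (next E T upd z H) i = (idx H i + rings z H i)%N.
Proof. by []. Qed.

Lemma idx_run rho z m i :
  (idx (run E T upd rho z m.+1) i =
   idx (run E T upd rho z m) i + rings z (run E T upd rho z m) i)%N.
Proof. by []. Qed.

Lemma idx_run_le rho z m i : (idx (run E T upd rho z m) i <= m)%N.
Proof.
elim: m => // m IH; rewrite idx_run -addn1 leq_add//.
by case: rings.
Qed.

Lemma other_gap_ge0 z H i : 0 <= rem H -> 0 <= other_gap z H i.
Proof.
move=> H0; rewrite /other_gap; elim/big_ind: _ => [//|x y x0 y0|k _].
  by rewrite le_min x0.
exact: gap_ge0.
Qed.

(* As a function of the value [x] of the clock [(i, c)], the first [m] events do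
   not depend on [x] as long as the clock has not rung.  So after [m] events
   either the clock has not been started, or it has rung if [x < a], while if
   [x > a] it is running, with age [a], in a state that does not depend on [x]. *)
Lemma run_set_clock (rho : {ffun 'I_n -> bool}) z i c m :
  let run_at x := run E T upd rho (set_clock (i, c) x z) in
  exists Hs : nat -> state R n, let H := Hs m in
  ((idx H i < c)%N /\ forall x k, (k <= m)%N -> run_at x k = Hs k) \/
  (exists N : seq R, [/\ idx H i = c, 0 <= age H i, 0 <= rem H, age H i \in N &
     forall x, 0 < x -> x \notin N ->
       (x < age H i -> (c < idx (run_at x m) i)%N) /\
       (age H i < x -> forall k, (k <= m)%N -> run_at x k = Hs k)]).
Proof.
move=> run_at.
elim: m => [|m [Hs [[Hc HH]|[N [Hc Ha Hr HN HH]]]]].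
- exists (fun=> init T rho).
  case: c @run_at => [|c] run_at; [right|left]; last first.
    by split=> // x k; rewrite leqn0 => /eqP->.
  exists [:: 0]; split=> //=; first by rewrite mem_head.
  move=> x x0 _; split=> [|_ k]; first by rewrite ltNge ltW.
  by rewrite leqn0 => /eqP->.
- pose H := Hs m.
  have e x : run_at x m.+1 = next E T upd z H.
    rewrite /run_at /run iterS -/(run _ _ _ _ _ _) -/(run_at x m) HH//.
    apply: next_ext; apply/funext => k.
    apply: gap_set_clock; apply/eqP => -[ki]; rewrite ki => ic.
    by rewrite -/H ic ltnn in Hc.
  set H' := next E T upd z H in e.
  pose Hs' k := if (k <= m)%N then Hs k else H'.
  have Hs'm : Hs' m.+1 = H' by rewrite /Hs' ltnn.
  have eHs' x k : (k <= m.+1)%N -> run_at x k = Hs' k.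
    rewrite leq_eqVlt ltnS /Hs' => /orP[/eqP->|km]; first by rewrite ltnn.
    by rewrite km HH.
  exists Hs'; rewrite Hs'm.
  have rH' : 0 <= rem H'.
    by have /andP[] := rem_run rho (set_clock (i, c) 0 z) m.+1; rewrite -/(run_at 0 m.+1) e.
  have [Hlt|Hge] := ltnP (idx H' i) c; first by left.
  right; exists [:: 0].
  have ri : rings z H i.
    by move: Hge; rewrite idx_next; case: rings => //; rewrite addn0 leqNgt Hc.
  have a0 : age H' i = 0 by rewrite /H' /= ri.
  split=> //; rewrite ?a0 ?mem_head//.
    by apply/eqP; rewrite eqn_leq Hge idx_next ri addn1 Hc.
  by move=> x x0 _; split=> [|_]; [rewrite ltNge ltW|exact: eHs'].
(* [a'] is the age that the clock reaches if the others act first: a value in ([age H i], [a'])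
   makes it ring in this step, a larger one lets it survive, and [a'] itself joins the exceptional
   values. *)
- pose H := Hs m; pose Y := other_gap z H i; pose a' := age H i + rate H i * Y.
  have Y0 : 0 <= Y by exact: other_gap_ge0.
  have aa' : age H i <= a' by rewrite /a' lerDl mulr_ge0// ltW// rate_gt0.
  have gE x : age H i < x ->
      gap (set_clock (i, c) x z) H i = (x - age H i) / rate H i.
    move=> ax; rewrite -Hc -/H gap_set_clock_eq max_r// divr_ge0//.
      by rewrite subr_ge0 ltW.
    exact/ltW/rate_gt0.
  have late x : a' < x ->
      other_gap (set_clock (i, c) x z) H i < gap (set_clock (i, c) x z) H i.
    move=> ax; rewrite gE ?(le_lt_trans aa')// other_gap_set_clock.
    by rewrite ltr_pdivlMr ?rate_gt0// mulrC ltrBrDl.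
  (* Any value beyond [a'] would define the same next state. *)
  pose H' := next E T upd (set_clock (i, c) (a' + 1) z) H.
  have ax0 : a' < a' + 1 by rewrite ltrDl.
  have nr : rings (set_clock (i, c) (a' + 1) z) H i = false.
    by rewrite /rings ltNge (ltW (late _ ax0)).
  have aH' : age H' i = a'.
    rewrite /H' /= nr (step_lenE _ _ i) min_r ?(ltW (late _ ax0))//.
    by rewrite other_gap_set_clock.
  exists (fun k => if (k <= m)%N then Hs k else H'); rewrite ltnn.
  right; exists (a' :: N); split.
  + by rewrite idx_next nr addn0.
  + by rewrite aH' (le_trans Ha).
  + rewrite /H' /=; case: ifP => // _.
    by rewrite subr_ge0 step_len_le_rem.
  + by rewrite aH' mem_head.
  + move=> x x0; rewrite inE negb_or => /andP[xa' xN].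
    rewrite aH'; have [h1 h2] := HH x x0 xN; split=> xa.
      rewrite /run_at idx_run -/(run_at x m).
      have : x != age H i by apply: contra xN => /eqP ->.
      rewrite neq_lt => /orP[/h1 ltc|ltx].
        by rewrite (leq_trans ltc)// leq_addr.
      rewrite (h2 ltx)// Hc -/H /rings gE// other_gap_set_clock.
      rewrite ltr_pdivrMr ?rate_gt0// mulrC ltrBlDl xa.
      by rewrite addn1.
    have ax := le_lt_trans aa' xa.
    move=> k; rewrite leq_eqVlt ltnS => /orP[/eqP->|km]; last by rewrite km h2.
    rewrite ltnn /run_at /run iterS -/(run _ _ _ _ _ _) -/(run_at x m) h2//.
    apply: (@next_ext_late _ _ _ i) => //; [|exact: late..].
    move=> l li; rewrite !gap_set_clock//; by apply: contra li => /eqP[->].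
Qed.

End Simulator.

(** * Resampling one clock *)

(** Finite-dimensional boxes: an intersection-stable family generating the product sigma-algebra, so
    that two laws of the clocks coincide once they agree on boxes, where independence gives a
    product. *)
Definition cylinders (R : realType) (n : nat) : set (set ('I_n * nat -> R)) :=
  [set C | exists (s : seq ('I_n * nat)) (B : 'I_n * nat -> set R),
     (forall p, measurable (B p)) /\
     C = [set z | forall p, p \in s -> B p (z p)]].

Notation clock_space R n := (g_sigma_algebraType (@cylinders R n)).

Lemma bounded_integrable (R : realType) d (X : measurableType d)
    (mu : probability X R) (f : X -> R) (M : R) :
  measurable_fun setT f -> (forall x, `|f x| <= M) ->
  mu.-integrable setT (EFin \o f).
Proof.
move=> mf fM; apply: measurable_bounded_integrable => //.
  by rewrite -ge0_fin_numE//; exact: fin_num_measure.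
exists M; split; first by rewrite num_real.
by move=> y My x _ /=; exact: le_trans (fM x) (ltW My).
Qed.

Lemma measurable_fun_true d (X : measurableType d) (f : X -> bool) :
  measurable_fun setT f -> measurable [set x | f x].
Proof. by move=> /(_ measurableT [set true] I); rewrite setTI. Qed.

Section ClockSpace.
Variables (R : realType) (n : nat).

Lemma cylinders_setI : setI_closed (@cylinders R n).
Proof.
move=> _ _ [s [B [mB ->]]] [s' [B' [mB' ->]]].
exists (s ++ s'), (fun p => (if p \in s then B p else setT) `&`
                   (if p \in s' then B' p else setT)); split.
  by move=> p; apply: measurableI; case: ifP.
apply/seteqP; split=> [z [h h'] p _|z h]; first split.
- by case: ifP => // /h.
- by case: ifP => // /h'.
- split=> p ps.
    by have := h p; rewrite mem_cat ps => /(_ isT)[].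
  by have := h p; rewrite mem_cat ps orbT => /(_ isT)[].
Qed.

Lemma measurable_clock p :
  measurable_fun setT (fun z : clock_space R n => z p).
Proof.
move=> _ B mB; rewrite setTI; apply: sub_sigma_algebra.
exists [:: p], (fun=> B); split=> //; apply/seteqP; split=> z /=.
  by move=> h q; rewrite inE => /eqP->.
by apply; rewrite mem_head.
Qed.

Lemma measurable_fun_clock_space d (X : measurableType d)
    (f : X -> clock_space R n) :
  (forall p, measurable_fun setT (fun x => f x p)) -> measurable_fun setT f.
Proof.
move=> mf; apply: measurability; first by [].
move=> _ [_ [s [B [mB ->]]] <-].
have -> : setT `&` f @^-1` [set z | forall p, p \in s -> B p (z p)] =
    \bigcap_(p in [set` s]) (setT `&` (fun x => f x p) @^-1` B p).
  apply/seteqP; split=> x /= => [[_ h] p ps|h]; first by split=> //; exact: h.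
  by split=> // p /h[].
apply: fin_bigcap_measurable => [|p _]; [exact: finite_seq|exact: mf].
Qed.

End ClockSpace.

Section Resample.
Variables (R : realType) (n : nat) (d : measure_display).
Variables (Omega : measurableType d) (P : probability Omega R).
Variable xi : 'I_n * nat -> {RV P >-> R}.
Hypothesis indep : forall (s : seq ('I_n * nat)) (B : 'I_n * nat -> set R),
  uniq s -> (forall p, measurable (B p)) ->
  P (\bigcap_(p in [set` s]) (xi p @^-1` B p)) =
  (\prod_(p <- s) P (xi p @^-1` B p))%E.

Definition clock_sample (w : Omega) : clock_space R n := fun p => xi p w.

Lemma measurable_clock_sample : measurable_fun setT clock_sample.
Proof.
by apply: measurable_fun_clock_space => p; exact: measurable_funP.
Qed.

Lemma measurable_set_clock p : measurable_fun setT
  (fun y : Omega * R => set_clock p y.2 (clock_sample y.1) : clock_space R n).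
Proof.
apply: measurable_fun_clock_space => q; rewrite /set_clock.
case: (q == p); first exact: measurable_snd.
by apply: measurableT_comp => //; exact: measurable_funP.
Qed.

Lemma resample_cylinder p (C : set (clock_space R n)) : cylinders C ->
  P (clock_sample @^-1` C) =
  (P \x distribution P (xi p))%E
    ((fun y : Omega * R => set_clock p y.2 (clock_sample y.1)) @^-1` C).
Proof.
move=> [s [B [mB ->]]].
pose B' q := if q \in s then B q else setT.
have mB' q : measurable (B' q) by rewrite /B'; case: ifP.
pose s' := [seq q <- undup s | q != p].
have us' : uniq s' by rewrite filter_uniq// undup_uniq.
have ups' : uniq (p :: s') by rewrite /= us' mem_filter eqxx.
have B'E z : (forall q, q \in s -> B q (z q)) <->
             (B' p (z p) /\ forall q, q \in s' -> B' q (z q)).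
  split=> [h|[hp h] q qs].
    by split=> [|q _]; rewrite /B'; case: ifP => // /h.
  have [qE|qp] := eqVneq q p.
    by move: hp; rewrite /B' -qE qs.
  have qs' : q \in s' by rewrite mem_filter qp mem_undup.
  by have := h q qs'; rewrite /B' qs.
have -> : clock_sample @^-1` [set z | forall q, q \in s -> B q (z q)] =
    \bigcap_(q in [set` p :: s']) (xi q @^-1` B' q).
  apply/seteqP; split=> w /=.
    move/B'E => [hp h] q /=; rewrite inE => /orP[/eqP->//|]; exact: h.
  move=> h; apply/B'E; split=> [|q qs]; first by apply: h; rewrite /= mem_head.
  by apply: h; rewrite /= inE qs orbT.
have -> : (fun y : Omega * R => set_clock p y.2 (clock_sample y.1)) @^-1`
     [set z | forall q, q \in s -> B q (z q)] =
   (\bigcap_(q in [set` s']) (xi q @^-1` B' q)) `*` B' p.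
  apply/seteqP; split=> -[w x] /=.
    move/B'E; rewrite /set_clock eqxx => -[hp h]; split=> // q /= qs.
    have := h q qs; case: ifP => // /eqP qp.
    by move: qs; rewrite qp mem_filter eqxx.
  move=> [h hp]; apply/B'E; rewrite /set_clock eqxx; split=> // q qs.
  case: ifP => [/eqP qp|_]; last exact: h.
  by move: qs; rewrite qp mem_filter eqxx.
rewrite product_measure1E//; last first.
  apply: fin_bigcap_measurable => [|q _]; first exact: finite_seq.
  by rewrite -[X in measurable X]setTI; exact: measurable_funP.
rewrite indep// big_cons muleC; congr (_ * _)%E; exact: esym (indep _ _).
Qed.

Lemma resample_measure p (C : set (clock_space R n)) : measurable C ->
  P (clock_sample @^-1` C) =
  (P \x distribution P (xi p))%E
    ((fun y : Omega * R => set_clock p y.2 (clock_sample y.1)) @^-1` C).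
Proof.
move=> mC.
pose c1 : {mfun Omega >-> clock_space R n} :=
  mfun_Sub (mem_set measurable_clock_sample).
pose c2 : {mfun (Omega * R)%type >-> clock_space R n} :=
  mfun_Sub (mem_set (measurable_set_clock p)).
have := @measure_unique _ R (clock_space R n) (@cylinders R n) (fun=> setT) erefl.
move=> /(_ (@cylinders_setI R n) _ _ (distribution P c1)
  (distribution (P \x distribution P (xi p))%E c2)); apply => //.
- move=> _; exists [::], (fun=> setT); split=> //.
  by apply/seteqP; split.
- by apply/seteqP; split=> // z _; exists 0%N.
- by move=> A /(resample_cylinder p).
- by move=> _; rewrite -[X in (X < _)%E]/(distribution P c1 setT) probability_setT ltry.
Qed.

(** Replacing one clock by an independent copy preserves the joint law; by Fubini that copy may be
    integrated first, all other clocks being frozen. This plays the part of conditioning. *)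
Lemma resample_integral p (F : clock_space R n -> R) (M : R) :
  measurable_fun [set: clock_space R n] F -> (forall z, `|F z| <= M) ->
  (\int[P]_w (F (clock_sample w))%:E =
   \int[P]_w \int[distribution P (xi p)]_x
      (F (set_clock p x (clock_sample w)))%:E)%E.
Proof.
move=> mF FM.
pose c1 : {mfun Omega >-> clock_space R n} :=
  mfun_Sub (mem_set measurable_clock_sample).
pose c2 : {mfun (Omega * R)%type >-> clock_space R n} :=
  mfun_Sub (mem_set (measurable_set_clock p)).
have mEF : measurable_fun [set: clock_space R n] (EFin \o F).
  exact/measurable_EFinP.
transitivity (\int[distribution P c1]_z (F z)%:E)%E.
  rewrite [RHS]integral_pushforward//; apply: (@bounded_integrable _ _ _ _ _ M) => //.
  by apply: measurableT_comp => //; exact: measurable_clock_sample.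
transitivity (\int[distribution (P \x distribution P (xi p))%E c2]_z (F z)%:E)%E.
  apply: eq_measure_integral => A mA _; exact: resample_measure.
rewrite [LHS]integral_pushforward//; last first.
  apply: (@bounded_integrable _ _ _ _ _ M) => //.
  by apply: measurableT_comp => //; exact: measurable_set_clock.
rewrite preimage_setT -integral12_prod_meas1//.
apply: (@bounded_integrable _ _ _ _ _ M) => //.
by apply: measurableT_comp => //; exact: measurable_set_clock.
Qed.

End Resample.

(** * Lack of memory of the exponential law *)

Section Memoryless.
Variables (R : realType) (Q : probability R R).
Hypothesis expQ : forall B, measurable B -> Q B = exponential_prob 1 B.

Local Notation mu := (@lebesgue_measure R).

Lemma exponential_set1 x : Q [set x] = 0%E.
Proof.
by rewrite expQ// /exponential_prob integral_set1.
Qed.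

Lemma negligible_seq (s : seq R) : Q.-negligible [set` s].
Proof.
elim: s => [|x s IH].
  rewrite (_ : [set` [::]] = set0); last by apply/seteqP; split=> y.
  exact: negligible_set0.
rewrite (_ : [set` x :: s] = [set x] `|` [set` s]); last first.
  apply/seteqP; split=> y /=; rewrite inE; first by move=> /orP[/eqP|]; [left|right].
  by move=> [->|->]; rewrite ?eqxx ?orbT.
apply: negligibleU => //; exists [set x]; split=> //; exact: exponential_set1.
Qed.

Lemma measurable_lt0 : measurable [set x : R | x < 0].
Proof.
rewrite (_ : [set x | x < 0] = `]-oo, 0[%classic)//.
Qed.

Lemma exponential_lt0 : Q [set x | x < 0] = 0%E.
Proof.
rewrite expQ; last exact: measurable_lt0.
rewrite /exponential_prob; apply: integral0_eq => x /= x0.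
by rewrite lt0_exponential_pdf.
Qed.

Lemma exponential_itv0c (x : R) : 0 <= x -> Q `[0, x]%classic = (1 - (expR (- x))%:E)%E.
Proof.
rewrite le_eqVlt => /orP[/eqP<-|x0].
  by rewrite set_itv1 exponential_set1 oppr0 expR0 subee.
by rewrite expQ// exponential_prob_itv0c// mulN1r.
Qed.

Lemma exponential_tail (a : R) : 0 <= a -> Q `]a, +oo[%classic = (expR (- a))%:E.
Proof.
move=> a0.
have -> : `]a, +oo[%classic = ~` ([set x | x < 0] `|` `[0, a]%classic).
  apply/seteqP; split=> x /=; rewrite !in_itv/= ?andbT.
    by move=> ax [|/andP[_]]; [rewrite ltNge (le_trans a0 (ltW ax))|rewrite leNgt ax].
  by move=> h; rewrite ltNge; apply/negP => xa; apply: h; case: (ltP x 0) => x0; [left|right; rewrite xa].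
have m0 := measurable_lt0.
rewrite probability_setC; last exact: measurableU.
rewrite measureU//; last first.
  by apply/seteqP; split=> x //= [x0]; rewrite in_itv/= leNgt x0.
rewrite [X in (_ - (X + _))%E]exponential_lt0 add0e [X in (_ - X)%E]exponential_itv0c//.
rewrite -[X in (X - (X - _))%E]/(1%R%:E) -!EFinB; congr EFin; ring.
Qed.

Lemma exponential_itvoo (a y : R) : 0 <= a -> 0 <= y ->
  Q `]a, (a + y)[%classic = (expR (- a) - expR (- (a + y)))%:E.
Proof.
move=> a0 y0; have ay : 0 <= a + y by rewrite addr_ge0.
have e : `]a, +oo[%classic =
    `]a, (a + y)[%classic `|` ([set a + y] `\ a) `|` `]a + y, +oo[%classic.
  apply/seteqP; split=> x /=; rewrite !in_itv/= ?andbT.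
    move=> ax; case: (ltgtP x (a + y)) => h; first by left; left; rewrite ax.
      by right.
    by left; right; split=> // xa; rewrite xa ltxx in ax.
  move=> [[/andP[]//|[-> /eqP]]|]; last by apply: le_lt_trans; rewrite lerDl.
  by rewrite lt_neqAle lerDl y0 andbT eq_sym.
have mD : measurable ([set a + y] `\ a) by exact: measurableD.
have Q0 : Q ([set a + y] `\ a) = 0%E.
  by apply: (subset_measure0 _ _ _ (exponential_set1 (a + y))) => // x [].
have h : Q `]a, +oo[%classic =
    (Q `]a, (a + y)%R[%classic + Q ([set (a + y)%R] `\ a) + Q `](a + y)%R, +oo[%classic)%E.
  rewrite e measureU//; last 2 first.
  - by apply: measurableU.
  - apply/seteqP; split=> x //= [[]]; rewrite !in_itv/= andbT.
      by move=> /andP[_ h] /(lt_trans h); rewrite ltxx.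
    by move=> [-> _]; rewrite ltxx.
  rewrite measureU//.
  apply/seteqP; split=> x //= []; rewrite !in_itv/=.
  by move=> /andP[_ h] [xay _]; rewrite xay ltxx in h.
move: h; rewrite Q0 adde0 !exponential_tail// => h.
have fQ : Q `]a, (a + y)[%classic \is a fin_num by exact: fin_num_measure.
by move: h; rewrite -(fineK fQ) -EFinD => -[->]; congr EFin; ring.
Qed.

(** The rate that a clock of value [x] accumulates in the window of length [y] after age [a], that
    is, the compensator of its ringing there. *)
Definition excess (a y x : R) := Num.min (Num.max (x - a) 0) y.

Lemma measurable_excess (a y : R) : measurable_fun setT (excess a y).
Proof.
apply: measurable_minr => //; apply: measurable_maxr => //.
exact: measurable_funB.
Qed.

(* Layer-cake formula: the excess is the integral of [a + s < x] over [s] in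
   [0, y], and [P (x > a + s) = expR (- a) * expR (- s)]. *)
Lemma integral_excess (a y : R) : 0 <= a -> 0 <= y ->
  (\int[Q]_x (excess a y x)%:E = (expR (- a) - expR (- (a + y)))%:E)%E.
Proof.
move=> a0 y0.
pose A : set (R * R) := [set u | (0 <= u.2) && (u.2 <= y) && (a + u.2 < u.1)].
have mA : measurable A.
  apply: measurable_fun_true; apply: measurable_and.
    by apply: measurable_and; apply: measurable_fun_ler.
  by apply: measurable_fun_ltr => //; exact: measurable_funD.
have := indic_fubini_tonelli Q mu mA.
rewrite indic_fubini_tonelli_FE// indic_fubini_tonelli_GE// => h.
transitivity (\int[Q]_x (mu \o xsection A) x)%E.
  apply: eq_integral => x _ /=.
  have -> : xsection A x = [set s | (0 <= s) && (s <= y) && (a + s < x)].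
    by apply/seteqP; split=> s; rewrite /xsection/= inE => hs; exact: hs.
  have [xa|ax] := leP x a.
    rewrite (_ : [set _ | _] = set0) ?measure0; last first.
      apply/seteqP; split=> s //= /andP[/andP[s0 _]].
      by rewrite ltNge (le_trans xa)// lerDl.
    by rewrite /excess max_r ?subr_le0// min_l.
  have [xay|ayx] := leP x (a + y).
    rewrite (_ : [set _ | _] = `[0, (x - a)[%classic); last first.
      apply/seteqP; split=> s /=; rewrite in_itv/=.
        by move=> /andP[/andP[-> _]]; rewrite ltrBrDl.
      move=> /andP[-> sx]; rewrite -ltrBrDl sx andbT/= (le_trans (ltW sx))//.
      by rewrite lerBlDl.
    rewrite lebesgue_measure_itv/= lte_fin subr_gt0 ax.
    by rewrite -EFinB subr0 /excess max_l ?subr_ge0 1?ltW// min_l// lerBlDl.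
  rewrite (_ : [set _ | _] = `[0, y]%classic); last first.
    apply/seteqP; split=> s /=; rewrite in_itv/=; first by move=> /andP[->].
    by move=> /andP[-> sy]; rewrite sy/= (le_lt_trans _ ayx)// lerD2l.
  have yx : y <= x - a by rewrite lerBrDl ltW.
  rewrite /excess max_l ?(le_trans y0)// min_r//.
  rewrite lebesgue_measure_itv/= lte_fin -EFinB subr0.
  case: ltP => [_|y0']; first by []. have -> : y = 0 by apply/eqP; rewrite eq_le y0' y0.
  by [].
rewrite h.
(* The tail at [a + s] is [expR (- a)] times the exponential density at [s], so what remains is the
   probability of [[0, y]]. *)
transitivity (\int[mu]_(s in `[0%R, y]%classic) ((expR (- a))%:E * (exponential_pdf 1 s)%:E))%E.
  rewrite [RHS]integral_mkcond; apply: eq_integral => s _ /=.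
  have -> : ysection A s = [set x | (0 <= s) && (s <= y) && (a + s < x)].
    by apply/seteqP; split=> x; rewrite /ysection/= inE => hs; exact: hs.
  rewrite patchE; case: ifPn => [|].
    rewrite inE/= in_itv/= => /andP[s0 sy].
    rewrite (_ : [set _ | _] = `]a + s, +oo[%classic); last first.
      by apply/seteqP; split=> x /=; rewrite in_itv/= andbT s0 sy.
    rewrite exponential_tail ?addr_ge0// -EFinM exponential_pdfE//.
    by rewrite mul1r mulN1r -expRD opprD.
  move=> /negP; rewrite inE/= in_itv/= => /negP sy.
  rewrite (_ : [set _ | _] = set0) ?measure0//.
  by apply/seteqP; split=> x //=; rewrite (negbTE sy).
rewrite ge0_integralZl//; last 2 first.
- by apply/measurable_EFinP; apply: measurable_funTS; exact: measurable_exponential_pdf.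
- by move=> x _; rewrite lee_fin exponential_pdf_ge0.
rewrite -[X in (_ * X)%E]/(exponential_prob 1 `[0, y]%classic) -expQ//.
rewrite exponential_itv0c// -EFinB -EFinM mulrBr mulr1 -expRD.
by rewrite opprD.
Qed.

(** The hazard rate is 1: ringing in the window after age [a] has probability
    [expR (- a) - expR (- (a + y))], which is also the mean of [excess]. The list [N] leaves room
    for the finitely many values at which the simulation is not controlled. *)
Lemma memoryless_compensation (F : R -> R) (N : seq R) (phi a y : R) :
  0 <= a -> 0 <= y ->
  (forall x : R, 0 < x -> x \notin N ->
    (x < a -> F x = 0) /\
    (a < x -> F x = phi * ((x < a + y)%R%:R - Num.min (x - a) y))) ->
  measurable_fun setT F ->
  (\int[Q]_x (F x)%:E = 0)%E.
Proof.
move=> a0 y0 HF mF.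
pose G x := phi * (\1_(`]a, (a + y)[%classic) x - excess a y x).
have mI : measurable_fun setT (\1_(`]a, (a + y)[%classic) : R -> R).
  exact: measurable_indic.
have mG : measurable_fun setT G.
  apply: measurable_funM => //; apply: measurable_funB => //.
  exact: measurable_excess.
have bI x : `|\1_(`]a, (a + y)[%classic) x : R| <= 1.
  by rewrite indicE ger0_norm// lern1 leq_b1.
have bE x : `|excess a y x| <= y.
  rewrite /excess ger0_norm ?ge_min ?lexx ?orbT//.
  by rewrite le_min y0 andbT le_max lexx orbT.
transitivity (\int[Q]_x (G x)%:E)%E.
  apply: ae_eq_integral => //; [exact/measurable_EFinP..|].
  (* [F] and [G] may differ only at negative values, at the endpoints of the window, at 0 and on
     [N]. *)
  have : Q.-negligible ([set x | x < 0] `|` [set` 0 :: a :: (a + y) :: N]).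
    apply: negligibleU; last exact: negligible_seq.
    by exists [set x | x < 0]; split; [exact: measurable_lt0|exact: exponential_lt0|].
  apply: negligibleS => x /= h; apply: contrapT => nx; apply: h => _.
  have [x0|x0] := ltP x 0; first by case: nx; left.
  have xN : x \notin [:: 0, a, a + y & N] by apply/negP => xN; apply: nx; right.
  move: xN; rewrite !inE !negb_or => /and4P[xn0 xa xay xN].
  have x0' : 0 < x by rewrite lt_neqAle eq_sym xn0.
  have [h1 h2] := HF x x0' xN; congr EFin.
  move: xa; rewrite neq_lt => /orP[xa|ax].
    rewrite h1// /G /excess indicE memNset; last first.
      by rewrite /= in_itv/= ltNge (ltW xa).
    by rewrite max_r ?subr_le0 1?ltW// min_l// subr0 mulr0.
  rewrite h2// /G /excess max_l ?subr_ge0 1?ltW//; congr (_ * (_ - _)).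
  by rewrite indicE mem_setE in_itv/= ax.
rewrite /G; under eq_integral do rewrite EFinM.
rewrite integralZl//; last first.
  apply: (@bounded_integrable _ _ _ _ _ (1 + y)).
    by apply: measurable_funB => //; exact: measurable_excess.
  by move=> x; rewrite (le_trans (ler_normB _ _))// lerD.
under eq_integral do rewrite EFinB.
rewrite integralB_EFin//; last 2 first.
- exact: (@bounded_integrable _ _ _ _ _ 1).
- by apply: (@bounded_integrable _ _ _ _ _ y) => //; exact: measurable_excess.
rewrite integral_indic// setIT [X in (X - _)%E]exponential_itvoo// integral_excess//.
by rewrite subee// mule0.
Qed.

End Memoryless.

(** * Measurability of the simulation *)

Section Discrete.
Context d (X : measurableType d).

(** Measurability for values in a countable or finite type that carries no sigma-algebra here, such
    as schedules and clock numbers. *)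
Definition discrete_fun (C : Type) (c : X -> C) :=
  forall v, measurable [set x | c x = v].

(** Split along the countably many values of [c]. This handles quantities selected at random, such
    as the clock that a node is currently running. *)
Lemma measurable_switch (C : countType) (c : X -> C) d' (Y : measurableType d')
    (F : C -> X -> Y) :
  discrete_fun c -> (forall v, measurable_fun setT (F v)) ->
  measurable_fun setT (fun x => F (c x) x).
Proof.
move=> mc mF _ B mB; rewrite setTI.
have -> : (fun x => F (c x) x) @^-1` B =
    \bigcup_v ([set x | c x = v] `&` F v @^-1` B).
  apply/seteqP; split=> x /=; first by move=> Bx; exists (c x).
  by move=> [v _ [/= <-]].
apply: countable_bigcupT_measurable => // v; apply: measurableI => //.
by have := mF v measurableT B mB; rewrite setTI.
Qed.

Lemma discrete_switch (C : countType) (c : X -> C) (D : Type) (F : C -> X -> D) :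
  discrete_fun c -> (forall v, discrete_fun (F v)) ->
  discrete_fun (fun x => F (c x) x).
Proof.
move=> mc mF w.
have -> : [set x | F (c x) x = w] =
    \bigcup_v ([set x | c x = v] `&` [set x | F v x = w]).
  apply/seteqP; split=> x /=; first by move=> Bx; exists (c x).
  by move=> [v _ [/= <-]].
by apply: countable_bigcupT_measurable => // v; apply: measurableI => //; exact: mF.
Qed.

Lemma discrete_cst (D : Type) (v : D) : discrete_fun (fun=> v).
Proof.
move=> w; have [<-|vw] := pselect (v = w).
  by rewrite (_ : [set _ | _] = setT)//; apply/seteqP; split.
by rewrite (_ : [set _ | _] = set0)//; apply/seteqP; split.
Qed.

Lemma discrete_comp (C : countType) (D : Type) (f : C -> D) (c : X -> C) :
  discrete_fun c -> discrete_fun (fun x => f (c x)).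
Proof.
by move=> mc; apply: (discrete_switch (F := fun v _ => f v)) => // v; exact: discrete_cst.
Qed.

Lemma discrete_measurable (C : countType) (c : X -> C) d' (Y : measurableType d')
    (f : C -> Y) :
  discrete_fun c -> measurable_fun setT (fun x => f (c x)).
Proof.
by move=> mc; apply: (measurable_switch (F := fun v _ => f v)).
Qed.

Lemma measurable_if_discrete (b : X -> bool) d' (Y : measurableType d')
    (f g : X -> Y) : discrete_fun b ->
  measurable_fun setT f -> measurable_fun setT g ->
  measurable_fun setT (fun x => if b x then f x else g x).
Proof.
move=> mb mf mg.
by apply: (measurable_switch (F := fun (v : bool) x => if v then f x else g x)) => // -[].
Qed.

Lemma discrete_bool (b : X -> bool) : measurable_fun setT b -> discrete_fun b.
Proof. by move=> mb v; have := mb measurableT [set v] I; rewrite setTI. Qed.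

Lemma discrete_finfun (I : finType) (C : countType) (c : X -> {ffun I -> C}) :
  (forall i, discrete_fun (fun x => c x i)) -> discrete_fun c.
Proof.
move=> mc v.
have -> : [set x | c x = v] = \bigcap_(i in [set: I]) [set x | c x i = v i].
  apply/seteqP; split=> x /= => [<- i _ //|h]; apply/ffunP => i; exact: h.
by apply: fin_bigcap_measurable => // i _; exact: mc.
Qed.

Lemma measurable_bigmin (R : realType) n (P : pred 'I_n) (f : X -> R)
    (g : 'I_n -> X -> R) :
  measurable_fun setT f -> (forall i, measurable_fun setT (g i)) ->
  measurable_fun setT (fun x => \big[Num.min/f x]_(i < n | P i) g i x).
Proof.
move=> mf mg; elim: (index_enum _) => [|i s IH].
  by under eq_fun do rewrite big_nil.
under eq_fun do rewrite big_cons.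
by case: (P i) => //; exact: measurable_minr.
Qed.

End Discrete.

Section MeasurableRun.
Context (R : realType) (n : nat) (E : rel 'I_n) (T : R).
Variable (upd : 'I_n -> R -> R -> R).
Hypothesis mupd : forall i, measurable_fun setT (fun y : R * R => upd i y.1 y.2).
Context d (X : measurableType d) (z : X -> 'I_n * nat -> R).
Hypothesis mz : forall p, measurable_fun setT (fun x => z x p).

Record measurable_state (H : X -> state R n) : Prop := MeasurableState {
  m_time : measurable_fun setT (fun x => time (H x)) ;
  m_rem : measurable_fun setT (fun x => rem (H x)) ;
  m_sched : discrete_fun (fun x => sched (H x)) ;
  m_idx : forall i, discrete_fun (fun x => idx (H x) i) ;
  m_age : forall i, measurable_fun setT (fun x => age (H x) i) ;
  m_par : forall i, measurable_fun setT (fun x => par (H x) i) ;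
  m_served : forall i, measurable_fun setT (fun x => served (H x) i) }.

Section Step.
Variable H : X -> state R n.
Hypothesis mH : measurable_state H.

Lemma measurable_sched i : discrete_fun (fun x => sched (H x) i).
Proof. exact: (discrete_comp (fun s : {ffun 'I_n -> bool} => s i) (m_sched mH)). Qed.

Lemma measurable_rate i : measurable_fun setT (fun x => rate (H x) i).
Proof.
apply: measurable_if_discrete => //; first exact: measurable_sched.
by apply: measurableT_comp => //; exact: m_par.
Qed.

Lemma measurable_gap i : measurable_fun setT (fun x => gap (z x) (H x) i).
Proof.
apply: measurable_maxr => //.
have -> : (fun x => (z x (i, idx (H x) i) - age (H x) i) / rate (H x) i) =
   (fun x => (z x (i, idx (H x) i) - age (H x) i) *
     (if sched (H x) i then 1 else expR (- par (H x) i))).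
  by apply/funext => x; rewrite /rate; case: ifP => _; rewrite ?invr1// expRN.
apply: measurable_funM; first apply: measurable_funB.
- by apply: (measurable_switch (F := fun k x => z x (i, k))) => //; exact: m_idx.
- exact: m_age.
- apply: measurable_if_discrete => //; first exact: measurable_sched.
  by apply: measurableT_comp => //; apply: measurable_funN; exact: m_par.
Qed.

Lemma measurable_other_gap i : measurable_fun setT (fun x => other_gap (z x) (H x) i).
Proof. by apply: measurable_bigmin; [exact: m_rem|exact: measurable_gap]. Qed.

Lemma measurable_step_len : measurable_fun setT (fun x => step_len (z x) (H x)).
Proof. by apply: measurable_bigmin; [exact: m_rem|exact: measurable_gap]. Qed.

Lemma measurable_rings i : discrete_fun (fun x => rings (z x) (H x) i).
Proof.
apply: discrete_bool; apply: measurable_fun_ltr; first exact: measurable_gap.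
exact: measurable_other_gap.
Qed.

Lemma measurable_event : discrete_fun (fun x => [exists i, rings (z x) (H x) i]).
Proof.
pose c x : {ffun 'I_n -> bool} := [ffun i => rings (z x) (H x) i].
have mc : discrete_fun c.
  apply: discrete_finfun => i; rewrite (_ : (fun x => c x i) = fun x => rings (z x) (H x) i).
    exact: measurable_rings.
  by apply/funext => x; rewrite ffunE.
have -> : (fun x => [exists i, rings (z x) (H x) i]) =
   (fun x => [exists i, c x i]).
  by apply/funext => x; apply: eq_existsb => i; rewrite ffunE.
exact: (discrete_comp (fun s : {ffun 'I_n -> bool} => [exists i, s i]) mc).
Qed.

Lemma measurable_next : measurable_state (fun x => next E T upd (z x) (H x)).
Proof.
have mser i : measurable_fun setT
    (fun x => served (H x) i + (sched (H x) i)%:R * step_len (z x) (H x)).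
  apply: measurable_funD; first exact: m_served.
  apply: measurable_funM; last exact: measurable_step_len.
  apply: (@discrete_measurable _ _ _ (fun x => sched (H x) i) _ _ (fun b : bool => b%:R : R)).
  exact: measurable_sched.
split=> /=.
- by apply: measurable_funD; [exact: m_time|exact: measurable_step_len].
- apply: measurable_if_discrete => //; first exact: measurable_event.
  by apply: measurable_funB; [exact: m_rem|exact: measurable_step_len].
- apply: discrete_finfun => i.
  rewrite (_ : (fun x => _) = fun x => if rings (z x) (H x) i
     then flip E (sched (H x)) i else sched (H x) i); last first.
    by apply/funext => x; rewrite ffunE.
  apply: (@discrete_switch _ _ _ (fun x => rings (z x) (H x) i) _ (fun (v : bool) x => if v then flip E (sched (H x)) i else sched (H x) i)).
    exact: measurable_rings.
  case; last exact: measurable_sched.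
  exact: (discrete_comp (fun s : {ffun 'I_n -> bool} => flip E s i) (m_sched mH)).
- move=> i.
  apply: (@discrete_switch _ _ _ (fun x => rings (z x) (H x) i) _ (fun (v : bool) x => (idx (H x) i + v)%N)).
    exact: measurable_rings.
  move=> v; exact: (discrete_comp (fun k => (k + v)%N) (m_idx mH i)).
- move=> i; apply: measurable_if_discrete => //; first exact: measurable_rings.
  apply: measurable_funD; first exact: m_age.
  by apply: measurable_funM; [exact: measurable_rate|exact: measurable_step_len].
- move=> i; apply: measurable_if_discrete; [exact: measurable_event|exact: m_par|].
  exact: (measurableT_comp (mupd i) (measurable_fun_pair (m_par mH i) (mser i))).
- by move=> i; apply: measurable_if_discrete => //; exact: measurable_event.
Qed.

End Step.

Lemma measurable_run rho m : measurable_state (fun x => run E T upd rho (z x) m).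
Proof.
elim: m => [|m IH]; last exact: measurable_next.
by split => //= *; exact: discrete_cst.
Qed.

End MeasurableRun.

(** * Strong law of large numbers for the compensated rings *)

(** Number of rings minus accumulated rate, read off the two states alone, so that [martingale] is a
    function of the sequence of states. *)
Definition compensated (R : realType) (n : nat) (i : 'I_n) (H H' : state R n) : R :=
  (idx H' i)%:R - (idx H i)%:R - rate H i * (time H' - time H).

Definition martingale (R : realType) (n : nat) (h : 'I_n -> state R n -> R)
    (Hs : nat -> state R n) (m : nat) : R :=
  \sum_(0 <= k < m) \sum_(i < n) h i (Hs k) * compensated i (Hs k) (Hs k.+1).

Lemma seq_ub (R : realType) (N : seq R) : exists b, forall x, x \in N -> x < b.
Proof.
elim: N => [|y N [b IH]]; first by exists 0.
exists (Num.max b (y + 1)) => x; rewrite inE lt_max => /orP[/eqP->|/IH->//].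
by rewrite ltrDl ltr01 orbT.
Qed.

Section Orthogonality.
Variables (R : realType) (n : nat) (d : measure_display).
Variables (Omega : measurableType d) (P : probability Omega R).
Variable xi : 'I_n * nat -> {RV P >-> R}.
Hypothesis indep : forall (s : seq ('I_n * nat)) (B : 'I_n * nat -> set R),
  uniq s -> (forall p, measurable (B p)) ->
  P (\bigcap_(p in [set` s]) (xi p @^-1` B p)) =
  (\prod_(p <- s) P (xi p @^-1` B p))%E.
Hypothesis exp_xi : forall p B, measurable B ->
  distribution P (xi p) B = exponential_prob 1 B.
Variables (E : rel 'I_n) (T Rmax : R) (upd : 'I_n -> R -> R -> R).
Hypotheses (T0 : 0 <= T) (Rmax0 : 0 <= Rmax).
Hypothesis mupd : forall i, measurable_fun setT (fun y : R * R => upd i y.1 y.2).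
Hypothesis upd_bound : forall i x y, 0 <= upd i x y <= Rmax.
Variable rho : {ffun 'I_n -> bool}.

Local Notation K := (clock_space R n).
Local Notation sample := (clock_sample xi).
Local Notation path z := (run E T upd rho z).

Lemma par_run z m i : 0 <= par (path z m) i <= Rmax.
Proof.
elim: m => [|m IH]; first by rewrite /= lexx Rmax0.
by rewrite /run iterS /=; case: ifP.
Qed.

Lemma rate_run z m i : 0 <= rate (path z m) i <= expR Rmax.
Proof.
rewrite ltW ?rate_gt0//= /rate; case: ifP => _.
  by rewrite -expR0 ler_expR.
by rewrite ler_expR; have /andP[] := par_run z m i.
Qed.

Lemma compensated_run z m i : compensated i (path z m) (path z m.+1) =
  (rings z (path z m) i)%:R - rate (path z m) i * step_len z (path z m).
Proof.
by rewrite /compensated /run iterS /= natrD; ring.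
Qed.

Definition comp_bound : R := 1 + expR Rmax * T.

Lemma compensated_le z m i :
  `|compensated i (path z m) (path z m.+1)| <= comp_bound.
Proof.
rewrite compensated_run (le_trans (ler_normB _ _))// lerD//.
  by rewrite ger0_norm// lern1 leq_b1.
have /andP[r0 rK] := rate_run z m i.
have /andP[b0 bT] := rem_run E upd T0 rho z m.
have s0 := step_len_ge0 z b0.
rewrite ger0_norm ?mulr_ge0//; apply: ler_pM => //.
exact: le_trans (step_len_le_rem z _) bT.
Qed.

Lemma measurable_run_clock m : measurable_state (fun z : K => path z m).
Proof. by apply: measurable_run => // p; exact: measurable_clock. Qed.

Lemma measurable_compensated m i :
  measurable_fun [set: K] (fun z : K => compensated i (path z m) (path z m.+1)).
Proof.
have M1 := measurable_run_clock m; have M2 := measurable_run_clock m.+1.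
have mi k (Hk := measurable_run_clock k) :
    measurable_fun [set: K] (fun z : K => (idx (path z k) i)%:R : R).
  exact: (@discrete_measurable _ _ _ (fun z : K => idx (path z k) i) _ _
     (fun v : nat => v%:R : R) (m_idx Hk i)).
apply: measurable_funB; first exact: measurable_funB.
apply: measurable_funM; first exact: measurable_rate.
by apply: measurable_funB; exact: m_time.
Qed.

(** Being determined by the past, stated as a factorization through the states up to event [m]
    instead of through a filtration. *)
Definition adapted (phi : K -> R) m := forall z z',
  (forall k, (k <= m)%N -> path z k = path z' k) -> phi z = phi z'.

(* Resample the clock [(i, c)] that node [i] is running: [phi] sees it only
   through the fact that it has not yet rung. *)
Lemma integral_clock_compensated (phi : K -> R) m i c M :
  measurable_fun [set: K] phi -> (forall z, `|phi z| <= M) -> adapted phi m ->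
  (\int[P]_w ((idx (path (sample w) m) i == c)%:R * (phi (sample w) *
     compensated i (path (sample w) m) (path (sample w) m.+1)))%:E = 0)%E.
Proof.
move=> mphi bphi aphi.
pose F (z : K) := (idx (path z m) i == c)%:R * (phi z *
     compensated i (path z m) (path z m.+1)).
have mF : measurable_fun [set: K] F.
  apply: measurable_funM.
    apply: (@discrete_measurable _ _ _ (fun z : K => idx (path z m) i) _ _
     (fun v : nat => (v == c)%:R : R)).
    exact: (m_idx (measurable_run_clock m) i).
  by apply: measurable_funM => //; exact: measurable_compensated.
have bF z : `|F z| <= M * comp_bound.
  rewrite /F !normrM -[leRHS]mul1r ler_pM//.
    by rewrite ger0_norm// lern1 leq_b1.
  by rewrite ler_pM// compensated_le.
rewrite (resample_integral indep (i, c) mF bF).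
apply: integral0_eq => w _.
set z := sample w.
have mset : measurable_fun setT (fun x : R => set_clock (i, c) x z : K).
  apply: measurable_fun_clock_space => q; rewrite /set_clock.
  by case: (q == (i, c)).
have [Hs [[lt HH]|[N [Hc Ha Hr HN HH]]]] := run_set_clock E upd T0 rho z i c m.
  apply: integral0_eq => x _; rewrite /F.
  by rewrite HH// (ltn_eqF lt) mul0r.
pose H := Hs m; pose a := age H i; pose Y := other_gap z H i.
have [b Nb] := seq_ub N.
(* A sample value for which the clock is still running: [phi] takes the same value at all such
   points outside [N], hence it is the constant evaluated at [x0]. *)
pose x0 := Num.max b (a + 1).
have ax0 : a < x0 by rewrite lt_max ltrDl ltr01 orbT.
have x00 : 0 < x0 by exact: le_lt_trans ax0.
have x0N : x0 \notin N by apply/negP => /Nb; rewrite ltNge /x0 le_max lexx.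
have rH : rate H i = rate (path (set_clock (i, c) x0 z) m) i.
  by rewrite (HH x0 x00 x0N).2.
apply: (@memoryless_compensation _ (distribution P (xi (i, c))) _ _ N
  (phi (set_clock (i, c) x0 z)) a (rate H i * Y)) => //.
- by move=> B mB; exact: exp_xi.
- by rewrite mulr_ge0 ?other_gap_ge0// ltW// rate_gt0.
- move=> x x1 xN; have [h1 h2] := HH x x1 xN; split=> xa.
    by rewrite /F gtn_eqF ?mul0r// h1.
  have e := h2 xa m (leqnn m).
  rewrite /F compensated_run e -/H Hc eqxx mul1r; congr (_ * _).
    apply: aphi => k km; rewrite h2//.
    by rewrite (HH x0 x00 x0N).2.
  have gE : gap (set_clock (i, c) x z) H i = (x - a) / rate H i.
    rewrite -Hc -/H gap_set_clock_eq max_r// divr_ge0//.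
      by rewrite subr_ge0 ltW.
    exact/ltW/rate_gt0.
  have rg : 0 < rate H i by exact: rate_gt0.
  rewrite /rings gE (step_lenE _ _ i) gE other_gap_set_clock -/Y.
  congr (_%:R - _); first by rewrite ltr_pdivrMr// mulrC ltrBlDl.
  by rewrite minr_pMr ?(ltW rg)// mulrC divfK// gt_eqF.
- exact: (measurableT_comp mF mset).
Qed.

(** Which clock node [i] is running after [m] events is random, but its number is at most [m];
    summing over that number reduces to a fixed clock. *)
Lemma integral_compensated (phi : K -> R) m i M :
  measurable_fun [set: K] phi -> (forall z, `|phi z| <= M) -> adapted phi m ->
  \int[P]_w (phi (sample w) *
     compensated i (path (sample w) m) (path (sample w) m.+1)) = 0.
Proof.
move=> mphi bphi aphi.
pose F c w := (idx (path (sample w) m) i == c)%:R * (phi (sample w) *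
     compensated i (path (sample w) m) (path (sample w) m.+1)).
have mF c : measurable_fun setT (F c).
  rewrite /F.
  have mz := measurable_clock_sample xi.
  apply: measurable_funM.
    apply: (@discrete_measurable _ _ _ (fun w => idx (path (sample w) m) i) _ _
     (fun v : nat => (v == c)%:R : R)).
    apply: m_idx; apply: measurable_run => // p.
  apply: measurable_funM; first exact: (measurableT_comp mphi mz).
  exact: (measurableT_comp (measurable_compensated m i) mz).
have bF c w : `|F c w| <= M * comp_bound.
  rewrite /F !normrM -[leRHS]mul1r ler_pM//.
    by rewrite ger0_norm// lern1 leq_b1.
  by rewrite ler_pM// compensated_le.
have -> : (fun w => phi (sample w) *
     compensated i (path (sample w) m) (path (sample w) m.+1)) =
    (fun w => \sum_(0 <= c < m.+1) F c w).
  apply/funext => w; rewrite -mulr_suml.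
  rewrite big_mkord (bigD1 (inord (idx (path (sample w) m) i)))//=.
  rewrite inordK ?ltnS ?idx_run_le// eqxx big1 ?addr0 ?mul1r// => c.
  by rewrite -val_eqE/= inordK ?ltnS ?idx_run_le// eq_sym => /negbTE->.
have mPT : P setT = 1%E := probability_setT P.
elim: m.+1 => [|k IH].
  by under eq_Rintegral do rewrite big_nil; rewrite Rintegral_cst// mul0r.
under eq_Rintegral do rewrite big_nat_recr//=.
rewrite RintegralD//; last 2 first.
- apply: (@bounded_integrable _ _ _ _ _ (\sum_(0 <= c < k) M * comp_bound)).
    by apply: measurable_sum.
  move=> w; rewrite (le_trans (ler_norm_sum _ _ _))//.
  by apply: ler_sum.
- exact: (@bounded_integrable _ _ _ _ _ (M * comp_bound)).
rewrite IH add0r /Rintegral.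
by rewrite (integral_clock_compensated i k mphi bphi aphi).
Qed.

End Orthogonality.

(** * A strong law for bounded orthogonal increments *)

Lemma sum_inv_squares (R : realType) N :
  \sum_(0 <= q < N) (q.+1%:R ^+ 2)^-1 <= 2 :> R.
Proof.
(* The correction [- N%:R^-1] makes the induction telescope. *)
suff h : (0 < N)%N -> \sum_(0 <= q < N) (q.+1%:R ^+ 2)^-1 <= 2 - N%:R^-1 :> R.
  case: N h => [_|N h]; first by rewrite big_nil.
  by rewrite (le_trans (h _))// gerBl.
elim: N => // -[_ _|N /(_ isT) IH _].
  rewrite big_nat1 expr1n invr1; lra.
rewrite big_nat_recr//=; move: IH; set S := \sum_(0 <= q < N.+1) _ => IH.
apply: (le_trans (lerD IH (lexx _))).
have a0 : 0 < N.+1%:R :> R by [].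
have b0 : 0 < N.+2%:R :> R by [].
have e : N.+2%:R = N.+1%:R + 1 :> R by rewrite -natr1.
rewrite -addrA lerD2l -lerBrDl opprK addrC.
have -> : N.+1%:R^-1 - N.+2%:R^-1 = (N.+1%:R * N.+2%:R)^-1 :> R.
  move: a0 b0 e; move: (N.+1%:R) (N.+2%:R) => a b a0 b0 e.
  have -> : a^-1 - b^-1 = (b - a) * (a * b)^-1.
    by field; rewrite (gt_eqF a0) (gt_eqF b0).
  by rewrite e addrAC subrr add0r mul1r.
by rewrite lef_pV2 ?posrE ?mulr_gt0 ?exprn_gt0// expr2 ler_pM2r// ler_nat.
Qed.

Lemma square_between (m : nat) : exists q, (q ^ 2 <= m < q.+1 ^ 2)%N.
Proof.
elim: m => [|m [q /andP[h1 h2]]]; first by exists 0%N.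
have [h|h] := ltnP m.+1 (q.+1 ^ 2); first by exists q; rewrite h andbT ltnW.
by exists q.+1; rewrite h/= (leq_ltn_trans h2)// ltn_exp2r.
Qed.

(* Second-moment bound along squares, with the bounded increments controlling
   the gaps between consecutive squares. *)
Lemma orthogonal_lln (R : realType) d (X : measurableType d) (P : probability X R)
    (M : nat -> X -> R) (C : R) :
  (forall m, measurable_fun setT (M m)) ->
  (forall x, M 0%N x = 0) ->
  (forall m x, `|M m.+1 x - M m x| <= C) ->
  (forall m, \int[P]_x (M m x * (M m.+1 x - M m x)) = 0) ->
  {ae P, forall x, forall e, 0 < e ->
     exists m0, forall m, (m0 <= m)%N -> `|M m x| <= e * m%:R}.
Proof.
move=> mM M0 bD orth.
(* Nonnegativity of [C] is read off an increment at an actual sample point. *)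
have [x0|noX] := pselect (exists x : X, True); last first.
  by apply: aeW => x; exfalso; apply: noX; exists x.
have C0 : 0 <= C by case: x0 => x _; exact: le_trans (bD 0%N x).
have mPT : (P : set X -> \bar R) setT = 1%E := probability_setT P.
have bM m x : `|M m x| <= m%:R * C.
  elim: m => [|m IH]; first by rewrite M0 normr0 mul0r.
  rewrite -(subrK (M m x) (M m.+1 x)) (le_trans (ler_normD _ _))//.
  by rewrite -natr1 mulrDl mul1r addrC lerD.
have mD m : measurable_fun setT (fun x => M m.+1 x - M m x).
  exact: measurable_funB.
have M2 m : \int[P]_x (M m x ^+ 2) <= m%:R * C ^+ 2.
  elim: m => [|m IH].
    by under eq_Rintegral do rewrite M0 expr0n/=; rewrite Rintegral_cst// mul0r mul0r.
  have -> : (fun x => M m.+1 x ^+ 2) = (fun x => M m x ^+ 2 +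
      (2 * (M m x * (M m.+1 x - M m x)) + (M m.+1 x - M m x) ^+ 2)).
    by apply/funext => x; ring.
  have i1 : P.-integrable setT (EFin \o (fun x => M m x ^+ 2)).
    apply: (@bounded_integrable _ _ _ _ _ ((m%:R * C) ^+ 2)).
      exact: measurable_funX.
    by move=> x; rewrite normrX lerXn2r ?nnegrE// (le_trans _ (bM m x)).
  have i2 : P.-integrable setT (EFin \o (fun x => M m x * (M m.+1 x - M m x))).
    apply: (@bounded_integrable _ _ _ _ _ ((m%:R * C) * C)).
      exact: measurable_funM.
    by move=> x; rewrite normrM ler_pM.
  have i2' : P.-integrable setT (EFin \o (fun x => 2 * (M m x * (M m.+1 x - M m x)))).
    apply: (@bounded_integrable _ _ _ _ _ (2 * ((m%:R * C) * C))).
      by apply: measurable_funM => //; exact: measurable_funM.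
    by move=> x; rewrite normrM ger0_norm// ler_pM2l// normrM ler_pM.
  have i3 : P.-integrable setT (EFin \o (fun x => (M m.+1 x - M m x) ^+ 2)).
    apply: (@bounded_integrable _ _ _ _ _ (C ^+ 2)).
      exact: measurable_funX.
    by move=> x; rewrite normrX lerXn2r ?nnegrE.
  have i23 : P.-integrable setT (EFin \o (fun x =>
      2 * (M m x * (M m.+1 x - M m x)) + (M m.+1 x - M m x) ^+ 2)).
    exact: (integrableD measurableT i2' i3).
  rewrite RintegralD// RintegralD// RintegralZl// orth mulr0 add0r.
  rewrite -natr1 mulrDl mul1r lerD//.
  rewrite (le_trans (le_Rintegral (f2 := fun=> C ^+ 2) _ _ _ _))//.
  - exact: (@bounded_integrable _ _ _ _ _ (`|C ^+ 2|)).
  - by move=> x _; rewrite -real_normK ?num_real// lerXn2r ?nnegrE.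
  - by rewrite Rintegral_cst// [X in fine X]probability_setT mulr1.
(* Along squares the normalized second moments are at most [C ^+ 2 / q.+1 ^ 2], hence summable:
   almost surely the series of the [f q] converges and its terms tend to 0. *)
pose f q x := (q.+1%:R ^+ 4)^-1 * M (q.+1 ^ 2)%N x ^+ 2.
have f0 q x : 0 <= f q x by rewrite mulr_ge0 ?sqr_ge0 ?invr_ge0 ?exprn_ge0//.
have mf q : measurable_fun setT (fun x => f q x).
  by apply: measurable_funM => //; exact: measurable_funX.
have If q : (\int[P]_x (f q x)%:E <= ((C ^+ 2) * (q.+1%:R ^+ 2)^-1)%:E)%E.
  have iM : P.-integrable setT (EFin \o (fun x => M (q.+1 ^ 2)%N x ^+ 2)).
    apply: (@bounded_integrable _ _ _ _ _ (((q.+1 ^ 2)%:R * C) ^+ 2)).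
      exact: measurable_funX.
    by move=> x; rewrite normrX lerXn2r ?nnegrE// (le_trans _ (bM _ x)).
  have i1 : P.-integrable setT (EFin \o f q).
    apply: (@bounded_integrable _ _ _ _ _ ((q.+1%:R ^+ 4)^-1 * ((q.+1 ^ 2)%:R * C) ^+ 2)) => //.
    move=> x; rewrite normrM ger0_norm ?invr_ge0 ?exprn_ge0//.
    rewrite ler_pM2l ?invr_gt0 ?exprn_gt0//.
    by rewrite normrX lerXn2r ?nnegrE// (le_trans _ (bM _ x)).
  have -> : (\int[P]_x (f q x)%:E = (\int[P]_x f q x)%:E)%E.
    by rewrite /Rintegral fineK//; exact: integrable_fin_num.
  rewrite lee_fin RintegralZl//.
  rewrite (le_trans (ler_wpM2l _ (M2 _)))// ?invr_ge0 ?exprn_ge0//.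
  rewrite natrX mulrA mulrC ler_wpM2l ?exprn_ge0//.
  have -> : (q.+1%:R ^+ 4 : R) = q.+1%:R ^+ 2 * q.+1%:R ^+ 2 by rewrite -exprD.
  by rewrite invfM -mulrA mulVf ?mulr1// gt_eqF// exprn_gt0.
have Isum : (\int[P]_x (\sum_(q <oo) (f q x)%:E) < +oo)%E.
  rewrite integral_nneseries//; last 2 first.
  - by move=> q; exact/measurable_EFinP.
  - by move=> q x _; rewrite lee_fin.
  apply: (@le_lt_trans _ _ ((C ^+ 2) * 2)%:E%E); last exact: ltry.
  apply: lime_le; first by apply: is_cvg_nneseries => q _ _; apply: integral_ge0 => x _; rewrite lee_fin.
  apply: nearW => N; apply: (@le_trans _ _ (\sum_(0 <= q < N) ((C ^+ 2) * (q.+1%:R ^+ 2)^-1)%:E)%E).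
    exact: lee_sum.
  by rewrite sumEFin lee_fin -mulr_sumr ler_wpM2l ?sqr_ge0// sum_inv_squares.
have mS : measurable_fun setT (fun x => \sum_(q <oo) (f q x)%:E)%E.
  apply: (ge0_emeasurable_sum (h := fun q x => (f q x)%:E) (P := xpredT)).
    by move=> q x _ _; rewrite lee_fin.
  by move=> q _; exact/measurable_EFinP.
have Iint : P.-integrable setT (fun x => \sum_(q <oo) (f q x)%:E)%E.
  apply/integrableP; split.
    exact: mS.
  under eq_integral => x _.
    rewrite gee0_abs; last by apply: nneseries_ge0 => q _ _; rewrite lee_fin.
    over.
  exact: Isum.
have := integrable_ae measurableT Iint.
apply: filterS => x /(_ I) fin e e0.
have cvf : f ^~ x @ \oo --> 0.
  apply: cvg_series_cvg_0; apply: nondecreasing_is_cvgn.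
    apply/nondecreasing_seqP => N; rewrite /series/= big_nat_recr//=.
    by rewrite lerDl.
  exists (fine (\sum_(q <oo) (f q x)%:E)%E) => _ [N _ <-].
  rewrite -lee_fin fineK// /series/= -sumEFin.
  by apply: nneseries_lim_ge => q _ _; rewrite lee_fin.
pose e2 := e / 2.
have e20 : 0 < e2 by rewrite divr_gt0.
have [q0 _ Hq0] : \forall q \near \oo, f q x < e2 ^+ 2.
  move/cvgrPdist_lt : cvf => /(_ _ (exprn_gt0 2 e20)).
  by apply: filterS => q; rewrite sub0r normrN ger0_norm.
have Msq q : (q0 < q)%N -> `|M (q ^ 2)%N x| <= e2 * (q ^ 2)%:R.
  case: q => // q; rewrite ltnS => /Hq0 /ltW; rewrite /f.
  rewrite mulrC ler_pdivrMr ?exprn_gt0// (exprM _ 2 2) -exprMn.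
  rewrite -real_normK ?num_real// => h.
  rewrite natrX -(@ler_pXn2r _ 2)// ?nnegrE//.
  by rewrite mulr_ge0 ?exprn_ge0// ltW.
(* An index lies at most [2 * q] above the preceding square [q ^ 2]; for [q >= q1] the drift
   [2 * q * C] over that gap is at most [e2 * q ^ 2]. *)
have [q1 Hq1] : exists q1 : nat, 2 * C / e2 <= q1%:R.
  exists (Num.truncn (2 * C / e2)).+1; rewrite ltW//.
  by rewrite truncnS_gt.
exists ((maxn q0 q1).+1 ^ 2)%N => m hm.
have [q /andP[qm mq]] := square_between m.
have : (maxn q0 q1 < q)%N.
  rewrite -ltnS -(@ltn_exp2r _ _ 2)//; apply: leq_ltn_trans mq.
  exact: hm.
rewrite gtn_max => /andP[q0q q1q].
have Mdiff k : `|M (q ^ 2 + k)%N x - M (q ^ 2)%N x| <= k%:R * C.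
  elim: k => [|k IH]; first by rewrite addn0 subrr normr0 mul0r.
  rewrite addnS (_ : _ - _ = (M (q ^ 2 + k).+1 x - M (q ^ 2 + k)%N x) +
     (M (q ^ 2 + k)%N x - M (q ^ 2)%N x)); last by ring.
  by rewrite (le_trans (ler_normD _ _))// -natr1 mulrDl mul1r addrC lerD.
have := Mdiff (m - q ^ 2)%N; rewrite subnKC// => h.
have mq2 : (m - q ^ 2 <= 2 * q)%N by lia.
have := Msq q q0q => h2.
have h3 : (m - q ^ 2)%:R * C <= e2 * (q ^ 2)%:R.
  apply: (@le_trans _ _ ((2 * q)%:R * C)).
    by rewrite ler_wpM2r// ler_nat.
  rewrite natrM natrX expr2 mulrAC mulrA ler_wpM2r//.
  move: Hq1; rewrite ler_pdivrMr// => Hq1; rewrite (le_trans Hq1)// mulrC.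
  by rewrite ler_pM2l// ler_nat ltnW.
have h4 : e2 * (q ^ 2)%:R <= e2 * m%:R by rewrite ler_pM2l// ler_nat.
have ee : e * m%:R = e2 * m%:R + e2 * m%:R by rewrite /e2 -mulrDl -splitr.
rewrite -(subrK (M (q ^ 2)%N x) (M m x)) (le_trans (ler_normD _ _))// ee lerD//.
  by rewrite (le_trans h)// (le_trans h3).
exact: le_trans h4.
Qed.

(** Applied to all initial schedules at once, it allows the random one to be substituted
    afterwards. *)
Lemma ae_forall_countable (R : realType) d (X : measurableType d)
    (P : {measure set X -> \bar R}) (I : countType) (Q : I -> X -> Prop) :
  (forall i, {ae P, forall x, Q i x}) -> {ae P, forall x, forall i, Q i x}.
Proof.
move=> h.
have : {ae P, forall x, forall k : nat, forall i : I, unpickle k = Some i -> Q i x}.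
  apply: ae_foralln => k; case e : (unpickle k : option I) => [i|]; last first.
    by apply: aeW.
  by apply: filterS (h i) => x Qx j [<-].
by apply: filterS => x H i; apply: (H (pickle i)); rewrite pickleK.
Qed.

(** * Almost sure properties of the simulation *)

Section AlmostSure.
Variables (R : realType) (n : nat) (d : measure_display).
Variables (Omega : measurableType d) (P : probability Omega R).
Variable xi : 'I_n * nat -> {RV P >-> R}.
Hypothesis indep : forall (s : seq ('I_n * nat)) (B : 'I_n * nat -> set R),
  uniq s -> (forall p, measurable (B p)) ->
  P (\bigcap_(p in [set` s]) (xi p @^-1` B p)) =
  (\prod_(p <- s) P (xi p @^-1` B p))%E.
Hypothesis exp_xi : forall p B, measurable B ->
  distribution P (xi p) B = exponential_prob 1 B.
Variables (E : rel 'I_n) (T Rmax : R) (upd : 'I_n -> R -> R -> R).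
Hypotheses (T0 : 0 <= T) (Rmax0 : 0 <= Rmax).
Hypothesis mupd : forall i, measurable_fun setT (fun y : R * R => upd i y.1 y.2).
Hypothesis upd_bound : forall i x y, 0 <= upd i x y <= Rmax.
Variable rho : {ffun 'I_n -> bool}.

Local Notation K := (clock_space R n).
Local Notation sample := (clock_sample xi).
Local Notation path z := (run E T upd rho z).

Lemma martingale_lln (h : 'I_n -> state R n -> R) (Hb : R) :
  (forall m i, measurable_fun [set: K] (fun z : K => h i (path z m))) ->
  (forall m z i, `|h i (path z m)| <= Hb) ->
  {ae P, forall w, forall e, 0 < e -> exists m0, forall m, (m0 <= m)%N ->
    `|martingale h (path (sample w)) m| <= e * m%:R}.
Proof.
move=> mh bh.
have mz := measurable_clock_sample xi.
pose M m (z : K) := martingale h (path z) m.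
have mc m i := measurable_compensated E T mupd rho m i.
have mM m : measurable_fun [set: K] (M m).
  apply: measurable_sum => k; apply: measurable_sum => i.
  exact: measurable_funM (mh k i) (mc k i).
have MS m z : M m.+1 z - M m z =
    \sum_(i < n) h i (path z m) * compensated i (path z m) (path z m.+1).
  by rewrite /M /martingale big_nat_recr//= addrAC subrr add0r.
have bD m z : `|M m.+1 z - M m z| <= n%:R * (Hb * comp_bound T Rmax).
  rewrite MS (le_trans (ler_norm_sum _ _ _))//.
  apply: (@le_trans _ _ (\sum_(i < n) Hb * comp_bound T Rmax)); last first.
    by rewrite sumr_const card_ord mulr_natl.
  apply: ler_sum => i _; rewrite normrM ler_pM//.
  by apply: compensated_le.
have bM m z : `|M m z| <= m%:R * (n%:R * (Hb * comp_bound T Rmax)).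
  elim: m => [|m IH]; first by rewrite /M /martingale big_nil normr0 mul0r.
  rewrite -(subrK (M m z) (M m.+1 z)) (le_trans (ler_normD _ _))//.
  by rewrite -natr1 mulrDl mul1r addrC lerD.
apply: (orthogonal_lln (M := fun m w => M m (sample w))
  (C := n%:R * (Hb * comp_bound T Rmax))) => //.
- by move=> m; exact: (measurableT_comp (mM m) mz).
- by move=> w; rewrite /M /martingale big_nil.
- move=> m.
  under eq_Rintegral => w _ do rewrite MS mulr_sumr.
  have h0 i : \int[P]_w (M m (sample w) * (h i (path (sample w) m) *
      compensated i (path (sample w) m) (path (sample w) m.+1))) = 0.
    under eq_Rintegral => w _ do rewrite mulrA.
    apply: (@integral_compensated _ _ _ _ P xi indep exp_xi E T Rmax upd T0 Rmax0 mupd upd_bound rho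
      (fun z => M m z * h i (path z m)) m i (m%:R * (n%:R * (Hb * comp_bound T Rmax)) * Hb)).
    + exact: measurable_funM (mM m) (mh m i).
    + by move=> z; rewrite normrM ler_pM.
    + move=> z z' e; rewrite /M /martingale e//; congr (_ * _).
      apply: eq_big_nat => k /andP[_ km]; apply: eq_bigr => j _.
      by rewrite !e// ltnW.
  have int i : P.-integrable setT (EFin \o (fun w => M m (sample w) * (h i (path (sample w) m) *
      compensated i (path (sample w) m) (path (sample w) m.+1)))).
    apply: (@bounded_integrable _ _ _ _ _ (m%:R * (n%:R * (Hb * comp_bound T Rmax)) *
      (Hb * comp_bound T Rmax))).
      apply: (measurableT_comp (f := fun z : K => M m z * (h i (path z m) *
        compensated i (path z m) (path z m.+1))) _ mz).
      exact: measurable_funM (mM m) (measurable_funM (mh m i) (mc m i)).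
    move=> w; rewrite !normrM ler_pM// ?mulr_ge0// ler_pM//.
    exact: compensated_le.
  elim: (index_enum _) => [|i s IH].
    by under eq_Rintegral do rewrite big_nil; rewrite Rintegral_cst// mul0r.
  under eq_Rintegral do rewrite big_cons.
  rewrite RintegralD//; first by rewrite h0 add0r IH.
  have : P.-integrable setT (fun w => \sum_(j <- s) (M m (sample w) * (h j (path (sample w) m) *
      compensated j (path (sample w) m) (path (sample w) m.+1)))%:E)%E.
    by apply: integrable_sum => // j _; exact: int.
  by apply: eq_integrable => // w _; rewrite /= sumEFin.
Qed.

(** With all other clocks frozen, a tie forces the resampled clock to take one particular value, and
    the exponential law has no atoms. *)
Lemma no_ties : {ae P, forall w, forall m i,
  gap (sample w) (path (sample w) m) i <> other_gap (sample w) (path (sample w) m) i}.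
Proof.
apply: ae_foralln => m; apply: ae_forall_countable => i.
have : {ae P, forall w, forall c, idx (path (sample w) m) i = c ->
  gap (sample w) (path (sample w) m) i <> other_gap (sample w) (path (sample w) m) i}.
  apply: ae_foralln => c.
  pose A : set K := [set z | (idx (path z m) i == c) &&
    (gap z (path z m) i == other_gap z (path z m) i)].
  have MK := measurable_run_clock E T mupd rho m.
  have mK p : measurable_fun setT (fun z : K => z p) by exact: measurable_clock.
  have mA : measurable A.
    apply: measurable_fun_true; apply: measurable_and.
      exact: (@discrete_measurable _ _ _ (fun z : K => idx (path z m) i) _ _
        (fun v : nat => v == c) (m_idx MK i)).
    by apply: measurable_fun_eqr; [exact: measurable_gap|exact: measurable_other_gap].
  have mz := measurable_clock_sample xi.
  have mAs : measurable (sample @^-1` A).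
    by rewrite -[X in measurable X]setTI; exact: mz.
  have PA : P (sample @^-1` A) = 0%E.
    rewrite -[X in P X]setIT -integral_indic//.
    have bI (z : K) : `|\1_A z| <= 1 :> R.
      by rewrite indicE ger0_norm// lern1 leq_b1.
    have mI : measurable_fun [set: K] (\1_A : K -> R) by exact: measurable_indic.
    rewrite (_ : (fun x => _) = (fun w => (\1_A (sample w))%:E)); last first.
      by apply/funext => w; rewrite !indicE.
    rewrite (resample_integral indep (i, c) mI bI).
    apply: integral0_eq => w _.
    set z := sample w.
    have mset : measurable_fun setT (fun x : R => set_clock (i, c) x z : K).
      apply: measurable_fun_clock_space => q; rewrite /set_clock.
      by case: (q == (i, c)).
    have [Hs [[lt HH]|[N [Hc Ha Hr HN HH]]]] := run_set_clock E upd T0 rho z i c m.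
      apply: integral0_eq => x _; rewrite indicE memNset//=.
      by rewrite /A/= HH// (ltn_eqF lt).
    pose H := Hs m; pose a := age H i; pose Y := other_gap z H i.
    (* With [phi = 0] the lemma just says that a function vanishing at all positive points off a
       finite list integrates to 0; [a + rate H i * Y] is the only value giving a tie. *)
    apply: (@memoryless_compensation _ (distribution P (xi (i, c))) _ _
      (a + rate H i * Y :: N) 0 a 0) => //.
    + by move=> B mB; exact: exp_xi.
    + move=> x x1; rewrite inE negb_or => /andP[xaY xN].
      have [h1 h2] := HH x x1 xN; rewrite mul0r.
      split=> xa; rewrite indicE memNset//= /A/=.
        by rewrite gtn_eqF// h1.
      rewrite h2//= -/H.
      have gE : gap (set_clock (i, c) x z) H i = (x - a) / rate H i.
        rewrite -Hc -/H gap_set_clock_eq max_r// divr_ge0//.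
          by rewrite subr_ge0 ltW.
        exact/ltW/rate_gt0.
      have rg : 0 < rate H i by exact: rate_gt0.
      rewrite gE other_gap_set_clock -/Y => /andP[_ /eqP e].
      case/eqP: xaY; rewrite -e mulrC divfK ?gt_eqF//; ring.
    + exact: (measurableT_comp mI mset).
  exists (sample @^-1` A); split=> // w /= nh.
  have [/eqP e1|ne] := eqVneq (idx (path (sample w) m) i) c.
    have [e2|ne] := eqVneq (gap (sample w) (path (sample w) m) i)
       (other_gap (sample w) (path (sample w) m) i).
      by rewrite /A/= e1 e2 eqxx.
    by exfalso; apply: nh => _; exact/eqP.
  by exfalso; apply: nh => e; rewrite e eqxx in ne.
by apply: filterS => w h; exact: (h _ erefl).
Qed.

End AlmostSure.

(** * Utilities *)

Lemma proper_within01 (R : realType) :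
  ProperFilter (within `[0, 1]%classic (0 : R)^').
Proof.
apply: Build_ProperFilter_ex => A; rewrite /within /= => /nbhs_ballP[e /= e0 he].
pose x := Num.min (e / 2) 1.
have x0 : 0 < x by rewrite lt_min divr_gt0 ?ltr01.
exists x; apply: he.
- rewrite /ball/= sub0r normrN gtr0_norm// /x gt_min.
  by rewrite ltr_pdivrMr// mulr_natr mulr2n ltrDl e0.
- by rewrite gt_eqF.
- by rewrite /= in_itv/= ltW// ge_min lexx orbT.
Qed.

Section Utility.
Variables (R : realType) (U : R -> R).
Hypothesis utU : utility U.

Lemma concave01 x y t : 0 <= x <= 1 -> 0 <= y <= 1 -> 0 <= t <= 1 ->
  t * U x + (1 - t) * U y <= U (t * x + (1 - t) * y).
Proof.
move=> x01 y01 /andP[t0 t1].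
have [->|xy] := eqVneq x y.
  by rewrite -!mulrDl addrCA subrr addr0 !mul1r.
move: t0; rewrite le_eqVlt => /orP[/eqP<-|t0].
  by rewrite !mul0r subr0 !mul1r !add0r.
move: t1; rewrite le_eqVlt => /orP[/eqP->|t1].
  by rewrite subrr !mul0r !mul1r !addr0.
apply/ltW/(utility_concave utU) => //; rewrite ?in_itv//=.
by rewrite t0.
Qed.

(** Chord slopes from 0 of a concave function increase as the chord shrinks, and the derivative at 0
    is their limit. *)
Lemma utility_le_slope y : 0 <= y <= 1 -> U y - U 0 <= deriv01 U 0 * y.
Proof.
move=> /andP[y0 y1].
move: y0; rewrite le_eqVlt => /orP[/eqP<-|y0]; first by rewrite subrr mulr0.
rewrite -ler_pdivrMr//.
have cvgU := @utility_differentiable _ _ utU 0.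
have := proper_within01 R => PF.
apply: limr_ge; first by apply: cvgU; rewrite in_itv/= lexx ler01.
apply/nbhs_ballP; exists y => //= x; rewrite /ball/= sub0r normrN => xy x0.
rewrite in_itv/= => /andP[x0' x1].
have xp : 0 < x by rewrite lt_neqAle eq_sym x0.
rewrite ger0_norm// in xy.
rewrite /slope subr0 ler_pdivlMr// mulrAC -ler_pdivlMr ?invr_gt0// invrK.
have t01 : 0 <= x / y <= 1 by rewrite divr_ge0 ?(ltW y0)//= ler_pdivrMr// mul1r ltW.
have y01 : 0 <= y <= 1 by rewrite ltW.
have := concave01 y01 (_ : 0 <= 0 <= 1) t01; rewrite lexx ler01 => /(_ isT).
rewrite mulr0 addr0 divfK ?gt_eqF// => h.
have h' : x / y * (U y - U 0) <= U x - U 0.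
  by rewrite lerBrDr; apply: le_trans h; rewrite [leLHS](_ : _ = x / y * U y + (1 - x / y) * U 0)//; ring.
move: h'; rewrite mulrAC -ler_pdivlMr ?invr_gt0// invrK => h'.
by rewrite mulrC.
Qed.

Lemma utility_le x y : 0 <= x <= 1 -> 0 <= y <= 1 -> x <= y -> U x <= U y.
Proof.
move=> x01 y01; rewrite le_eqVlt => /orP[/eqP->//|xy].
by apply/ltW/(utility_increasing utU) => //; rewrite in_itv.
Qed.

Lemma deriv01_ge0 : 0 <= deriv01 U 0.
Proof.
have := @utility_le_slope 1; rewrite ler01 lexx mulr1 => /(_ isT); apply: le_trans.
by rewrite subr_ge0 utility_le ?lexx ?ler01.
Qed.

Lemma utility_osc x y : 0 <= x <= 1 -> 0 <= y <= 1 -> U x - U y <= deriv01 U 0.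
Proof.
move=> x01 y01; have /andP[y0 y1] := y01; have /andP[x0 x1] := x01.
have h1 : U 0 <= U y by apply: utility_le; rewrite ?lexx ?ler01.
have h2 := utility_le_slope x01.
have h3 : deriv01 U 0 * x <= deriv01 U 0 by rewrite ler_piMr// deriv01_ge0.
lra.
Qed.

Lemma average_itv (x : nat -> R) J : (0 < J)%N -> (forall j, 0 <= x j <= 1) ->
  0 <= average x J <= 1.
Proof.
move=> J0 x01; have J0' : 0 < J%:R :> R by rewrite ltr0n.
rewrite /average mulr_ge0 ?invr_ge0 ?sumr_ge0//=; last first.
  by move=> j _; have /andP[] := x01 j.
rewrite mulrC ler_pdivrMr// mul1r.
apply: (@le_trans _ _ (\sum_(0 <= j < J) 1)).
  by apply: ler_sum => j _; have /andP[] := x01 j.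
by rewrite sumr_const_nat subn0.
Qed.

(** Jensen's inequality, by viewing each average as a two-point mixture of the previous average and
    the last value. *)
Lemma average_utility (x : nat -> R) J : (0 < J)%N -> (forall j, 0 <= x j <= 1) ->
  average (U \o x) J <= U (average x J).
Proof.
move=> J0 x01; case: J J0 => // J _; elim: J => [|J IH].
  by rewrite /average !big_nat1 invr1 !mul1r.
have e (y : nat -> R) : average y J.+2 =
    (J.+1%:R / J.+2%:R) * average y J.+1 + (1 - J.+1%:R / J.+2%:R) * y J.+1.
  rewrite /average big_nat_recr//=; move: (\sum_(0 <= j < J.+1) _) => A.
  have -> : J.+2%:R = J.+1%:R + 1 :> R by rewrite -natr1.
  have a0 : 0 < J.+1%:R :> R by [].
  move: (J.+1%:R) a0 => a a0.
  have a1 : a + 1 != 0 by rewrite gt_eqF// addr_gt0.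
  by field; rewrite a1 gt_eqF.
have t01 : 0 <= (J.+1%:R / J.+2%:R : R) <= 1.
  by rewrite divr_ge0//= ler_pdivrMr// mul1r ler_nat.
rewrite !e; apply: le_trans (concave01 (average_itv _ x01) (x01 _) t01) => //.
rewrite lerD2r ler_wpM2l//; by have /andP[] := t01.
Qed.

Section Rate.
Variable beta : R.
Hypothesis beta0 : 0 < beta.
Local Notation obj r := (fun y => beta * U y - r * y).

(* [rate_choice r] is the maximizer of [obj r] when there is one.  This form
   makes it antitone, hence measurable, in [r], for arbitrary [U]. *)
Definition rate_choices (r : R) : set R :=
  [set y | 0 <= y <= 1 /\ forall z, 0 <= z <= y -> obj r z <= obj r y].

Definition rate_choice (r : R) : R := sup (rate_choices r).

Lemma rate_choices0 r : rate_choices r 0.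
Proof.
split=> [|z /andP[z0 z1]]; first by rewrite lexx ler01.
by have -> : z = 0 by apply/eqP; rewrite eq_le z0 z1.
Qed.

Lemma rate_choices_ub r : ubound (rate_choices r) 1.
Proof. by move=> y [/andP[]]. Qed.

(** Lowering the price [r] favours larger arguments, so a choice for [r'] remains one for [r]; the
    comparison with smaller [z] only is what makes this inclusion hold. *)
Lemma rate_choice_antitone r r' : r <= r' -> rate_choice r' <= rate_choice r.
Proof.
move=> rr'; apply: ge_sup; first by exists 0; exact: rate_choices0.
move=> y [y01 h]; apply: ub_le_sup; first by exists 1; exact: rate_choices_ub.
split=> // z zy; have := h z zy.
have : (r' - r) * z <= (r' - r) * y.
  by rewrite ler_wpM2l ?subr_ge0//; have /andP[] := zy.
lra.
Qed.

Lemma measurable_rate_choice : measurable_fun setT rate_choice.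
Proof.
by apply: nonincreasing_measurable => // x y; exact: rate_choice_antitone.
Qed.

Lemma argmax_rate_choice r y : argmax01 (obj r) y -> y = rate_choice r.
Proof.
move=> [yi ymax]; have y01 : 0 <= y <= 1 by move: yi; rewrite in_itv.
have yr : rate_choices r y.
  split=> // z /andP[z0 zy]; apply: ymax; rewrite in_itv/= z0 (le_trans zy)//.
  by have /andP[] := y01.
apply/eqP; rewrite eq_le; apply/andP; split.
  by apply: ub_le_sup => //; exists 1; exact: rate_choices_ub.
apply: ge_sup; first by exists 0; exact: rate_choices0.
move=> x [x01 hx]; rewrite leNgt; apply/negP => yx.
(* A choice [x] beyond the maximizer [y] would be a second maximizer, and strict concavity would
   make their midpoint better than both. *)
have h1 : obj r y <= obj r x by apply: hx; have /andP[-> _] := y01; exact: ltW.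
have xi : x \in `[0, 1] by rewrite in_itv.
have h2 : obj r x <= obj r y by apply: ymax.
have xy : x != y by rewrite gt_eqF.
have t01 : 0 < (2^-1 : R) < 1 by rewrite invr_gt0 ltr0n invf_lt1// ltr1n.
have := utility_concave utU xi yi xy t01.
set m := 2^-1 * x + (1 - 2^-1) * y => hm.
have /andP[x0 x1] := x01; have /andP[y0 y1] := y01.
have hm' : obj r m <= obj r y.
  by apply: ymax; rewrite in_itv/= /m; lra.
have : beta * (2^-1 * U x + (1 - 2^-1) * U y) < beta * U m by rewrite ltr_pM2l.
move: h1 h2 hm' => /=; rewrite /m; lra.
Qed.

Lemma argmax_large r y : beta * deriv01 U 0 < r -> argmax01 (obj r) y -> y = 0.
Proof.
move=> hr [yi ymax]; have y01 : 0 <= y <= 1 by move: yi; rewrite in_itv.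
have /andP[y0 y1] := y01.
have := ymax 0; rewrite in_itv/= lexx ler01 => /(_ isT) h0.
have h1 := utility_le_slope y01.
have h2 : beta * (U y - U 0) <= beta * (deriv01 U 0 * y) by rewrite ler_pM2l.
apply/eqP; rewrite eq_le y0 andbT leNgt; apply/negP => yp.
have h3 : 0 < (r - beta * deriv01 U 0) * y by rewrite mulr_gt0// subr_gt0.
lra.
Qed.

Lemma argmax_zero : argmax01 (obj 0) 1.
Proof.
split; first by rewrite in_itv/= ler01 lexx.
move=> z; rewrite in_itv/= => z01; rewrite !mul0r !subr0 ler_pM2l//.
by apply: utility_le; rewrite ?lexx ?ler01//; have /andP[] := z01.
Qed.

End Rate.
End Utility.

Lemma deriv01_le_max_slope (R : realType) n (U : 'I_n -> R -> R) i :
  deriv01 (U i) 0 <= max_slope U.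
Proof. exact: le_bigmax. Qed.

Lemma max_slope_ge0 (R : realType) n (U : 'I_n -> R -> R) : 0 <= max_slope U.
Proof. by rewrite /max_slope; exact: bigmax_ge_id. Qed.

(** * Queue lengths *)

Section TimeIntegral.
Variable R : realType.
Implicit Types (s t u : R) (f : R -> R).
Local Notation mu := (@lebesgue_measure R).

Lemma lebesgue_measure_itv_lty s t b b' :
  (mu [set` Interval (BSide b s) (BSide b' t)] < +oo)%E.
Proof.
by rewrite lebesgue_measure_itv/=; case: ifP => _; rewrite ?ltry// -EFinB ltry.
Qed.

Lemma time_integral_cst s t c f : s <= t -> (forall u, s <= u < t -> f u = c) ->
  time_integral s t f = c * (t - s).
Proof.
rewrite le_eqVlt => /orP[/eqP<- _|st hf].
  by rewrite /time_integral set_itv1 Rintegral_set1 subrr mulr0.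
rewrite /time_integral -Rintegral_itv_bndo_bndc; last first.
  apply: (@eq_integrable _ _ _ _ _ _ (fun=> c%:E)) => //.
    by move=> u; rewrite inE/= in_itv/= => /hf ->.
  apply: (@measurable_bounded_integrable _ _ _ mu (cst c)) => //.
    exact: lebesgue_measure_itv_lty.
  exact: bounded_cst.
transitivity (\int[mu]_(u in `[s, t[) (cst c u)).
  by apply: eq_Rintegral => u; rewrite inE/= in_itv/= => /hf.
rewrite Rintegral_cst//; congr (_ * _).
rewrite [X in fine X](_ : _ = (t - s)%:E)//.
by apply: etrans (lebesgue_measure_itv `[s, t[) _; rewrite /= lte_fin st -EFinB.
Qed.

Lemma bounded_integrable_itv s t f C : measurable_fun `[s, t] f ->
  (forall u, s <= u <= t -> `|f u| <= C) -> mu.-integrable `[s, t] (EFin \o f).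
Proof.
move=> mf fC; apply: measurable_bounded_integrable => //.
  exact: lebesgue_measure_itv_lty.
exists C; split; first by rewrite num_real.
move=> y Cy u /=; rewrite in_itv/= => /fC h; exact: le_trans h (ltW Cy).
Qed.

Lemma time_integral_split s u t f : s <= u -> u <= t ->
  mu.-integrable `[s, t] (EFin \o f) ->
  time_integral s t f = time_integral s u f + time_integral u t f.
Proof.
move=> su ut int; rewrite /time_integral.
have h := Rintegral_itvB int (_ : BLeft s <= BRight u)%O (_ : BRight u <= BRight t)%O.
rewrite -[X in _ = _ + X]Rintegral_itv_obnd_cbnd; last first.
  by apply: integrableS int => //; apply: subset_itvr; rewrite bnd_simp.
by rewrite -h ?bnd_simp// addrC subrK.
Qed.

Lemma time_integral_ge0 s t f : (forall u, s <= u <= t -> 0 <= f u) ->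
  0 <= time_integral s t f.
Proof. by move=> f0; apply: Rintegral_ge0 => u /=; rewrite in_itv/= => /f0. Qed.

Lemma eq_time_integral s t f g : (forall u, s <= u <= t -> f u = g u) ->
  time_integral s t f = time_integral s t g.
Proof. by move=> fg; apply: eq_Rintegral => u; rewrite inE/= in_itv/= => /fg. Qed.

Lemma heldE (T : R) x j u : 0 < T -> j%:R * T <= u < j.+1%:R * T -> held T x u = x j.
Proof.
move=> T0 h; rewrite /held (@truncn_def _ _ j)//.
by rewrite ler_pdivlMr// ltr_pdivrMr.
Qed.

Lemma slot_of (T : R) u : 0 < T -> 0 <= u -> exists j, j%:R * T <= u < j.+1%:R * T.
Proof.
move=> T0 u0; exists (Num.truncn (u / T)).
by rewrite -ler_pdivlMr// -ltr_pdivrMr// truncn_itv// divr_ge0// ltW.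
Qed.

Lemma measurable_held (T : R) (x : nat -> R) : 0 < T -> measurable_fun setT (held T x).
Proof.
move=> T0 _ B mB; rewrite setTI.
have -> : held T x @^-1` B =
    \bigcup_(k in [set k | B (x k)]) [set u | Num.truncn (u / T) = k].
  apply/seteqP; split=> u /=; first by move=> Bu; exists (Num.truncn (u / T)).
  by move=> [k Bk e]; rewrite /held e.
apply: bigcup_measurable => k _.
have mt : measurable_fun setT (fun u : R => (Num.truncn (u / T))%:R : R).
  apply: nondecreasing_measurable => // u v uv; rewrite ler_nat le_truncn//.
  by rewrite ler_pM2r// invr_gt0.
have := mt measurableT [set k%:R] (measurable_set1 _); rewrite setTI.
congr measurable; apply/seteqP; split=> u /= => [|->//].
by move/eqP; rewrite eqr_nat => /eqP.
Qed.

End TimeIntegral.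

Section Queue.
Variables (R : realType) (n : nat) (U : 'I_n -> R -> R).
Hypothesis utU : forall i, utility (U i).
Variables (alpha beta T : R).
Hypotheses (alpha0 : 0 < alpha) (beta0 : 0 < beta) (T0 : 0 < T).
Variables (sigma : R -> {ffun 'I_n -> bool}) (r lam : 'I_n -> nat -> R).
Hypothesis rlP : parameter_path U alpha beta T sigma r lam.
Local Notation V := (max_slope U).

Lemma lam_itv i j : 0 <= lam i j <= 1.
Proof.
case: j => [|j]; first by rewrite (lam_init rlP) ler01 lexx.
by have [] := lam_update rlP i j; rewrite in_itv.
Qed.

Lemma service_ge0 i j : 0 <= service T sigma i j.
Proof.
by rewrite mulr_ge0 ?invr_ge0 ?(ltW T0)//; apply: time_integral_ge0.
Qed.

(** Above [beta * V] the price exceeds every marginal utility and no data is generated, so the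
    parameter can overshoot that level by one increment [alpha] only. *)
Lemma r_bounded i j : 0 <= r i j <= beta * V + alpha.
Proof.
have V0 : 0 <= beta * V by rewrite mulr_ge0 ?max_slope_ge0// ltW.
elim: j => [|j /andP[r0 rV]].
  by rewrite (r_init rlP) lexx addr_ge0// ltW.
have /andP[l0 l1] := lam_itv i j.
have s0 := mulr_ge0 (ltW alpha0) (service_ge0 i j).
rewrite (r_update rlP) addr_ge0 ?mulr_ge0 ?le_max ?lexx ?orbT ?(ltW alpha0)//=.
have al : alpha * lam i j <= alpha by rewrite ler_piMr// ltW.
have [h|h] := leP (r i j) (beta * V).
  by apply: lerD => //; rewrite ge_max V0 andbT lerBlDr ler_wpDr.
(* In slot 0 the value of [lam] is imposed rather than optimal, but there [r] vanishes and cannot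
   exceed the level. *)
have lam0 : lam i j = 0.
  case: j h {r0 rV s0 al l0 l1} => [|j] h.
    by move: h; rewrite (r_init rlP) ltNge V0.
  apply: (@argmax_large _ (U i) (utU i) beta beta0 (r i j.+1)); last first.
    exact: lam_update rlP i j.
  by apply: le_lt_trans h; rewrite ler_pM2l// deriv01_le_max_slope.
rewrite lam0 mulr0 addr0 ge_max (le_trans _ rV) ?lerBlDr ?lerDl//=.
by rewrite addr_ge0// ltW.
Qed.

Variables (i : 'I_n) (Q : R -> R).
Hypothesis QP : queue_path (held T (lam i)) (fun t => sigma t i) Q.

(** If the queue empties at some [u] in the slot, only arrivals after [u] count; otherwise it is
    positive throughout and is served exactly while transmitting. Thus the unspecified departure
    rate of an empty queue does not matter. *)
Lemma queue_slot j t : j%:R * T <= t <= j.+1%:R * T ->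
  Q t <= Num.max (Q (j%:R * T) -
    time_integral (j%:R * T) t (fun u => (sigma u i)%:R)) 0 + lam i j * (t - j%:R * T).
Proof.
move=> /andP[jt tj]; have /andP[l0 l1] := lam_itv i j.
have [_ Q0 [dep [mdep dep01 depQ Qeq]]] := QP.
have j0 : 0 <= j%:R * T by rewrite mulr_ge0// ltW.
have hl u : j%:R * T <= u -> u <= t ->
    time_integral u t (held T (lam i)) = lam i j * (t - u).
  move=> ju ut; apply: time_integral_cst => // v /andP[uv vt].
  by apply: heldE => //; rewrite (le_trans ju)//= (lt_le_trans vt).
have le0 : 0 <= lam i j * (t - j%:R * T) by rewrite mulr_ge0// subr_ge0.
have [[u [/andP[ju ut] Qu]]|noz] := pselect (exists u, j%:R * T <= u <= t /\ Q u = 0).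
  apply: (@le_trans _ _ (lam i j * (t - j%:R * T))); last by rewrite lerDr le_max lexx orbT.
  move: ut; rewrite le_eqVlt => /orP[/eqP ut|ut]; first by rewrite -ut Qu ut.
  have u0 := le_trans j0 ju.
  rewrite (Qeq u t u0 ut) Qu sub0r (hl u ju (ltW ut)).
  have d0 : 0 <= time_integral u t dep.
    apply: time_integral_ge0 => v /andP[uv _].
    by have /andP[] := dep01 v (le_trans u0 uv).
  have h2 : lam i j * (t - u) <= lam i j * (t - j%:R * T).
    by rewrite ler_wpM2l// lerD2l lerN2.
  by apply: le_trans h2; rewrite gerDr oppr_le0.
move: jt; rewrite le_eqVlt => /orP[/eqP jt|jt].
  rewrite -jt subrr mulr0 addr0 /time_integral set_itv1 Rintegral_set1 subr0.
  by rewrite le_max lexx.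
rewrite (Qeq (j%:R * T) t j0 jt) (hl _ (lexx _) (ltW jt)) lerD2r le_max; apply/orP; left.
rewrite (@eq_time_integral _ _ _ dep (fun u => (sigma u i)%:R))// => u uit.
have u0 : 0 <= u by apply: le_trans j0 _; have /andP[] := uit.
apply: depQ => //; rewrite lt_neqAle Q0// andbT; apply/eqP => Qu0.
by apply: noz; exists u.
Qed.

(** Over a full slot, the bound of [queue_slot] is the recursion defining [r] scaled by
    [T / alpha]. *)
Lemma queue_slot_start j : Q (j%:R * T) <= T / alpha * r i j.
Proof.
elim: j => [|j IH].
  by rewrite mul0r (r_init rlP) mulr0; have [->] := QP.
have h : j%:R * T <= j.+1%:R * T <= j.+1%:R * T.
  by rewrite lexx andbT ler_pM2r// ler_nat.
apply: (le_trans (queue_slot h)).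
have -> : j.+1%:R * T - j%:R * T = T by rewrite -natr1; ring.
have Ta0 : 0 < T / alpha by rewrite divr_gt0.
rewrite (r_update rlP) mulrDr; apply: lerD; last first.
  by rewrite mulrCA mulrA [alpha * _]mulrCA divff ?gt_eqF// mulr1 mulrC.
rewrite maxr_pMr ?(ltW Ta0)// mulr0 ge_max !le_max lexx orbT andbT.
apply/orP; left; rewrite mulrBr lerB//.
by rewrite /service mulrA mulrA divfK ?gt_eqF// divff ?gt_eqF// mul1r.
Qed.

Lemma queue_bound t : 0 <= t -> Q t <= T * (beta * V + 2 * alpha) / alpha.
Proof.
move=> t0; have [j /andP[jt tj]] := slot_of T0 t0.
have /andP[l0 l1] := lam_itv i j.
have /andP[r0 rV] := r_bounded i j.
have h : j%:R * T <= t <= j.+1%:R * T by rewrite jt ltW.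
apply: (le_trans (queue_slot h)).
have -> : T * (beta * V + 2 * alpha) / alpha = T / alpha * (beta * V + alpha) + T.
  by field; rewrite gt_eqF.
have Ta0 : 0 < T / alpha by rewrite divr_gt0.
apply: lerD.
  apply: (@le_trans _ _ (T / alpha * r i j)); last by rewrite ler_pM2l.
  rewrite ge_max mulr_ge0 ?(ltW Ta0)// andbT.
  apply: le_trans (queue_slot_start j); rewrite gerDl oppr_le0.
  exact: time_integral_ge0.
have tT : t - j%:R * T <= T.
  by rewrite lerBlDr ltW// (lt_le_trans tj)// -natr1 mulrDl mul1r addrC.
by rewrite -[leRHS]mul1r ler_pM// subr_ge0.
Qed.

End Queue.

(** * The generator of the schedule for frozen parameters *)

Definition ring_at (n : nat) (E : rel 'I_n) (s : {ffun 'I_n -> bool}) (i : 'I_n) :=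
  [ffun k => if k == i then flip E s i else s k].

Definition rate_of (R : realType) (n : nat) (r : 'I_n -> R)
    (s : {ffun 'I_n -> bool}) (i : 'I_n) : R :=
  if s i then 1 else expR (r i).

Definition generator (R : realType) (n : nat) (E : rel 'I_n) (r : 'I_n -> R)
    (f : {ffun 'I_n -> bool} -> R) (s : {ffun 'I_n -> bool}) : R :=
  \sum_(i < n) rate_of r s i * (f (ring_at E s i) - f s).

Definition energy (R : realType) (n : nat) (r : 'I_n -> R)
    (s : {ffun 'I_n -> bool}) : R := \sum_(i < n) r i * (s i)%:R.

Definition jump_step (R : realType) (n : nat) (E : rel 'I_n) (q : R) (r : 'I_n -> R)
    (f : {ffun 'I_n -> bool} -> R) (s : {ffun 'I_n -> bool}) : R :=
  f s + q^-1 * generator E r f s.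

Definition jump_iter (R : realType) (n : nat) (E : rel 'I_n) (q : R) (r : 'I_n -> R)
    (k : nat) : {ffun 'I_n -> bool} -> R :=
  iter k (jump_step E q r) (energy r).

Definition cesaro (R : realType) (n : nat) (E : rel 'I_n) (q : R) (N : nat)
    (r : 'I_n -> R) (s : {ffun 'I_n -> bool}) : R :=
  N%:R^-1 * \sum_(0 <= k < N) jump_iter E q r k s.

(* An approximate solution of the Poisson equation [L f = energy - mean]: the
   mean is replaced by the Cesaro average of the iterates. *)
Definition potential (R : realType) (n : nat) (E : rel 'I_n) (q : R) (N : nat)
    (r : 'I_n -> R) (s : {ffun 'I_n -> bool}) : R :=
  - (q * N%:R)^-1 * \sum_(0 <= k < N) \sum_(0 <= l < k) jump_iter E q r l s.

Section Generator.
Variables (R : realType) (n : nat) (E : rel 'I_n).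
Hypotheses (symE : symmetric E) (irrE : irreflexive E).
Variables (r : 'I_n -> R) (Rmax : R).
Hypothesis r_bound : forall i, 0 <= r i <= Rmax.
Implicit Types (s : {ffun 'I_n -> bool}) (f g : {ffun 'I_n -> bool} -> R).

Local Notation S := (schedules E).
Local Notation W s := (expR (energy r s)).

Lemma schedulesP s :
  reflect (forall i j, E i j -> s i -> ~~ s j) (s \in S).
Proof.
rewrite inE; apply: (iffP forallP) => [h i j Eij si|h i].
  have /forallP /(_ j) := h i; rewrite Eij /= si.
  by case: (s j).
apply/forallP => j; apply/implyP => Eij.
have := h i j Eij; case: (s i) => [/(_ isT)|_]; case: (s j) => //.
Qed.

Lemma ring_at_in s i : s \in S -> ring_at E s i \in S.
Proof.
move=> /schedulesP hs; apply/schedulesP => j k Ejk; rewrite !ffunE.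
have [ji|ji] := eqVneq j i; have [ki|ki] := eqVneq k i.
- by move: Ejk; rewrite ji ki irrE.
- by move=> /andP[_ /forallP /(_ k)]; rewrite -ji Ejk.
- move=> sj; rewrite /flip negb_and negbK; apply/orP; right.
  rewrite negb_forall; apply/existsP; exists j.
  by rewrite -ki symE Ejk /= sj.
- exact: hs.
Qed.

Lemma ring_at_on s i : s \in S -> s i ->
  [/\ ring_at E s i \in S, ~~ ring_at E s i i, flip E (ring_at E s i) i &
      ring_at E (ring_at E s i) i = s].
Proof.
move=> sS si; have sS' := ring_at_in i sS.
have ni : ~~ ring_at E s i i by rewrite ffunE eqxx /flip si.
have fl : flip E (ring_at E s i) i.
  rewrite /flip ni; apply/forallP => m; apply/implyP => Eim; rewrite ffunE.
  case: eqP => [mi|_]; first by rewrite mi irrE in Eim.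
  by move/schedulesP : sS => /(_ _ _ Eim si).
split=> //; apply/ffunP => k; rewrite ffunE fl ffunE.
by have [->|//] := eqVneq k i; rewrite si.
Qed.

Lemma ring_at_free s i : s \in S -> flip E s i ->
  ring_at E s i i /\ ring_at E (ring_at E s i) i = s.
Proof.
move=> sS fl; have ri : ring_at E s i i by rewrite ffunE eqxx.
split=> //; apply/ffunP => k; rewrite ffunE /flip ri/= ffunE.
by have [->|//] := eqVneq k i; case/andP : fl => /negbTE.
Qed.

Lemma ring_at_blocked s i : ~~ s i -> ~~ flip E s i -> ring_at E s i = s.
Proof.
move=> si fl; apply/ffunP => k; rewrite ffunE.
by have [->|//] := eqVneq k i; rewrite (negbTE si) (negbTE fl).
Qed.

Lemma energy_ring_at s i : s i ->
  energy r s = energy r (ring_at E s i) + r i.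
Proof.
move=> si; rewrite /energy (bigD1 i)//= [in RHS](bigD1 i)//= si ffunE eqxx /flip si/=.
rewrite mulr1 mulr0 add0r addrC; congr (_ + _).
by apply: eq_bigr => k ki; rewrite ffunE (negbTE ki).
Qed.

(** Detailed balance: a feasible schedule with [i] on is paired with the one where [i] is off; the
    weights have ratio [expR (r i)], which is the ratio of the two rates. Blocked rings change
    nothing and drop out. *)
Lemma dirichlet_form f g :
  \sum_(s in S) W s * (f s * generator E r g s) =
  - \sum_(i < n) \sum_(s in S | s i)
      W s * ((f s - f (ring_at E s i)) * (g s - g (ring_at E s i))).
Proof.
under eq_bigr do rewrite mulr_sumr mulr_sumr.
rewrite exchange_big /= -sumrN; apply: eq_bigr => i _.
rewrite (bigID (fun s => s i))/=.
rewrite [X in _ + X](bigID (fun s => flip E s i))/=.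
rewrite [X in _ + (_ + X)]big1 ?addr0; last first.
  by move=> s /andP[/andP[_ si] fl]; rewrite ring_at_blocked// subrr !mulr0.
rewrite [X in _ + X](reindex_onto (fun s => ring_at E s i) (fun s => ring_at E s i))/=; last first.
  by move=> s /andP[/andP[sS _]] /(ring_at_free sS)[].
have eP s : (ring_at E s i \in S) && ~~ ring_at E s i i &&
    flip E (ring_at E s i) i && (ring_at E (ring_at E s i) i == s) =
    (s \in S) && s i.
  apply/idP/idP => [/andP[/andP[/andP[h1 h2] h3] /eqP h4]|/andP[sS si]].
    by rewrite -h4 ring_at_in//= (ring_at_free h1 h3).1.
  by have [-> -> -> ->] := ring_at_on sS si; rewrite eqxx.
under [X in _ + X]eq_bigl => s do rewrite eP.
rewrite -big_split -sumrN; apply: eq_bigr => s /andP[sS si] /=.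
have [_ ni _ ->] := ring_at_on sS si.
rewrite /rate_of si (negbTE ni) (energy_ring_at si) expRD; ring.
Qed.

Lemma sum_generator f : \sum_(s in S) W s * generator E r f s = 0.
Proof.
have := dirichlet_form (fun=> 1) f.
under eq_bigr do rewrite mul1r.
move=> ->; rewrite big1 ?oppr0// => i _; rewrite big1// => s _.
by rewrite subrr mul0r mulr0.
Qed.

Local Notation q := (n%:R * expR Rmax).
Hypothesis n0 : (0 < n)%N.

Lemma q_gt0 : 0 < q.
Proof. by rewrite mulr_gt0 ?expR_gt0 ?ltr0n. Qed.

Lemma rate_of_bound s i : 0 <= rate_of r s i <= expR Rmax.
Proof.
have /andP[r0 rR] := r_bound i.
rewrite /rate_of; case: ifP => _; last by rewrite expR_ge0 ler_expR.
by rewrite ler01 -expR0 ler_expR (le_trans r0).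
Qed.

(** Since [q] dominates the total rate, [jump_step] averages the values of [f]: it is a Markov
    kernel. *)
Lemma jump_step_mono f a b : (forall s, a <= f s <= b) ->
  forall s, a <= jump_step E q r f s <= b.
Proof.
move=> fab s; rewrite /jump_step /generator.
have -> : f s + q^-1 * (\sum_(i < n) rate_of r s i * (f (ring_at E s i) - f s)) =
   (1 - q^-1 * \sum_(i < n) rate_of r s i) * f s +
   q^-1 * \sum_(i < n) rate_of r s i * f (ring_at E s i).
  under eq_bigr do rewrite mulrBr.
  by rewrite big_split/= sumrN -mulr_suml; ring.
set c := \sum_(i < n) rate_of r s i.
have c0 : 0 <= c by apply: sumr_ge0 => i _; have /andP[] := rate_of_bound s i.
have q0 := q_gt0.
have cq : c <= q.
  apply: (@le_trans _ _ (\sum_(i < n) expR Rmax)); last first.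
    by rewrite sumr_const card_ord mulr_natl.
  by apply: ler_sum => i _; have /andP[] := rate_of_bound s i.
have cq1 : 0 <= 1 - q^-1 * c by rewrite subr_ge0 mulrC ler_pdivrMr// mul1r.
have la : c * a <= \sum_(i < n) rate_of r s i * f (ring_at E s i).
  rewrite mulr_suml; apply: ler_sum => i _; have /andP[r0 _] := rate_of_bound s i.
  by rewrite ler_wpM2l//; have /andP[] := fab (ring_at E s i).
have lb : \sum_(i < n) rate_of r s i * f (ring_at E s i) <= c * b.
  rewrite mulr_suml; apply: ler_sum => i _; have /andP[r0 _] := rate_of_bound s i.
  by rewrite ler_wpM2l//; have /andP[] := fab (ring_at E s i).
have /andP[fa fb] := fab s.
have qi0 : 0 <= q^-1 by rewrite invr_ge0 ltW.
have h1 := ler_wpM2l qi0 la; have h2 := ler_wpM2l qi0 lb.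
have h3 := ler_wpM2l cq1 fa; have h4 := ler_wpM2l cq1 fb.
apply/andP; split.
  by apply: le_trans (lerD h3 h1); rewrite [leRHS](_ : _ = a)//; ring.
by apply: le_trans (lerD h4 h2) _; rewrite [leLHS](_ : _ = b)//; ring.
Qed.

Lemma energy_bound s : 0 <= energy r s <= n%:R * Rmax.
Proof.
apply/andP; split.
  by apply: sumr_ge0 => i _; rewrite mulr_ge0//; have /andP[] := r_bound i.
apply: (@le_trans _ _ (\sum_(i < n) Rmax)); last first.
  by rewrite sumr_const card_ord mulr_natl.
apply: ler_sum => i _; have /andP[h1 h2] := r_bound i.
by case: (s i); rewrite ?mulr1// mulr0 (le_trans h1).
Qed.

Lemma jump_iter_bound k s : 0 <= jump_iter E q r k s <= n%:R * Rmax.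
Proof. by elim: k s => [|k IH] s; [exact: energy_bound|exact: jump_step_mono]. Qed.

Lemma generator_jump_iter k s : generator E r (jump_iter E q r k) s =
  q * (jump_iter E q r k.+1 s - jump_iter E q r k s).
Proof.
by rewrite /jump_iter iterS /jump_step addrAC subrr add0r mulrA divff ?mul1r// gt_eqF// q_gt0.
Qed.

Lemma generator_sum (F : nat -> {ffun 'I_n -> bool} -> R) m c s :
  generator E r (fun s => c * \sum_(0 <= k < m) F k s) s =
  c * \sum_(0 <= k < m) generator E r (F k) s.
Proof.
rewrite /generator exchange_big [RHS]mulr_sumr; apply: eq_bigr => i _ /=.
rewrite -mulrBr -sumrB mulrCA; congr (_ * _).
by rewrite mulr_sumr.
Qed.

(** The generator acts on iterates as [q] times a forward difference, so the sum telescopes and the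
    factor [N%:R^-1] makes the result small. *)
Lemma generator_cesaro N s : (0 < N)%N -> generator E r (cesaro E q N r) s =
  q / N%:R * (jump_iter E q r N s - energy r s).
Proof.
move=> N0; rewrite generator_sum.
under eq_bigr do rewrite generator_jump_iter.
rewrite -mulr_sumr telescope_sumr//; rewrite -[jump_iter _ _ _ 0 _]/(energy r s); ring.
Qed.

(** Each inner sum telescopes to [q * (jump_iter k - energy)]; averaging over [k] turns the iterates
    into [cesaro]. *)
Lemma generator_potential N s : (0 < N)%N -> generator E r (potential E q N r) s =
  energy r s - cesaro E q N r s.
Proof.
move=> N0.
rewrite (generator_sum (fun k s => \sum_(0 <= l < k) jump_iter E q r l s)).
have h k : generator E r (fun s => \sum_(0 <= l < k) jump_iter E q r l s) s =
   q * (jump_iter E q r k s - energy r s).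
  transitivity (generator E r (fun s => 1 * \sum_(0 <= l < k) jump_iter E q r l s) s).
    by apply: eq_bigr => i _; rewrite !mul1r.
  rewrite generator_sum mul1r.
  under eq_bigr do rewrite generator_jump_iter.
  by rewrite -mulr_sumr telescope_sumr.
under eq_bigr do rewrite h.
rewrite -mulr_sumr sumrB sumr_const_nat subn0 /cesaro.
have q0 := q_gt0; have N0' : 0 < N%:R :> R by rewrite ltr0n.
move: (\sum_(0 <= k < N) _) => A; rewrite -mulr_natl.
by field; rewrite !gt_eqF ?expR_gt0// ltr0n.
Qed.

(** At most [N ^ 2] iterates, each in [[0, n * Rmax]], divided by [q * N]. *)
Lemma potential_bound N s : (0 < N)%N ->
  `|potential E q N r s| <= N%:R * (n%:R * Rmax) / q.
Proof.
move=> N0; have q0 := q_gt0; have N0' : 0 < N%:R :> R by rewrite ltr0n.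
have qN : 0 < q * N%:R by rewrite mulr_gt0.
rewrite /potential normrM normrN (@ger0_norm _ (q * N%:R)^-1) ?invr_ge0 ?(ltW qN)//.
have G0 : 0 <= n%:R * Rmax.
  by have /andP[h1 h2] := energy_bound s; exact: le_trans h2.
rewrite [X in X <= _]mulrC ler_pdivrMr//.
have -> : N%:R * (n%:R * Rmax) / q * (q * N%:R) = \sum_(0 <= k < N) (N%:R * (n%:R * Rmax)).
  by rewrite sumr_const_nat subn0 -mulr_natl; field; rewrite !gt_eqF ?expR_gt0// ltr0n.
rewrite (le_trans (ler_norm_sum _ _ _))// big_nat [leRHS]big_nat.
apply: ler_sum => k /andP[_ kN].
rewrite (le_trans (ler_norm_sum _ _ _))//.
apply: (@le_trans _ _ (\sum_(0 <= l < k) (n%:R * Rmax))).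
  apply: ler_sum => l _; have /andP[h1 h2] := jump_iter_bound l s.
  by rewrite ger0_norm.
by rewrite sumr_const_nat subn0 -[leLHS]mulr_natl ler_wpM2r// ler_nat ltnW.
Qed.

End Generator.

Lemma measurable_potential (R : realType) n (E : rel 'I_n) q N d
    (X : measurableType d) (r : X -> 'I_n -> R) s :
  (forall i, measurable_fun setT (fun x => r x i)) ->
  measurable_fun setT (fun x => potential E q N (r x) s).
Proof.
move=> mr.
have mg s' : measurable_fun setT (fun x => energy (r x) s').
  by apply: measurable_sum => i; apply: measurable_funM.
have mrate s' i : measurable_fun setT (fun x => rate_of (r x) s' i).
  by rewrite /rate_of; case: (s' i) => //; exact: measurableT_comp.
have mp k : forall s', measurable_fun setT (fun x => jump_iter E q (r x) k s').
  elim: k => [|k IH] s'; first exact: mg.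
  apply: measurable_funD; first exact: IH.
  apply: measurable_funM => //; apply: measurable_sum => i.
  by apply: measurable_funM => //; apply: measurable_funB; exact: IH.
apply: measurable_funM => //; apply: measurable_sum => k.
by apply: measurable_sum.
Qed.

Lemma natr_card_ffun (R : realType) n (A : {set {ffun 'I_n -> bool}}) :
  #|A|%:R <= 2 ^+ n :> R.
Proof.
rewrite -natrX ler_nat (leq_trans (max_card _))//.
by rewrite card_ffun card_bool card_ord.
Qed.

Lemma two_le_expR (R : realType) : 2 <= expR 1 :> R.
Proof. by have := @expR_ge1Dx R 1; rewrite -[1 + 1]/(2%:R). Qed.

(** * Almost invariant averages dominate the capacity region *)

Section LowerBound.
Variables (R : realType) (n : nat) (E : rel 'I_n).
Hypotheses (symE : symmetric E) (irrE : irreflexive E).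
Variables (r : 'I_n -> R) (Rmax : R).
Hypothesis r_bound : forall i, 0 <= r i <= Rmax.
Hypothesis n0 : (0 < n)%N.
Variable N : nat.
Hypothesis N0 : (0 < N)%N.
Implicit Types (s : {ffun 'I_n -> bool}).

Local Notation S := (schedules E).
Local Notation W s := (expR (energy r s)).
Local Notation q := (n%:R * expR Rmax).
Local Notation G := (n%:R * Rmax).
Local Notation u := (cesaro E q N r).
Local Notation Z := (\sum_(s in S) W s).

Hypothesis N_large : q / N%:R * (2 ^+ n * expR G) * G ^+ 2 <= 4^-1.

Let empty : {ffun 'I_n -> bool} := [ffun=> false].

Lemma empty_schedule : empty \in S.
Proof. by apply/schedulesP => i j _; rewrite ffunE. Qed.

Lemma expR_energy_ge1 s : 1 <= W s.
Proof. by rewrite -expR0 ler_expR; have /andP[] := energy_bound r_bound s. Qed.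

Lemma partition_bound : 1 <= Z <= 2 ^+ n * expR G.
Proof.
apply/andP; split.
  rewrite (bigD1 empty) ?empty_schedule//=.
  by rewrite ler_wpDr ?expR_energy_ge1// sumr_ge0// => s _; exact: expR_ge0.
apply: (@le_trans _ _ (\sum_(s in S) expR G)).
  by apply: ler_sum => s _; rewrite ler_expR; have /andP[] := energy_bound r_bound s.
rewrite sumr_const -[leLHS]mulr_natl ler_wpM2r ?expR_ge0//.
exact: natr_card_ffun.
Qed.

Lemma cesaro_bound s : 0 <= u s <= G.
Proof.
have N0' : 0 < N%:R :> R by rewrite ltr0n.
rewrite /cesaro mulr_ge0 ?invr_ge0 ?sumr_ge0//=; last first.
  by move=> k _; have /andP[] := jump_iter_bound E r_bound n0 k s.
rewrite mulrC ler_pdivrMr//.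
apply: (@le_trans _ _ (\sum_(0 <= k < N) G)).
  by apply: ler_sum => k _; have /andP[] := jump_iter_bound E r_bound n0 k s.
by rewrite sumr_const_nat subn0 -[leLHS]mulr_natl mulrC.
Qed.

(* [u] is almost invariant, so its Dirichlet form is small; it dominates the
   square of the left-hand side, the weights being at least 1. *)
Lemma cesaro_edge s i : s \in S -> s i -> `|u s - u (ring_at E s i)| <= 2^-1.
Proof.
move=> sS si.
have G0 : 0 <= G by have /andP[h1 h2] := energy_bound r_bound s; exact: le_trans h2.
have q0 : 0 < q by exact: q_gt0.
have N0' : 0 < N%:R :> R by rewrite ltr0n.
have qN : 0 <= q / N%:R by rewrite divr_ge0// ltW.
have h := dirichlet_form symE irrE r u u.
(* Both [u] and the iterates lie in [[0, G]], so [- u * L u] is at most [q / N * G ^+ 2]; the total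
   weight is at most [2 ^+ n * expR G]. By [N_large] this is at most 1/4, the square of the
   variation 1/2 allowed on an edge. *)
have h1 : \sum_(i < n) \sum_(s in S | s i)
      W s * ((u s - u (ring_at E s i)) * (u s - u (ring_at E s i))) <=
    q / N%:R * (2 ^+ n * expR G) * G ^+ 2.
  rewrite -[leLHS]opprK -h -sumrN.
  apply: (@le_trans _ _ (\sum_(s in S) W s * (q / N%:R * G ^+ 2))).
    apply: ler_sum => t _; rewrite -mulrN ler_pM2l ?expR_gt0//.
    rewrite generator_cesaro// mulrCA -mulrN ler_wpM2l//.
    have /andP[u0 uG] := cesaro_bound t.
    have /andP[p0 pG] := jump_iter_bound E r_bound n0 N t.
    have /andP[g0 gG] := energy_bound r_bound t.
    rewrite mulrBr opprB lerBlDr (@le_trans _ _ (G ^+ 2))//.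
      by rewrite expr2 ler_pM.
    by rewrite lerDl mulr_ge0.
  have -> : q / N%:R * (2 ^+ n * expR G) * G ^+ 2 =
    (2 ^+ n * expR G) * (q / N%:R * G ^+ 2) by ring.
  rewrite -mulr_suml; apply: ler_wpM2r; first exact: mulr_ge0 (exprn_ge0 2 G0).
  by have /andP[] := partition_bound.
have h2 : W s * (u s - u (ring_at E s i)) ^+ 2 <= 4^-1.
  apply: le_trans N_large; apply: le_trans h1.
  rewrite (bigD1 i)//= (bigD1 s)/= ?sS// expr2 -addrA lerDl addr_ge0//.
    by apply: sumr_ge0 => t _; rewrite mulr_ge0 ?expR_ge0// -expr2 sqr_ge0.
  apply: sumr_ge0 => k _; apply: sumr_ge0 => t _.
  by rewrite mulr_ge0 ?expR_ge0// -expr2 sqr_ge0.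
have h3 : (u s - u (ring_at E s i)) ^+ 2 <= 4^-1.
  by apply: le_trans h2; rewrite ler_peMl ?sqr_ge0// expR_energy_ge1.
rewrite -(@ler_pXn2r _ 2)// ?nnegrE ?invr_ge0// real_normK ?num_real//.
by rewrite (le_trans h3)// exprVn -natrX.
Qed.

Lemma cesaro_empty s : s \in S -> `|u s - u empty| <= n%:R / 2.
Proof.
suff h k : forall s, s \in S -> #|[set i | s i]%SET| = k -> `|u s - u empty| <= k%:R / 2.
  move=> sS; rewrite (le_trans (h _ _ sS erefl))// ler_pM2r// ler_nat.
  by rewrite -[leqRHS]card_ord max_card.
elim: k => [|k IH] {}s sS.
  move=> /eqP; rewrite cards_eq0 => /eqP s0; have -> : s = empty.
    apply/ffunP => i; rewrite ffunE; apply/negbTE.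
    by have := finset.in_set0 i; rewrite -s0 inE => ->.
  by rewrite subrr normr0 mul0r.
move=> sk; have [i si] : exists i, i \in [set i | s i]%SET.
  by apply/set0Pn; rewrite -card_gt0 sk.
have si' : s i by rewrite inE in si.
have [rS ni _ _] := ring_at_on symE irrE sS si'.
have := IH _ rS; have -> : #|[set i0 | ring_at E s i i0]%SET| = k.
  have -> : [set i0 | ring_at E s i i0]%SET = [set i0 | s i0]%SET :\ i.
    apply/setP => j; rewrite !inE ffunE.
    have [->|//] := eqVneq j i; by rewrite /flip si'.
  by move: sk; rewrite (cardsD1 i) si add1n => -[].
move=> /(_ erefl) h; have h' := cesaro_edge sS si'.
rewrite -(subrK (u (ring_at E s i)) (u s)) -addrA (le_trans (ler_normD _ _))//.
by rewrite -[k.+1%:R]natr1 mulrDl div1r [leRHS]addrC lerD.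
Qed.

(** The Gibbs weights are stationary, so every iterate has the same mean as [energy]. *)
Lemma sum_cesaro : \sum_(s in S) W s * u s = \sum_(s in S) W s * energy r s.
Proof.
have N0' : 0 < N%:R :> R by rewrite ltr0n.
have h k : \sum_(s in S) W s * jump_iter E q r k s = \sum_(s in S) W s * energy r s.
  elim: k => // k <-; rewrite /jump_iter iterS /jump_step.
  under eq_bigr do rewrite mulrDr.
  rewrite big_split/= -[RHS]addr0; congr (_ + _).
  under eq_bigr do rewrite mulrCA.
  by rewrite -mulr_sumr sum_generator// mulr0.
rewrite /cesaro.
under eq_bigr do rewrite mulrCA mulr_sumr.
rewrite -mulr_sumr exchange_big/=.
under eq_bigr do rewrite h.
rewrite sumr_const_nat subn0 -[X in _ * X]mulr_natl mulrA mulVf ?mul1r//.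
by rewrite gt_eqF.
Qed.

(* Gibbs variational principle: Jensen's inequality for [exp], in tangent-line
   form at [n], with the crude entropy bound [ln (2 ^ n) <= n]. *)
Lemma gibbs rho : rho \in S ->
  Z * (energy r rho - n%:R) <= \sum_(s in S) W s * energy r s.
Proof.
move=> rhoS.
have /andP[Z1 _] := partition_bound.
have Z0 : 0 < Z by exact: lt_le_trans Z1.
have hZ : expR (energy r rho) <= Z.
  rewrite (bigD1 rho)//= lerDl; apply: sumr_ge0 => s _; exact: expR_ge0.
rewrite leNgt; apply/negP => hlt.
set w := energy r rho in hlt hZ.
have e2 : 2 ^+ n <= expR n%:R :> R.
  have -> : expR n%:R = expR 1 ^+ n :> R by rewrite -expRM_natl mulr1.
  by rewrite lerXn2r ?nnegrE ?expR_ge0// two_le_expR.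
(* Every term equals [expR w], one of the weights composing [Z], and there are at most [2 ^+ n]
   terms. *)
have h1 : \sum_(s in S) W s * expR (w - energy r s) <= 2 ^+ n * Z.
  under eq_bigr do rewrite -expRD addrC subrK.
  rewrite sumr_const -[leLHS]mulr_natl ler_pM ?expR_ge0//.
  exact: natr_card_ffun.
have h2 : \sum_(s in S) W s * (expR n%:R * (1 + (w - energy r s - n%:R))) <=
    \sum_(s in S) W s * expR (w - energy r s).
  apply: ler_sum => s _; rewrite ler_pM2l ?expR_gt0//.
  rewrite -[X in _ <= expR X](subrK n%:R) expRD mulrC ler_pM2r ?expR_gt0//.
  exact: expR_ge1Dx.
have h3 : \sum_(s in S) W s * (expR n%:R * (1 + (w - energy r s - n%:R))) =
    expR n%:R * (Z * (1 + w - n%:R) - \sum_(s in S) W s * energy r s).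
  rewrite mulr_suml -sumrB mulr_sumr; apply: eq_bigr => s _; ring.
have h4 : expR n%:R * Z < expR n%:R * (Z * (1 + w - n%:R) - \sum_(s in S) W s * energy r s).
  rewrite ltr_pM2l ?expR_gt0// -subr_gt0.
  have -> : Z * (1 + w - n%:R) - \sum_(s in S) W s * energy r s - Z =
     Z * (w - n%:R) - \sum_(s in S) W s * energy r s by ring.
  by rewrite subr_gt0.
have h5 : 2 ^+ n * Z <= expR n%:R * Z by rewrite ler_pM2r.
have := lt_le_trans h4 (le_trans (le_trans (eq_ind _ (fun x => x <= _) h2 _ h3) h1) h5).
by rewrite ltxx.
Qed.

(** The loss [2 * n] is [n] for the entropy, [n / 2] from the Gibbs mean of [u] to [u empty], and
    [n / 2] from there to [u s]. *)
Lemma cesaro_ge_energy s rho : s \in S -> rho \in S ->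
  energy r rho - 2 * n%:R <= u s.
Proof.
move=> sS rhoS.
have /andP[Z1 _] := partition_bound.
have Z0 : 0 < Z by exact: lt_le_trans Z1.
have h1 : \sum_(t in S) W t * u t <= Z * (u empty + n%:R / 2).
  rewrite mulr_suml; apply: ler_sum => t tS; rewrite ler_pM2l ?expR_gt0//.
  rewrite -lerBlDl; apply: le_trans (cesaro_empty tS); exact: ler_norm.
have h2 := gibbs rhoS; rewrite -sum_cesaro in h2.
have := le_trans h2 h1; rewrite ler_pM2l// => h3.
have h4 : u empty - u s <= n%:R / 2.
  by apply: le_trans (cesaro_empty sS); rewrite distrC; exact: ler_norm.
lra.
Qed.

Lemma cesaro_ge_capacity s l : s \in S -> capacity E l ->
  \sum_(i < n) r i * l i - 2 * n%:R <= u s.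
Proof.
move=> sS [l0 [g [w [w0 w1 gE]] lg]].
apply: (@le_trans _ _ (\sum_(rho in S) w rho * (energy r rho - 2 * n%:R))).
  under [leRHS]eq_bigr do rewrite mulrBr.
  rewrite sumrB -mulr_suml w1 mul1r lerD2r.
  under [leRHS]eq_bigr do rewrite mulr_sumr.
  rewrite [leRHS]exchange_big/=; apply: ler_sum => i _.
  have /andP[ri0 _] := r_bound i.
  rewrite (le_trans (ler_wpM2l ri0 (lg i)))// gE mulr_sumr.
  by apply: ler_sum => rho _; rewrite mulrCA.
have -> : u s = \sum_(rho in S) w rho * u s by rewrite -mulr_suml w1 mul1r.
by apply: ler_sum => rho rhoS; rewrite ler_wpM2l// cesaro_ge_energy.
Qed.

End LowerBound.

(** * Sample paths follow the simulation *)

(* The truncation to [0, Rmax], which is inactive along sample paths, makes the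
   simulation bounded for all values of the clocks. *)
Definition rate_update (R : realType) (n : nat) (U : 'I_n -> R -> R)
    (alpha beta T Rmax : R) (i : 'I_n) (x s : R) : R :=
  Num.max 0 (Num.min Rmax
    (Num.max (x - alpha * (T^-1 * s)) 0 + alpha * rate_choice (U i) beta x)).

Section Matching.
Variables (R : realType) (n : nat) (E : rel 'I_n) (U : 'I_n -> R -> R).
Hypothesis irrE : irreflexive E.
Hypothesis utU : forall i, utility (U i).
Variables (alpha beta T : R).
Hypotheses (alpha0 : 0 < alpha) (beta0 : 0 < beta) (T0 : 0 < T).
Variables (xi : 'I_n -> nat -> R) (sigma : R -> {ffun 'I_n -> bool}).
Variables (tau : 'I_n -> nat -> R) (r lam : 'I_n -> nat -> R).
Hypothesis rlP : parameter_path U alpha beta T sigma r lam.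
Hypothesis csmaP : csma_path E (fun i => held T (r i)) xi sigma tau.

Local Notation mu := (@lebesgue_measure R).
Local Notation Rmax := (beta * max_slope U + alpha).
Local Notation upd := (rate_update U alpha beta T Rmax).
Local Notation z := (fun p : 'I_n * nat => xi p.1 p.2).
Local Notation H m := (run E T upd (sigma 0) z m).
Local Notation wait_rate i := (fun t => expR (held T (r i) t)).

Hypothesis no_tie : forall m i, gap z (H m) i <> other_gap z (H m) i.

(** The imposed initial value 1 is also optimal, an increasing utility being maximal at 1 when the
    price is 0. So the arrival rate is a function of the parameter in every slot, and the simulated
    state need not store it. *)
Lemma lamE i j : lam i j = rate_choice (U i) beta (r i j).
Proof.
case: j => [|j].
  rewrite (lam_init rlP) (r_init rlP).
  by apply: (argmax_rate_choice (utU i) beta0); exact: argmax_zero.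
by apply: (argmax_rate_choice (utU i) beta0); exact: lam_update rlP i j.
Qed.

Lemma updE i j (s : R) : T^-1 * s = service T sigma i j -> upd i (r i j) s = r i j.+1.
Proof.
move=> e; rewrite /rate_update e -lamE -(r_update rlP).
have /andP[h1 h2] := r_bounded utU alpha0 beta0 T0 rlP i j.+1.
by rewrite min_r// max_r.
Qed.

Lemma tau_mono i k l : (k <= l)%N -> tau i k <= tau i l.
Proof.
move=> /subnKC <-; elim: (l - k)%N => [|j IH]; first by rewrite addn0.
by rewrite addnS (le_trans IH)// ltW// (csma_increasing csmaP).
Qed.

(** The transmitting times form a countable union of half-open periods. *)
Lemma measurable_transmitting i (s t : R) : 0 <= s ->
  measurable_fun `[s, t] (fun u => (sigma u i)%:R : R).
Proof.
move=> s0.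
pose A : set R := \bigcup_(k in [set k | sigma (tau i k) i]) `[tau i k, tau i k.+1[%classic.
have mA : measurable A by apply: bigcup_measurable.
apply: (@eq_measurable_fun _ _ _ _ _ (\1_A : R -> R)); last first.
  exact: measurable_indic.
move=> u; rewrite inE/= in_itv/= => /andP[su _].
have u0 := le_trans s0 su.
rewrite indicE; congr (nat_of_bool _)%:R.
apply/idP/idP => [|su'].
  rewrite inE => -[k /= sk]; rewrite in_itv/= => uk.
  by rewrite (csma_const csmaP uk).
have [k uk] := csma_cover csmaP i u0.
rewrite inE; exists k; last by rewrite /= in_itv.
by rewrite /= -(csma_const csmaP uk).
Qed.

Lemma integrable_transmitting i (s t : R) : 0 <= s ->
  mu.-integrable `[s, t] (EFin \o (fun u => (sigma u i)%:R : R)).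
Proof.
move=> s0; apply: (@bounded_integrable_itv _ _ _ _ 1).
  exact: measurable_transmitting.
by move=> u _; rewrite ger0_norm// lern1 leq_b1.
Qed.

Lemma integrable_wait i (s t : R) : mu.-integrable `[s, t] (EFin \o wait_rate i).
Proof.
apply: (@bounded_integrable_itv _ _ _ _ (expR Rmax)).
  apply: measurable_funTS; apply: measurableT_comp => //.
  exact: measurable_held.
move=> u _; rewrite ger0_norm ?expR_ge0// ler_expR.
by have /andP[] := r_bounded utU alpha0 beta0 T0 rlP i (Num.truncn (u / T)).
Qed.

Lemma service_le1 i j : service T sigma i j <= 1.
Proof.
rewrite /service mulrC ler_pdivrMr// mul1r.
have e : j.+1%:R * T - j%:R * T = T by rewrite -natr1; ring.
have le : j%:R * T <= j.+1%:R * T by rewrite ler_pM2r// ler_nat.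
rewrite -[leRHS]e -[leRHS]mul1r -(@time_integral_cst _ _ _ 1 (fun=> 1))//.
apply: le_Rintegral => //.
- by apply: integrable_transmitting; rewrite mulr_ge0// ltW.
- by apply: (@bounded_integrable_itv _ _ _ _ 1) => // u _; rewrite normr1.
- by move=> u _; rewrite lern1 leq_b1.
Qed.

Definition elapsed i k (t : R) : R :=
  if sigma (tau i k) i then t - tau i k
  else time_integral (tau i k) t (wait_rate i).

Lemma elapsed_next i k : elapsed i k (tau i k.+1) = xi i k.
Proof.
rewrite /elapsed; case: ifPn => h.
  by have [] := csma_transmit csmaP h.
by have [] := csma_wait csmaP h.
Qed.

Lemma elapsed_start i k : elapsed i k (tau i k) = 0.
Proof.
rewrite /elapsed subrr; case: ifP => // _.
by rewrite /time_integral set_itv1 Rintegral_set1.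
Qed.

(** Parameters are nonnegative, so a waiting clock runs at rate at least 1; strictness separates the
    node that rings from those that ring later. *)
Lemma elapsed_lt i k (s t : R) : tau i k <= s -> s < t -> elapsed i k s < elapsed i k t.
Proof.
move=> ts st; rewrite /elapsed; case: ifP => _; first by rewrite ltrD2r.
rewrite (@time_integral_split _ _ s t) ?(ltW st)//; last exact: integrable_wait.
rewrite ltrDl; apply: (@lt_le_trans _ _ (t - s)); first by rewrite subr_gt0.
rewrite -[leLHS]mul1r -(@time_integral_cst _ _ _ 1 (fun=> 1)) ?(ltW st)//.
apply: le_Rintegral => //.
- by apply: (@bounded_integrable_itv _ _ _ _ 1) => // u _; rewrite normr1.
- exact: integrable_wait.
- move=> u _; rewrite -expR0 ler_expR.
  by have /andP[] := r_bounded utU alpha0 beta0 T0 rlP i (Num.truncn (u / T)).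
Qed.

(** [K] describes the right-continuous path at [time K]. Positivity of [rem] assigns the end of a
    slot to the slot that begins there. *)
Record matches (K : state R n) : Prop := Matches {
  match_time : time K = (slot K)%:R * T + (T - rem K) ;
  match_rem : 0 < rem K <= T ;
  match_sched : sched K = sigma (time K) ;
  match_idx : forall i, tau i (idx K i) <= time K < tau i (idx K i).+1 ;
  match_age : forall i, age K i = elapsed i (idx K i) (time K) ;
  match_par : forall i, par K i = r i (slot K) ;
  match_served : forall i, served K i =
    time_integral ((slot K)%:R * T) (time K) (fun u => (sigma u i)%:R) }.

Lemma matches_init : matches (init T (sigma 0)).
Proof.
split => //=.
- by rewrite mul0r subrr addr0.
- by rewrite T0 lexx.
- move=> i; rewrite (csma_start csmaP) lexx/=.
  by rewrite -{1}(csma_start csmaP i) (csma_increasing csmaP).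
- by move=> i; rewrite -{2}(csma_start csmaP i) elapsed_start.
- by move=> i; rewrite (r_init rlP).
- by move=> i; rewrite mul0r /time_integral set_itv1 Rintegral_set1.
Qed.

Section Step.
Variable K : state R n.
Hypothesis mK : matches K.
Hypothesis no_tieK : forall i, gap z K i <> other_gap z K i.

Let t0 := time K.
(** The next event of the given path, to be identified with the next event of the simulation. *)
Let v := \big[Num.min/t0 + rem K]_(i < n) tau i (idx K i).+1.

Let slot_end : t0 + rem K = (slot K).+1%:R * T.
Proof. by rewrite /t0 (match_time mK) -natr1; ring. Qed.

Let t0_ge : (slot K)%:R * T <= t0.
Proof.
by rewrite /t0 (match_time mK) lerDl subr_ge0; have /andP[] := match_rem mK.
Qed.

Let t0_ge0 : 0 <= t0.
Proof. by apply: le_trans t0_ge; rewrite mulr_ge0// ltW. Qed.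

Let t0v : t0 < v.
Proof.
rewrite /v; elim/big_ind: _ => [|x y x0 y0|i _].
- by rewrite ltrDl; have /andP[] := match_rem mK.
- by rewrite lt_min x0.
- by have /andP[] := match_idx mK i.
Qed.

Let v_end : v <= (slot K).+1%:R * T.
Proof. by rewrite -slot_end; exact: bigmin_le_id. Qed.

Let v_tau i : v <= tau i (idx K i).+1.
Proof. exact: bigmin_le. Qed.

Let tau_start i : sigma (tau i (idx K i)) i = sched K i.
Proof. by rewrite (match_sched mK) (csma_const csmaP (match_idx mK i)). Qed.

Let sigma_const i t : t0 <= t -> t < v -> sigma t i = sched K i.
Proof.
move=> t0t tv; rewrite -tau_start; apply: (csma_const csmaP).
have /andP[h _] := match_idx mK i.
by rewrite (le_trans h)// (lt_le_trans tv).
Qed.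

Let elapsedE i t : t0 <= t -> t <= v ->
  elapsed i (idx K i) t = age K i + rate K i * (t - t0).
Proof.
move=> t0t tv; rewrite (match_age mK) /elapsed /rate tau_start.
have /andP[h _] := match_idx mK i.
case: ifP => _; first by rewrite -/t0; ring.
rewrite (@time_integral_split _ _ t0)//; last exact: integrable_wait.
congr (_ + _); apply: time_integral_cst => // u /andP[t0u ut].
rewrite (@heldE _ _ _ (slot K))// ?(match_par mK)//.
by rewrite (le_trans t0_ge)//= (lt_le_trans ut)// (le_trans tv).
Qed.

(** The simulation extrapolates the current rate, which is correct only up to [v]. What the clock
    still has to accumulate after [v] adds a nonnegative term, zero exactly for the nodes whose
    period ends at [v]. *)
Let gap_raw i : (xi i (idx K i) - age K i) / rate K i =
  (v - t0) + (elapsed i (idx K i) (tau i (idx K i).+1) - elapsed i (idx K i) v) / rate K i.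
Proof.
rewrite elapsed_next (elapsedE i (ltW t0v) (lexx _)).
by field; rewrite gt_eqF// rate_gt0.
Qed.

Let gap_at i : tau i (idx K i).+1 = v -> gap z K i = v - t0.
Proof.
move=> e; rewrite /gap gap_raw e subrr mul0r addr0 max_r// subr_ge0.
exact: ltW.
Qed.

Let gap_after i : v < tau i (idx K i).+1 -> v - t0 < gap z K i.
Proof.
move=> lt; rewrite /gap lt_max; apply/orP; right; rewrite gap_raw ltrDl.
rewrite divr_gt0 ?rate_gt0// subr_gt0 elapsed_lt//.
by have /andP[h _] := match_idx mK i; rewrite (le_trans h)// ltW.
Qed.

Let gap_ge i : v - t0 <= gap z K i.
Proof.
have := v_tau i; rewrite le_eqVlt => /orP[/eqP e|/gap_after/ltW//].
by rewrite (gap_at (esym e)).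
Qed.

Let rem_ge : v - t0 <= rem K.
Proof. by rewrite lerBlDr addrC slot_end. Qed.

Let v_cases : (exists i, tau i (idx K i).+1 = v) \/
  ((forall i, v < tau i (idx K i).+1) /\ v = t0 + rem K).
Proof.
have [[i e]|ne] := pselect (exists i, tau i (idx K i).+1 = v); first by left; exists i.
have lt i : v < tau i (idx K i).+1.
  by rewrite lt_neqAle v_tau andbT; apply/eqP => e; apply: ne; exists i.
right; split=> //; apply/eqP; rewrite eq_le; apply/andP; split.
  exact: bigmin_le_id.
rewrite leNgt; apply/negP => h.
have : v < v by rewrite {2}/v; apply/bigmin_gtP; split.
by rewrite ltxx.
Qed.

Let step_ge : v - t0 <= step_len z K.
Proof.
rewrite /step_len; elim/big_ind: _ => [//|x y x0 y0|i _]; last exact: gap_ge.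
by rewrite le_min x0.
Qed.

Let served_v i : served K i + (sched K i)%:R * (v - t0) =
  time_integral ((slot K)%:R * T) v (fun u => (sigma u i)%:R).
Proof.
rewrite (@time_integral_split _ _ t0)// ?(ltW t0v)//; last first.
  by apply: integrable_transmitting; rewrite mulr_ge0// ltW.
rewrite (match_served mK); congr (_ + _); apply/esym.
apply: time_integral_cst; first exact: ltW.
by move=> u /andP[t0u uv]; rewrite sigma_const.
Qed.

Lemma step_len_v : step_len z K = v - t0.
Proof.
apply/eqP; rewrite eq_le step_ge andbT; have [[i ei]|[lt vE]] := v_cases.
  by rewrite -(gap_at ei); exact: bigmin_le.
by rewrite vE addrAC subrr add0r; exact: step_len_le_rem.
Qed.

Lemma served_step i : served K i + (sched K i)%:R * step_len z K =
  time_integral ((slot K)%:R * T) (time (next E T upd z K)) (fun u => (sigma u i)%:R).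
Proof.
have -> : time (next E T upd z K) = v by rewrite /= step_len_v addrC subrK.
by rewrite step_len_v served_v.
Qed.

Lemma matches_next : matches (next E T upd z K).
Proof.
have sl := step_len_v.
have [[i ei]|[lt vE]] := v_cases.
(* Some period ends at [v]. Absence of ties makes [i] the only such node and puts [v] strictly
   before the end of the slot. *)
- have gi := gap_at ei.
  have ri : rings z K i.
    rewrite /rings lt_neqAle; apply/andP; split; first by apply/eqP.
    by rewrite gi -sl (step_lenE _ _ i) ge_min lexx orbT.
  have go : v - t0 < other_gap z K i by rewrite -gi.
  have lt k : k != i -> v < tau k (idx K k).+1.
    move=> ki; rewrite lt_neqAle v_tau andbT; apply/eqP => /esym/gap_at gk.
    have : other_gap z K i <= gap z K k by exact: bigmin_le_cond.
    by rewrite gk leNgt go.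
  have vr : v - t0 < rem K by apply: lt_le_trans go _; exact: bigmin_le_id.
  have ex : [exists k, rings z K k] by apply/existsP; exists i.
  have rk k : k != i -> rings z K k = false.
    move=> ki; apply/negbTE/negP => rk.
    by move/eqP: ki; apply; exact: rings_inj rk ri.
  have tE : time (next E T upd z K) = v by rewrite /= sl addrC subrK.
  have sv k : k != i -> sigma v k = sched K k.
    move=> ki; rewrite -tau_start; apply: (csma_const csmaP).
    by rewrite (lt k ki) andbT; have /andP[h _] := match_idx mK k; rewrite (le_trans h)// ltW.
  split; rewrite ?tE /= ?ex ?sl.
  + by rewrite -[LHS](subrK t0) {2}/t0 (match_time mK); ring.
  + rewrite subr_gt0 vr/= lerBlDr; have /andP[_ h] := match_rem mK.
    by rewrite (le_trans h)// lerDl subr_ge0 ltW.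
  + apply/ffunP => k; rewrite ffunE.
    have [->|ki] := eqVneq k i; last by rewrite rk// sv.
    rewrite ri /flip; case: (boolP (sched K i)) => si /=.
      by have [_] := csma_transmit csmaP (etrans (tau_start i) si); rewrite ei.
    (* The path consults the neighbours at time [v], the simulation just before. They agree, since
       no other node changes at [v] and [i] is not its own neighbour. *)
    have := csma_wait csmaP (eq_ind_r (fun b => ~~ b) si (tau_start i)).
    rewrite ei => -[_ ->]; apply: eq_forallb => l.
    have [->|li] := eqVneq l i; first by rewrite irrE.
    by rewrite sv.
  + move=> k; have [->|ki] := eqVneq k i.
      by rewrite ri addn1 ei lexx/= -ei; exact: (csma_increasing csmaP).
    rewrite rk// addn0 lt// andbT.
    by have /andP[h _] := match_idx mK k; rewrite (le_trans h)// ltW.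
  + move=> k; have [->|ki] := eqVneq k i.
      by rewrite ri addn1 -ei elapsed_start.
    by rewrite rk// addn0 elapsedE// ltW.
  + exact: match_par.
  + by move=> k; rewrite served_v.
- have rv : v - t0 = rem K by rewrite vE addrAC subrr add0r.
  have rk k : rings z K k = false.
    apply/negbTE/negP; rewrite /rings => h.
    have := lt_le_trans h (bigmin_le_id _ _ _ _).
    by rewrite -rv ltNge (ltW (gap_after (lt k))).
  have ex : [exists k, rings z K k] = false.
    by apply/negbTE/existsPn => k; rewrite rk.
  have tE : time (next E T upd z K) = v by rewrite /= sl addrC subrK.
  have vE' : v = (slot K).+1%:R * T by rewrite vE slot_end.
  split; rewrite ?tE /= ?ex ?sl.
  + by rewrite subrr addr0.
  + by rewrite T0 lexx.
  + apply/ffunP => k; rewrite ffunE rk -tau_start.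
    apply/esym; apply: (csma_const csmaP).
    by rewrite lt andbT; have /andP[h _] := match_idx mK k; rewrite (le_trans h)// ltW.
  + move=> k; rewrite rk addn0 lt andbT.
    by have /andP[h _] := match_idx mK k; rewrite (le_trans h)// ltW.
  + by move=> k; rewrite rk addn0 elapsedE// ltW.
  + move=> k; rewrite served_v (match_par mK) (@updE _ (slot K))//.
    by rewrite vE'.
  + by move=> k; rewrite vE' /time_integral set_itv1 Rintegral_set1.
Qed.

End Step.

Lemma matches_run m : matches (H m).
Proof.
elim: m => [|m IH]; first exact: matches_init.
by apply: matches_next => // i; exact: no_tie.
Qed.

(** Every event is either one ring or the end of a slot. *)
Lemma sum_idx_run m : (m = \sum_(i < n) idx (H m) i + slot (H m))%N.
Proof.
elim: m => [|m IH]; first by rewrite /= big1.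
rewrite /run iterS -/(run _ _ _ _ _ _) /= big_split/=.
case: ifPn => [/existsP[i ri]|/existsPn nr].
  rewrite [X in (_ + X + _)%N](bigD1 i)//= ri [X in (_ + (_ + X) + _)%N]big1 /=.
    by rewrite addn0 addn1 addSn -IH.
  move=> k ki; apply/eqP; rewrite eqb0; apply/negP => rk.
  by move/eqP: ki; apply; exact: rings_inj rk ri.
rewrite [X in (_ + X + _)%N]big1; first by rewrite addn0 addnS -IH.
by move=> k _; rewrite (negbTE (nr k)).
Qed.

(** Were the simulation confined to slots before [J], its time would stay below [J * T], where each
    node completes finitely many periods, contradicting the count of events. Slots advance one at a
    time, so [J] is entered at an actual slot start. *)
Lemma slot_reached J : exists2 m, slot (H m) = J & rem (H m) = T.
Proof.
have [m Jm] : exists m, (J <= slot (H m))%N.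
  apply: contrapT => hJ.
  have lt m : (slot (H m) < J)%N by rewrite ltnNge; apply/negP => h; apply: hJ; exists m.
  have t0 : 0 <= J%:R * T by rewrite mulr_ge0// ltW.
  have ex i : exists k, J%:R * T < tau i k.+1.
    by have [k /andP[_ h]] := csma_cover csmaP i t0; exists k.
  pose b i := projT1 (cid (ex i)).
  have hb i : J%:R * T < tau i (b i).+1 := projT2 (cid (ex i)).
  pose m := (\sum_(i < n) b i + J)%N.
  have mm := matches_run m.
  have tm : time (H m) <= J%:R * T.
    rewrite (match_time mm); apply: (@le_trans _ _ ((slot (H m)).+1%:R * T)).
      rewrite -natr1 mulrDl mul1r lerD2l gerBl.
      by have /andP[/ltW] := match_rem mm.
    by rewrite ler_pM2r// ler_nat lt.
  have ib i : (idx (H m) i <= b i)%N.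
    rewrite leqNgt; apply/negP => h.
    have /andP[h1 _] := match_idx mm i.
    have := lt_le_trans (hb i) (tau_mono i h).
    by rewrite ltNge (le_trans h1).
  have sb : (\sum_(i < n) idx (H m) i <= \sum_(i < n) b i)%N by exact: leq_sum.
  have : (m < m)%N.
    by rewrite {1}(sum_idx_run m) {2}/m -addnS leq_add// lt.
  by rewrite ltnn.
elim: m Jm => [|m IH] Jm.
  by exists 0%N => //=; move: Jm; rewrite /= leqn0 => /eqP.
have [/IH//|h] := leqP J (slot (H m)).
have := Jm; rewrite /run iterS -/(run _ _ _ _ _ _) /=.
case: ifPn => [_|e J1]; first by rewrite leqNgt h.
exists m.+1; rewrite /run iterS -/(run _ _ _ _ _ _) /= (negbTE e)//.
by apply/eqP; rewrite eqn_leq h J1.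
Qed.

End Matching.

(** * The utility bound *)

Definition potential_jump (R : realType) (n : nat) (E : rel 'I_n) (q : R) (N : nat)
    (i : 'I_n) (K : state R n) : R :=
  potential E q N (par K) (ring_at E (sched K) i) - potential E q N (par K) (sched K).

Lemma capacity_itv (R : realType) n (E : rel 'I_n) (l : 'I_n -> R) i :
  capacity E l -> 0 <= l i <= 1.
Proof.
move=> [l0 [g [w [w0 w1 gE]] lg]]; rewrite l0/= (le_trans (lg i))// gE -[leRHS]w1.
by apply: ler_sum => rho _; case: (rho i); rewrite ?mulr1// mulr0.
Qed.

Section UtilityBound.
Variables (R : realType) (n : nat) (E : rel 'I_n) (U : 'I_n -> R -> R).
Hypotheses (symE : symmetric E) (irrE : irreflexive E) (n0 : (0 < n)%N).
Hypothesis utU : forall i, utility (U i).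
Variables (alpha beta T eps : R).
Hypotheses (alpha0 : 0 < alpha) (alpha1 : alpha < 1) (beta0 : 0 < beta) (T0 : 0 < T).
Hypothesis beta_eps : beta * eps = 4 * n%:R.
Variables (xi : 'I_n -> nat -> R) (sigma : R -> {ffun 'I_n -> bool}).
Variables (tau : 'I_n -> nat -> R) (r lam : 'I_n -> nat -> R).
Hypothesis rlP : parameter_path U alpha beta T sigma r lam.
Hypothesis csmaP : csma_path E (fun i => held T (r i)) xi sigma tau.

Local Notation Rmax := (beta * max_slope U + alpha).
Local Notation upd := (rate_update U alpha beta T Rmax).
Local Notation z := (fun p : 'I_n * nat => xi p.1 p.2).
Local Notation H m := (run E T upd (sigma 0) z m).
Local Notation q := (n%:R * expR Rmax).
Local Notation S := (schedules E).

Hypothesis no_tie : forall m i, gap z (H m) i <> other_gap z (H m) i.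

Variable N : nat.
Hypothesis N0 : (0 < N)%N.
Hypothesis N_large :
  q / N%:R * (2 ^+ n * expR (n%:R * Rmax)) * (n%:R * Rmax) ^+ 2 <= 4^-1.
Local Notation B := (N%:R * (n%:R * Rmax) / q).
Hypothesis B_small : 8 * B <= n%:R * T.

Local Notation jump := (potential_jump E q N).
Hypothesis lln_jump : forall e, 0 < e -> exists m0, forall m, (m0 <= m)%N ->
  `|martingale jump (fun k => H k) m| <= e * m%:R.
Hypothesis lln_count : forall e, 0 < e -> exists m0, forall m, (m0 <= m)%N ->
  `|martingale (fun _ _ => 1) (fun k => H k) m| <= e * m%:R.

Variable l : 'I_n -> R.
Hypothesis capl : capacity E l.

Local Arguments run : simpl never.

Let mH m : matches T sigma tau r (H m).
Proof. exact: (matches_run irrE utU alpha0 beta0 T0 rlP csmaP no_tie). Qed.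

Let parH m i : 0 <= par (H m) i <= Rmax.
Proof. by rewrite (match_par (mH m)); exact: (r_bounded utU alpha0 beta0 T0 rlP). Qed.

Let schedH m : sched (H m) \in S.
Proof.
rewrite (match_sched (mH m)); apply: (csma_feasible csmaP).
rewrite (match_time (mH m)) addr_ge0 ?mulr_ge0 ?(ltW T0)// subr_ge0.
by have /andP[] := match_rem (mH m).
Qed.

Let runS m : H m.+1 = next E T upd z (H m).
Proof. by rewrite /run iterS. Qed.

Let dt m := step_len z (H m).

Let dt_ge0 m : 0 <= dt m.
Proof. by apply: step_len_ge0; have /andP[/ltW] := match_rem (mH m). Qed.

Let timeS m : time (H m.+1) = time (H m) + dt m.
Proof. by rewrite runS. Qed.

Let compE m i : compensated i (H m) (H m.+1) =
  (rings z (H m) i)%:R - rate (H m) i * dt m.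
Proof. by rewrite /compensated runS /= natrD /dt; ring. Qed.

(** Dynkin's formula for one event: at most one node rings, so the ring part is the actual change of
    the potential, while the compensator is the duration times its generator. *)
Lemma jump_increment m :
  \sum_(i < n) jump i (H m) * compensated i (H m) (H m.+1) =
  potential E q N (par (H m)) (sched (H m.+1)) -
  potential E q N (par (H m)) (sched (H m)) -
  dt m * (energy (par (H m)) (sched (H m)) - cesaro E q N (par (H m)) (sched (H m))).
Proof.
under eq_bigr do rewrite compE mulrBr.
rewrite sumrB; congr (_ - _); last first.
  rewrite -(generator_potential E (par (H m)) Rmax n0 (sched (H m)) N0) /generator mulr_sumr.
  apply: eq_bigr => i _; rewrite /potential_jump.
  rewrite -[rate_of _ _ _]/(rate (H m) i); ring.
have [[i ri]|nr] := pselect (exists i, rings z (H m) i); last first.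
  have nr' i : rings z (H m) i = false by apply/negbTE/negP => ri; apply: nr; exists i.
  rewrite big1; last by move=> i _; rewrite nr' mulr0.
  rewrite (_ : sched (H m.+1) = sched (H m)) ?subrr//.
  by rewrite runS; apply/ffunP => i; rewrite ffunE nr'.
rewrite (bigD1 i)//= ri mulr1 big1 ?addr0; last first.
  move=> k ki; rewrite (_ : rings _ _ _ = false) ?mulr0//.
  by apply/negbTE/negP => rk; move/eqP: ki; apply; exact: rings_inj rk ri.
rewrite /jump /potential_jump; congr (potential _ _ _ _ _ - _).
apply/ffunP => k; rewrite !ffunE.
have [->|ki] := eqVneq k i; first by rewrite ri.
rewrite (_ : rings _ _ _ = false)//.
by apply/negbTE/negP => rk; move/eqP: ki; apply; exact: rings_inj rk ri.
Qed.

Let slot_cases m : (slot (H m.+1) = slot (H m) /\ par (H m.+1) = par (H m)) \/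
  slot (H m.+1) = (slot (H m)).+1.
Proof. by rewrite runS /=; case: ifPn => _; [left|right]. Qed.

Let gain m := \sum_(0 <= k < m) dt k * (energy (par (H k)) (sched (H k)) -
  \sum_(i < n) par (H k) i * l i).

Let gainS m : gain m.+1 = gain m + dt m * (energy (par (H m)) (sched (H m)) -
  \sum_(i < n) par (H m) i * l i).
Proof. by rewrite /gain big_nat_recr. Qed.

Let martingaleS h m : martingale h (fun k => H k) m.+1 =
  martingale h (fun k => H k) m +
  \sum_(i < n) h i (H m) * compensated i (H m) (H m.+1).
Proof. by rewrite /martingale big_nat_recr. Qed.

(** Within a slot the potential telescopes; a change of parameters costs at most [2 * B]. The extra
    unit in [(slot (H m)).+1] pays for the potentials at the two ends, which the induction has to
    keep. *)
Lemma gain_lower m : - (2 * n%:R) * time (H m) - 2 * B * (slot (H m)).+1%:R -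
  martingale jump (fun k => H k) m <= gain m.
Proof.
have pb k s : `|potential E q N (par (H k)) s| <= B.
  by apply: potential_bound.
suff h : - (2 * n%:R) * time (H m) - 2 * B * (slot (H m))%:R +
    potential E q N (par (H m)) (sched (H m)) -
    potential E q N (par (H 0%N)) (sched (H 0%N)) -
    martingale jump (fun k => H k) m <= gain m.
  apply: le_trans h; rewrite -natr1.
  have := pb m (sched (H m)); have := pb 0%N (sched (H 0%N)).
  rewrite !ler_norml => /andP[_ h1] /andP[h2 _]; lra.
elim: m => [|m IH].
  by rewrite /gain /martingale !big_nil /run/= mulr0 mulr0; lra.
rewrite gainS martingaleS jump_increment timeS.
have hu : \sum_(i < n) par (H m) i * l i - 2 * n%:R <=
    cesaro E q N (par (H m)) (sched (H m)).
  exact: (cesaro_ge_capacity symE irrE (parH m) n0 N0 N_large (schedH m) capl).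
have hd := ler_wpM2l (dt_ge0 m) hu.
have hp : potential E q N (par (H m.+1)) (sched (H m.+1)) <=
    potential E q N (par (H m)) (sched (H m.+1)) +
    2 * B * ((slot (H m.+1))%:R - (slot (H m))%:R).
  have [[-> ->]|->] := slot_cases m.
    by rewrite subrr mulr0 addr0.
  have := pb m (sched (H m.+1)); have := pb m.+1 (sched (H m.+1)).
  rewrite !ler_norml => /andP[_ h1] /andP[h2 _].
  rewrite -[(slot (H m)).+1%:R]natr1; lra.
move: hd hp IH; rewrite mulrBr.
lra.
Qed.

Let X j := \sum_(i < n) r i j * (service T sigma i j - l i).

(** Regrouping by slots. The second sum is the contribution of the unfinished slot and vanishes when
    a slot starts. *)
Lemma gainE m : gain m = T * (\sum_(0 <= j < slot (H m)) X j) +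
  \sum_(i < n) r i (slot (H m)) *
    (served (H m) i - (time (H m) - (slot (H m))%:R * T) * l i).
Proof.
elim: m => [|m IH].
  rewrite /gain !big_nil mulr0 add0r big1// => i _.
  by rewrite /run/= mul0r subr0 mul0r subr0 mulr0.
have step i := served_step utU alpha0 beta0 T0 rlP csmaP (mH m) i.
rewrite gainS IH; set G := (X in _ = X).
have -> : dt m * (energy (par (H m)) (sched (H m)) - \sum_(i < n) par (H m) i * l i) =
    \sum_(i < n) r i (slot (H m)) * ((sched (H m) i)%:R * dt m - dt m * l i).
  rewrite /energy -sumrB mulr_sumr; apply: eq_bigr => i _.
  rewrite (match_par (mH m)); ring.
rewrite -addrA -big_split/=.
have -> : \sum_(i < n) (r i (slot (H m)) *
      (served (H m) i - (time (H m) - (slot (H m))%:R * T) * l i) +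
      r i (slot (H m)) * ((sched (H m) i)%:R * dt m - dt m * l i)) =
    \sum_(i < n) r i (slot (H m)) * (served (H m) i + (sched (H m) i)%:R * dt m -
      (time (H m.+1) - (slot (H m))%:R * T) * l i).
  by apply: eq_bigr => i _; rewrite timeS; ring.
have tm := match_time (mH m.+1).
rewrite {}/G.
have [ev|nev] := orP (orbN [exists i, rings z (H m) i]).
  have -> : slot (H m.+1) = slot (H m) by rewrite runS /= ev.
  by congr (_ + _); apply: eq_bigr => i _; rewrite [in RHS]runS /= ev.
have sl : slot (H m.+1) = (slot (H m)).+1 by rewrite runS /= (negbTE nev).
have rm : rem (H m.+1) = T by rewrite runS /= (negbTE nev).
have sv i : served (H m.+1) i = 0 by rewrite runS /= (negbTE nev).
rewrite sl rm subrr addr0 in tm.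
rewrite sl.
have -> : \sum_(0 <= j < (slot (H m)).+1) X j =
    \sum_(0 <= j < slot (H m)) X j + X (slot (H m)) by rewrite big_nat_recr.
rewrite mulrDr -[RHS]addrA; congr (_ + _).
rewrite [X in _ = _ + X]big1 ?addr0; last first.
  by move=> i _; rewrite sv tm subrr mul0r subr0 mulr0.
rewrite mulr_sumr; apply: eq_bigr => i _.
rewrite step -runS tm mulrCA; congr (_ * _).
rewrite /service mulrBr mulrA divff ?gt_eqF// mul1r -[(slot (H m)).+1%:R]natr1.
ring.
Qed.

(** With coefficient 1, [martingale] is the number of rings minus the accumulated rate, and the
    total rate is at most [q]. *)
Lemma event_count m : m%:R <= (slot (H m))%:R + q * time (H m) +
  martingale (fun _ _ => 1) (fun k => H k) m.
Proof.
suff h : (\sum_(i < n) idx (H m) i)%:R - q * time (H m) <=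
    martingale (fun _ _ => 1) (fun k => H k) m.
  have e : m%:R = (\sum_(i < n) idx (H m) i)%:R + (slot (H m))%:R :> R.
    by rewrite {1}(sum_idx_run E U alpha beta T xi sigma m) natrD.
  lra.
elim: m => [|m IH].
  by rewrite /run/= big1// mulr0 subr0 /martingale big_nil.
rewrite martingaleS timeS mulrDr.
have -> : \sum_(i < n) 1 * compensated i (H m) (H m.+1) =
    (\sum_(i < n) idx (H m.+1) i)%:R - (\sum_(i < n) idx (H m) i)%:R -
    (\sum_(i < n) rate (H m) i) * dt m.
  rewrite !natr_sum -sumrB mulr_suml -sumrB; apply: eq_bigr => i _.
  by rewrite mul1r /compensated timeS; ring.
have hr : (\sum_(i < n) rate (H m) i) * dt m <= q * dt m.
  rewrite ler_wpM2r//; apply: (@le_trans _ _ (\sum_(i < n) expR Rmax)); last first.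
    by rewrite sumr_const card_ord mulr_natl.
  by apply: ler_sum => i _; have /andP[] := rate_of_bound (parH m) (sched (H m)) i.
lra.
Qed.

Lemma drift J : - (n%:R * alpha * J%:R) <=
  \sum_(0 <= j < J) \sum_(i < n) r i j * (lam i j - service T sigma i j).
Proof.
rewrite exchange_big/=.
have -> : - (n%:R * alpha * J%:R) = \sum_(i < n) - (alpha * J%:R).
  by rewrite sumr_const card_ord -[RHS]mulr_natl; ring.
apply: ler_sum => i _.
suff h : r i J ^+ 2 <= 2 * alpha * (\sum_(0 <= j < J) r i j * (lam i j - service T sigma i j)) +
    2 * alpha ^+ 2 * J%:R.
  have := le_trans (sqr_ge0 _) h.
  have -> : 2 * alpha * (\sum_(0 <= j < J) r i j * (lam i j - service T sigma i j)) +
    2 * alpha ^+ 2 * J%:R = 2 * alpha * (alpha * J%:R +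
    \sum_(0 <= j < J) r i j * (lam i j - service T sigma i j)) by ring.
  rewrite pmulr_rge0; first by lra.
  by rewrite mulr_gt0.
elim: J => [|J IH]; first by rewrite (r_init rlP) big_nil !mulr0 expr0n/= addr0.
rewrite big_nat_recr//= (r_update rlP).
have /andP[r0 _] := r_bounded utU alpha0 beta0 T0 rlP i J.
have /andP[l0 l1] := lam_itv rlP i J.
have s0 := service_ge0 T0 sigma i J.
have s1 := service_le1 T0 csmaP i J.
set s := service T sigma i J in s0 s1 *; set x := r i J in r0 IH *; set y := lam i J in l0 l1 *.
set Sg := \sum_(0 <= j < J) _ in IH *.
(* Service and arrivals lie in [[0, 1]], so each contributes at most [alpha ^+ 2] in second
   order. *)
have h1 : (Num.max (x - alpha * s) 0 + alpha * y) ^+ 2 <=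
    x ^+ 2 + 2 * alpha * (x * (y - s)) + 2 * alpha ^+ 2.
  have as0 : 0 <= alpha * s by rewrite mulr_ge0// ltW.
  have ay0 : 0 <= alpha * y by rewrite mulr_ge0// ltW.
  have aa : 0 <= alpha ^+ 2 by rewrite exprn_ge0// ltW.
  have ss : alpha ^+ 2 * s ^+ 2 <= alpha ^+ 2 by rewrite ler_piMr// exprn_ile1.
  have yy : alpha ^+ 2 * y ^+ 2 <= alpha ^+ 2 by rewrite ler_piMr// exprn_ile1.
  have sy : 0 <= alpha ^+ 2 * (s * y) by rewrite mulr_ge0// mulr_ge0.
  have sq : 0 <= (x - alpha * s) ^+ 2 by exact: sqr_ge0.
  have xy : 0 <= x * (alpha * y) by exact: mulr_ge0.
  have [h|h] := leP (x - alpha * s) 0; first by rewrite add0r; lra.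
  lra.
apply: (le_trans h1).
have -> : 2 * alpha ^+ 2 * J.+1%:R = 2 * alpha ^+ 2 * J%:R + 2 * alpha ^+ 2 by rewrite -natr1; ring.
lra.
Qed.

(** Optimality of [lam] against [l] in each slot bounds the utility gap by the [drift] term and [X].
    The budget [beta * eps = 4 * n] covers [11 / 4 * n] here and [n * alpha <= n] for the drift. *)
Lemma utility_lower J : (0 < J)%N ->
  - (11 / 4 * n%:R * J%:R) <= \sum_(0 <= j < J) X j ->
  \sum_(i < n) U i (l i) - eps <= \sum_(i < n) U i (average (lam i) J).
Proof.
move=> J0 hX; have J0' : 0 < J%:R :> R by rewrite ltr0n.
have n0' : 0 < n%:R :> R by rewrite ltr0n.
have hav : \sum_(i < n) average (U i \o lam i) J <= \sum_(i < n) U i (average (lam i) J).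
  by apply: ler_sum => i _; apply: (average_utility (utU i) J0) => j; exact: lam_itv rlP i j.
apply: le_trans hav.
rewrite -[leRHS](mulr1) -(divff (lt0r_neq0 (mulr_gt0 beta0 J0'))) mulrA ler_pdivlMr ?mulr_gt0//.
rewrite mulr_suml.
have -> : \sum_(i < n) average (U i \o lam i) J * (beta * J%:R) =
    \sum_(0 <= j < J) \sum_(i < n) beta * U i (lam i j).
  rewrite exchange_big/=; apply: eq_bigr => i _.
  rewrite -mulr_sumr /average; move: (\sum_(0 <= j < J) _) => A.
  by field; rewrite gt_eqF.
have hj j : \sum_(i < n) beta * U i (lam i j) >= beta * (\sum_(i < n) U i (l i)) +
    (\sum_(i < n) r i j * (lam i j - service T sigma i j) + X j).
  rewrite mulr_sumr /X -!big_split/=; apply: ler_sum => i _.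
  have li : l i \in `[0, 1] by rewrite in_itv; exact: capacity_itv capl.
  have [_ /(_ (l i) li)] : argmax01 (fun y => beta * U i y - r i j * y) (lam i j).
    case: j => [|j]; last exact: lam_update rlP i j.
    by rewrite (lam_init rlP) (r_init rlP); exact: argmax_zero.
  lra.
apply: (@le_trans _ _ (\sum_(0 <= j < J) (beta * (\sum_(i < n) U i (l i)) +
    (\sum_(i < n) r i j * (lam i j - service T sigma i j) + X j)))); last first.
  by apply: ler_sum => j _; exact: hj.
rewrite big_split/= big_split/= sumr_const_nat subn0 -[X in _ <= X + _]mulr_natr.
have hd := drift J.
have ha : n%:R * alpha * J%:R <= n%:R * J%:R.
  by rewrite ler_pM2r// ler_piMr// ltW.
have hb : eps * (beta * J%:R) = 4 * n%:R * J%:R by rewrite mulrA [eps * _]mulrC beta_eps.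
have nJ : 0 <= n%:R * J%:R :> R by rewrite mulr_ge0.
rewrite mulrBl hb.
have -> : (\sum_(i < n) U i (l i)) * (beta * J%:R) = beta * (\sum_(i < n) U i (l i)) * J%:R by ring.
lra.
Qed.

Lemma average_utility_eventually : exists J0, forall J, (J0 <= J)%N ->
  \sum_(i < n) U i (l i) - eps <= \sum_(i < n) U i (average (lam i) J).
Proof.
have n0' : 0 < n%:R :> R by rewrite ltr0n.
have q0 : 0 < q by exact: q_gt0.
pose c : R := 1 + q * T.
have c0 : 0 < c by rewrite addr_gt0// mulr_gt0.
have half0 : 0 < 2^-1 :> R by rewrite invr_gt0.
have [m1 hm1] := lln_count half0.
(* The count with error [m / 2] gives [m <= 2 * c * J], so this tolerance limits the martingale to
   [n * T * J / 8]. *)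
have e0 : 0 < n%:R * T / (16 * c) by rewrite divr_gt0 ?mulr_gt0.
have [m2 hm2] := lln_jump e0.
exists (maxn 1 (maxn m1 m2)) => J; rewrite !geq_max => /and3P[J0 Jm1 Jm2].
have J0' : 0 < J%:R :> R by rewrite ltr0n.
apply: utility_lower => //.
have [m sm rm] := slot_reached irrE utU alpha0 beta0 T0 rlP csmaP no_tie J.
have Jm : (J <= m)%N.
  by rewrite (sum_idx_run E U alpha beta T xi sigma m) sm leq_addl.
have tm : time (H m) = J%:R * T by rewrite (match_time (mH m)) rm sm subrr addr0.
have := hm1 m (leq_trans Jm1 Jm); rewrite ler_norml => /andP[_ h1].
have := hm2 m (leq_trans Jm2 Jm); rewrite ler_norml => /andP[_ h2].
have := event_count m; rewrite sm tm => h3.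
have h4 : m%:R <= 2 * (J%:R * c).
  have : J%:R * c = J%:R + q * (J%:R * T) by rewrite /c; ring.
  lra.
have h5 : n%:R * T / (16 * c) * m%:R <= n%:R * T * J%:R / 8.
  have := ler_wpM2l (ltW e0) h4.
  have -> : n%:R * T / (16 * c) * (2 * (J%:R * c)) = n%:R * T * J%:R / 8.
    by field; rewrite gt_eqF.
  by [].
have := gain_lower m; rewrite gainE sm tm.
rewrite [X in _ <= _ + X]big1 ?addr0; last first.
  move=> i _; rewrite (match_served (mH m)) sm tm subrr mul0r subr0.
  by rewrite /time_integral set_itv1 Rintegral_set1 mulr0.
move=> h6.
have J1 : 1 <= J%:R :> R by rewrite ler1n.
have B0 : 0 <= B.
  by apply: le_trans (normr_ge0 _) (potential_bound E (parH 0%N) n0 (sched (H 0%N)) N0).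
(* The jumps between slots cost at most [4 * B * J]. Per unit of [n * T * J] the total loss is 2 +
   1/2 + 1/8, below 11/4. *)
have h7 : 2 * B * J.+1%:R <= n%:R * T * J%:R / 2.
  have e1 : J.+1%:R <= 2 * J%:R :> R by rewrite -natr1; lra.
  have h8 := ler_wpM2l (mulr_ge0 (ler0n R 2) B0) e1.
  have h9 := ler_wpM2r (ltW J0') B_small.
  lra.
rewrite -(ler_pM2l T0).
have nTJ : 0 <= n%:R * T * J%:R by rewrite !mulr_ge0// ltW.
lra.
Qed.

End UtilityBound.

(** * Choice of the constants and conclusion *)

Lemma le_limn_einf (R : realType) (u : nat -> R) (c : R) J0 :
  (forall J, (J0 <= J)%N -> c <= u J) ->
  (c%:E <= limn_einf (fun J => (u J)%:E))%E.
Proof.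
move=> cu; rewrite limn_einf_lim; apply: lime_ge; first exact: is_cvg_einfs.
exists J0 => // J /= J0J; apply: le_ereal_inf_tmp => _ [k /= Jk <-].
by rewrite lee_fin cu// (leq_trans J0J).
Qed.

(** Summing over the finitely many initial schedules removes them from the independence
    hypothesis. *)
Lemma clocks_independent (R : realType) n d (Omega : measurableType d)
    (P : probability Omega R) (xi : 'I_n -> nat -> {RV P >-> R})
    (sigma0 : Omega -> {ffun 'I_n -> bool}) :
  (forall rho, measurable [set w | sigma0 w = rho]) -> clocks xi sigma0 ->
  forall (s : seq ('I_n * nat)) (B : 'I_n * nat -> set R),
  uniq s -> (forall p, measurable (B p)) ->
  P (\bigcap_(p in [set` s]) (xi p.1 p.2 @^-1` B p)) =
  (\prod_(p <- s) P (xi p.1 p.2 @^-1` B p))%E.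
Proof.
move=> ms [_ ind] s B us mB.
have fs : finite_set [set: {ffun 'I_n -> bool}] by exact: finite_finset.
have split_P (A : set Omega) : measurable A ->
    P A = (\sum_(rho \in [set: {ffun 'I_n -> bool}])
      P ([set w | sigma0 w = rho] `&` A))%E.
  move=> mA; rewrite -measure_fin_bigcup//; last 2 first.
  - by move=> rho rho' _ _ [w [[/= <- _] [<- _]]].
  - by move=> rho _; exact: measurableI.
  by congr (P _); apply/seteqP; split=> [w Aw|w [rho _ []//]]; exists (sigma0 w).
have mI : measurable (\bigcap_(p in [set` s]) (xi p.1 p.2 @^-1` B p)).
  apply: fin_bigcap_measurable => [|p _]; first exact: finite_seq.
  by rewrite -[X in measurable X]setTI; exact: measurable_funP.
rewrite split_P//.
under eq_fsbigr do rewrite ind//.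
rewrite -ge0_mule_fsuml//.
have := split_P setT measurableT; under eq_fsbigr do rewrite setIT.
by move=> <-; rewrite probability_setT mul1e.
Qed.

Lemma measurable_rate_update (R : realType) n (U : 'I_n -> R -> R) alpha beta T Rmax i :
  measurable_fun setT (fun y : R * R => rate_update U alpha beta T Rmax i y.1 y.2).
Proof.
apply: measurable_maxr => //; apply: measurable_minr => //.
apply: measurable_funD.
  apply: measurable_maxr => //; apply: measurable_funB => //.
  by apply: measurable_funM => //; exact: measurable_funM.
apply: measurable_funM => //.
by apply: (measurableT_comp (measurable_rate_choice _ _)).
Qed.

Lemma rate_update_bound (R : realType) n (U : 'I_n -> R -> R) alpha beta T Rmax i x s :
  0 <= Rmax -> 0 <= rate_update U alpha beta T Rmax i x s <= Rmax.
Proof.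
by move=> R0; rewrite /rate_update le_max lexx/= ge_max R0 ge_min lexx.
Qed.

Lemma iteration_number (R : realType) (n : nat) (v alpha : R) :
  (0 < n)%N -> 0 < alpha < 1 -> 4 <= v ->
  let q := n%:R * expR (v + alpha) in
  exists N : nat, [/\ (0 < N)%N,
  q / N%:R * (2 ^+ n * expR (n%:R * (v + alpha))) * (n%:R * (v + alpha)) ^+ 2 <= 4^-1 &
  8 * (N%:R * (n%:R * (v + alpha)) / q) <=
    n%:R * (expR (9 * (v * n%:R)) * ((v + alpha) * n%:R / 4))].
Proof.
move=> n0 /andP[a0 a1] v4 q.
have n1 : 1 <= n%:R :> R by rewrite ler1n.
set G := n%:R * (v + alpha); set x := v * n%:R.
have x4 : 4 <= x by rewrite -[leLHS]mulr1 ler_pM.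
have R0 : 0 <= v + alpha by lra.
have G0 : 0 <= G by exact: mulr_ge0.
have Gx : G <= 2 * x.
  rewrite /G /x mulrDr.
  have : n%:R * alpha <= n%:R * v by rewrite ler_pM2l ?ltr0n//; lra.
  lra.
have q1 : 1 <= q.
  rewrite -[leLHS]mulr1 ler_pM// -expR0 ler_expR; lra.
have q0 : 0 < q by lra.
(* The threshold for [N] in the first inequality; the next integer above it keeps the second one
   affordable. *)
pose y := 4 * q * (2 ^+ n * expR G) * G ^+ 2.
have y0 : 0 <= y by rewrite /y !mulr_ge0 ?expR_ge0 ?exprn_ge0//; lra.
exists (Num.truncn y).+1; split=> //.
  have N0 : 0 < (Num.truncn y).+1%:R :> R by [].
  have yN : y <= (Num.truncn y).+1%:R by rewrite ltW// truncnS_gt.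
  have -> : q / (Num.truncn y).+1%:R * (2 ^+ n * expR G) * G ^+ 2 =
    4^-1 * (y / (Num.truncn y).+1%:R).
    rewrite /y; move: ((Num.truncn y).+1%:R) N0 => N N0.
    by field; rewrite gt_eqF.
  by rewrite ler_piMr ?invr_ge0// ler_pdivrMr// mul1r.
have Ny : (Num.truncn y).+1%:R <= y + 1 by rewrite -natr1 lerD2r truncn_le.
have hB : 8 * ((Num.truncn y).+1%:R * G / q) <= 8 * (4 * (2 ^+ n * expR G) * G ^+ 3 + G).
  rewrite ler_pM2l// ler_pdivrMr//.
  apply: (@le_trans _ _ ((y + 1) * G)); first by rewrite ler_wpM2r.
  rewrite mulrDl mul1r mulrDl; apply: lerD; last by rewrite ler_peMr.
  by rewrite /y le_eqVlt; apply/orP; left; apply/eqP; ring.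
apply: (le_trans hB).
have X1 : 1 <= expR x by rewrite -expR0 ler_expR; lra.
have xe : x <= expR x.
  by apply: le_trans (expR_ge1Dx x); rewrite lerDr.
have e16 : 16 <= expR x.
  apply: (@le_trans _ _ (expR 1 ^+ 4)).
    have -> : 16 = 2 ^+ 4 :> R by ring.
    by rewrite lerXn2r ?nnegrE ?expR_ge0// two_le_expR.
  rewrite -expRM_natl mulr1 ler_expR//.
have n2 : 2 ^+ n <= expR x.
  apply: (@le_trans _ _ (expR 1 ^+ n)).
    by rewrite lerXn2r ?nnegrE ?expR_ge0// two_le_expR.
  rewrite -expRM_natl mulr1 ler_expR /x mulrC ler_peMr//; lra.
have eG : expR G <= expR x ^+ 2.
  by rewrite -expRM_natl ler_expR.
have G3 : G ^+ 3 <= 8 * expR x ^+ 3.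
  have -> : 8 = 2 ^+ 3 :> R by ring.
  rewrite -exprMn lerXn2r ?nnegrE ?mulr_ge0 ?expR_ge0//.
  by rewrite (le_trans Gx)// ler_pM2l.
have -> : expR (9 * x) = expR x ^+ 9 by rewrite -expRM_natl.
move: X1 xe e16 n2 eG G3; set X := expR x => X1 xe e16 n2 eG G3.
have X0 : 0 <= X by lra.
(* The three factors are at most [X], [X ^+ 2] and [8 * X ^+ 3], which gives the power 6. As
   [X >= 16], two more powers absorb the factor 256 and one more the sum of two terms: hence the
   exponent 9. *)
have h1 : 2 ^+ n * expR G * G ^+ 3 <= X * X ^+ 2 * (8 * X ^+ 3).
  have t0 : 0 <= 2 ^+ n :> R by exact: exprn_ge0.
  have u0 := expR_ge0 G.
  have h := ler_pM t0 u0 n2 eG.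
  exact: ler_pM (mulr_ge0 t0 u0) (exprn_ge0 3 G0) h G3.
have p2 : 256 <= X ^+ 2.
  have -> : 256 = 16 ^+ 2 :> R by ring.
  by rewrite lerXn2r ?nnegrE.
have p6 : 0 <= X ^+ 6 by rewrite exprn_ge0.
have h2 : 256 * X ^+ 6 <= X ^+ 2 * X ^+ 6 by rewrite ler_wpM2r.
have p8 : 1 <= X ^+ 7 by rewrite exprn_ege1.
have h3 : 16 * X <= X ^+ 8.
  apply: (@le_trans _ _ (X * X)); first by rewrite ler_wpM2r.
  have -> : X ^+ 8 = X * X * X ^+ 6 by ring.
  by rewrite ler_peMr ?mulr_ge0// exprn_ege1.
have h4 : 2 * X ^+ 8 <= X ^+ 9.
  have -> : X ^+ 9 = X * X ^+ 8 by ring.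
  rewrite ler_wpM2r ?exprn_ge0//; lra.
apply: (@le_trans _ _ (X ^+ 9)).
  apply: le_trans h4.
  have -> : 8 * (4 * (2 ^+ n * expR G) * G ^+ 3 + G) =
     32 * (2 ^+ n * expR G * G ^+ 3) + 8 * G by ring.
  have e8 : X ^+ 2 * X ^+ 6 = X ^+ 8 by ring.
  have e6 : X * X ^+ 2 * (8 * X ^+ 3) = 8 * X ^+ 6 by ring.
  lra.
rewrite mulrCA ler_peMr ?exprn_ge0// -[leLHS]mulr1 ler_pM//.
rewrite ler_pdivlMr// mul1r -[leLHS]mulr1 ler_pM//; lra.
Qed.

Lemma martingale_lln_jump (R : realType) (n : nat) (d : measure_display)
    (Omega : measurableType d) (P : probability Omega R)
    (xi : 'I_n * nat -> {RV P >-> R}) (E : rel 'I_n) (T Rmax : R)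
    (upd : 'I_n -> R -> R -> R) (rho : {ffun 'I_n -> bool}) (N : nat) :
  (forall (s : seq ('I_n * nat)) (B : 'I_n * nat -> set R),
    uniq s -> (forall p, measurable (B p)) ->
    P (\bigcap_(p in [set` s]) (xi p @^-1` B p)) =
    (\prod_(p <- s) P (xi p @^-1` B p))%E) ->
  (forall p B, measurable B -> distribution P (xi p) B = exponential_prob 1 B) ->
  0 <= T -> 0 <= Rmax ->
  (forall i, measurable_fun setT (fun y : R * R => upd i y.1 y.2)) ->
  (forall i x y, 0 <= upd i x y <= Rmax) ->
  (0 < n)%N -> (0 < N)%N ->
  {ae P, forall w, forall e, 0 < e -> exists m0, forall m, (m0 <= m)%N ->
    `|martingale (potential_jump E (n%:R * expR Rmax) N)
        (run E T upd rho (clock_sample xi w)) m| <= e * m%:R}.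
Proof.
move=> indep exp_xi T0 R0 mupd bupd n0 N0.
set q := n%:R * expR Rmax.
have mR m := measurable_run_clock E T mupd rho m.
apply: (@martingale_lln _ _ _ _ _ _ indep exp_xi E T Rmax upd T0 R0 mupd bupd rho
  _ (2 * (N%:R * (n%:R * Rmax) / q))).
- move=> m i.
  have mF s : measurable_fun [set: clock_space R n] (fun z : clock_space R n =>
      potential E q N (par (run E T upd rho z m)) (ring_at E s i) -
      potential E q N (par (run E T upd rho z m)) s).
    by apply: measurable_funB; apply: measurable_potential => k; exact: m_par (mR m) k.
  exact: (measurable_switch (m_sched (mR m)) mF).
- move=> m z i; rewrite (le_trans (ler_normB _ _))// mulrDl mul1r.
  by apply: lerD; apply: potential_bound => // k; exact: par_run.
Qed.

Theorem theorem4 (R : realType) :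
  exists c1 c2 c3 c4 : R, [/\ 0 < c1, c1 <= c2, 0 < c3 & c3 <= c4] /\
  forall (n : nat) (E : rel 'I_n) (U : 'I_n -> R -> R) (eps alpha : R),
    (0 < n)%N -> symmetric E -> irreflexive E ->
    (forall i, utility (U i)) ->
    0 < eps -> 0 < alpha < 1 ->
    let beta := 4 * n%:R / eps in
    let V := max_slope U in
    exists T : R,
    (exists a b : R, [/\ c1 <= a <= c2, c3 <= b <= c4 &
       T = expR (a * (beta * n%:R * V)) *
           (b * ((beta * V + alpha) * n%:R ^+ 2 / (beta * eps)))]) /\
    forall (d : measure_display) (Omega : measurableType d)
      (P : probability Omega R) (xi : 'I_n -> nat -> {RV P >-> R})
      (sigma : Omega -> R -> {ffun 'I_n -> bool})
      (r lam : Omega -> 'I_n -> nat -> R) (Q : Omega -> 'I_n -> R -> R),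
      congestion_control E U alpha beta T xi sigma r lam Q ->
      (forall w t i, 0 <= t ->
         Q w i t <= T * (beta * V + 2 * alpha) / alpha) /\
      forall lstar : 'I_n -> R, utility_optimum E U lstar ->
        {ae P, forall w,
          ((\sum_(i < n) U i (lstar i) - eps)%:E <=
           limn_einf (fun J => (\sum_(i < n) U i (average (lam w i) J))%:E))%E}.
Proof.
exists 9, 9, 1, 1; split; first by split.
move=> n E U eps alpha n0 symE irrE utU eps0 alpha01 beta V.
have /andP[alpha0 alpha1] := alpha01.
have n0' : 0 < n%:R :> R by rewrite ltr0n.
have beta0 : 0 < beta by rewrite divr_gt0// mulr_gt0.
have beta_eps : beta * eps = 4 * n%:R by rewrite /beta divfK// gt_eqF.
have V0 : 0 <= V by exact: max_slope_ge0.
have bV0 : 0 <= beta * V by rewrite mulr_ge0// ltW.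
pose T := expR (9 * (beta * n%:R * V)) *
  (1 * ((beta * V + alpha) * n%:R ^+ 2 / (beta * eps))).
have bVa0 : 0 < beta * V + alpha by rewrite ltr_wpDl.
have T0 : 0 < T.
  apply: mulr_gt0; first exact: expR_gt0.
  by rewrite mul1r; apply: divr_gt0; apply: mulr_gt0 => //; exact: exprn_gt0.
exists T; split; first by exists 9, 1; rewrite !lexx.
move=> d Omega P xi sigma r lam Q cc; split.
  move=> w t i t0.
  exact: (queue_bound utU alpha0 beta0 T0 (cc_parameters cc w) (cc_queue cc w i)).
move=> l [capl _].
have lamb w i j := lam_itv (cc_parameters cc w) i j.
have [small|large] := leP (n%:R * V) eps.
  apply: aeW => w; apply: (@le_limn_einf _ _ _ 1%N) => J J0.
  rewrite lerBlDr -lerBlDl -sumrB; apply: le_trans small.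
  have -> : n%:R * V = \sum_(i < n) V by rewrite sumr_const card_ord mulr_natl.
  apply: ler_sum => i _; apply: le_trans (deriv01_le_max_slope U i).
  by apply: (utility_osc (utU i)); [exact: capacity_itv capl|exact: average_itv].
have bV4 : 4 <= beta * V.
  rewrite /beta mulrAC ler_pdivlMr// -mulrA ler_pM2l//; exact: ltW.
have [N [N0 N_large B_small]] := iteration_number n0 alpha01 bV4.
have TE : T = expR (9 * (beta * V * n%:R)) * ((beta * V + alpha) * n%:R / 4).
  rewrite /T beta_eps mul1r; congr (_ * _); first by rewrite [beta * V * _]mulrAC.
  by field; rewrite gt_eqF.
rewrite -TE in B_small.
pose Rmax := beta * V + alpha.
have R0 : 0 <= Rmax by rewrite addr_ge0// ltW.
pose upd := rate_update U alpha beta T Rmax.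
pose xi' (p : 'I_n * nat) := xi p.1 p.2.
have indep := clocks_independent (fun rho => cc_measurable cc rho (lexx 0)) (cc_clocks cc).
have exp_xi p B : measurable B -> distribution P (xi' p) B = exponential_prob 1 B.
  exact: (clocks_exp (cc_clocks cc)).
have mupd i := measurable_rate_update U alpha beta T Rmax i.
have bupd i x y : 0 <= upd i x y <= Rmax by exact: rate_update_bound.
(* The null sets must not depend on the initial schedule, which is known only once [w] is chosen. *)
have ties := ae_forall_countable (fun rho =>
  no_ties (xi := xi') indep exp_xi E (ltW T0) mupd rho).
have jumps := ae_forall_countable (fun rho =>
  martingale_lln_jump (xi := xi') E rho indep exp_xi (ltW T0) R0 mupd bupd n0 N0).
have counts : {ae P, forall w rho e, 0 < e -> exists m0, forall m, (m0 <= m)%N ->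
    `|martingale (fun _ _ => 1) (run E T upd rho (clock_sample xi' w)) m| <= e * m%:R}.
  apply: ae_forall_countable => rho.
  apply: (martingale_lln (Hb := 1) indep exp_xi (ltW T0) R0 mupd bupd) => //.
  by move=> *; rewrite normr1.
apply: filterS3 ties jumps counts => w tie jump count.
have [tau csmaP] := cc_csma cc w.
have [J0 hJ] := @average_utility_eventually _ _ E U symE irrE n0 utU alpha beta T eps
  alpha0 alpha1 beta0 T0 beta_eps (fun i k => xi i k w) (sigma w) tau (r w) (lam w)
  (cc_parameters cc w) csmaP (tie (sigma w 0)) N N0 N_large B_small
  (jump (sigma w 0)) (count (sigma w 0)) l capl.
exact: le_limn_einf hJ.
Qed.
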